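(* Let $F|K$ be a one-dimensional separable function field of characteristic $2$, of genus $3$ and geometric genus $1$, that admits a prime $\mathfrak p$ of singularity degree $2$ whose restriction $\mathfrak p_1$ to the first Frobenius pullback $F_1|K=F^2K|K$ is rational, and let $j$ be the $j$-invariant of $F_1|K$. (a) If $j=0$, then the functions $x,y,z$ in the normal form ($\mathrm{A}$) of the context are uniquely determined up to the transformations \[ x=\alpha^{-4}x'+\sigma^2,\quad y=\alpha^{-6}y'+\sigma\alpha^{-4}x'+\tau,\quad z=\alpha z'+\gamma x'+\delta \] where $\alpha\in K^*$ and $\sigma,\tau,\gamma,\delta\in K$, which imply the transformation rules \[ \alpha^{-6}a'=a,\quad \alpha^{-8}a_4'=a_4+\sigma a+\sigma^4,\quad \alpha^{-12}a_6'=a_6+\sigma^2a_4+\tau a+\sigma^6+\tau^2, \] \[ \alpha^2b'=\alpha^{-8}b+\gamma^2,\quad \alpha^2d'=d+\sigma^4b+\sigma^2a^{-1}+\delta^2. \] (b) If $j\neq0$, then the functions $x,y,z$ in the normal form ($\mathrm{B}$) of the context are uniquely determined up to the transformations \[ x=x',\quad y=y'+\sigma x',\quad z=\alpha z'+\beta y'+\gamma x' \] where $\alpha\in K^*$, $\sigma,\beta,\gamma\in K$ and $\beta^2\sigma^2+(b+\beta^2)\sigma+\gamma^2+a\beta^2=0$, which imply the transformation rules \[ \eta'=\eta,\quad a'=a+\sigma+\sigma^2,\quad \alpha^2b'=b+\beta^2,\quad \alpha^2c'=c. \] Here ''uniquely determined up to'' means: given one triple $(x,y,z)$ in normal form with its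 coefficients, the triples $(x',y',z')$ in normal form (with corresponding primed coefficients) are exactly those related to $(x,y,z)$ by such a transformation, and the coefficients are then related by the stated rules. (This is a criterion for two function fields to be isomorphic: two such function fields in the same normal form are isomorphic over $K$ if and only if their coefficients are related by the stated rules for some constants $\alpha\in K^*$ and $\sigma,\tau,\gamma,\delta\in K$ in the case of normal form ($\mathrm{A}$), respectively for some constants $\alpha\in K^*$ and $\sigma,\beta,\gamma\in K$ satisfying $\beta^2\sigma^2+(b+\beta^2)\sigma+\gamma^2+a\beta^2=0$ in the case of normal form ($\mathrm{B}$).)
   Context: A one-dimensional separable function field $F|K$ is a finitely generated separable field extension of transcendence degree one in which $K$ is algebraically closed; its primes are its discrete rank one valuations trivial on $K$. The geometric genus is the genus of $F\overline K|\overline K$. The singularity degree of a prime $\mathfrak p$ with valuation ring $\mathcal O_{\mathfrak p}$ is the $\overline K$-dimension of the quotient of the integral closure of $\mathcal O_{\mathfrak p}\otimes_K\overline K$ by $\mathcal O_{\mathfrak p}\otimes_K\overline K$. $F_1=F^2K$ is the compositum of $K$ and the field of squares of $F$; it has genus one and, with the rational prime $\mathfrak p_1$, is an elliptic function field with a $j$-invariant. It is known that functions $x,y,z\in F$ in the following normal forms exist. Normal form (A), if $j=0$: $F_1=K(x,y)$ with $y^2+ay=x^3+a_4x+a_6$, $a\in K^*$, $a_4,a_6\in K$, and $F=F_1(z)$ with $z^2=bx^2+a^{-1}x+d$, $b\in K\setminus K^2$, $d\in K$. Normal form (B), if $j\ne0$: $F_1=K(x,y)$ with $y^2+xy=x^3+ax^2+\eta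 x$, $a\in K$, $\eta\in K^*$, $j=\eta^{-2}$, and $F=F_1(z)$ with $z^2=by^2+abx^2+cx$, $b\in K\setminus K^2$, $c\in K^*$. In the transformations, $x',y',z'$ satisfy the same equations with modified coefficients $a',a_4',a_6',b',d'$, respectively $a',\eta',b',c'$. *)

(* Defs.v *)
From HB Require Import structures.
From mathcomp Require Import all_boot all_order all_algebra all_field.
From mathcomp Require Import boolp classical_sets cardinality fsbigop.

Set Implicit Arguments.
Unset Strict Implicit.
Unset Printing Implicit Defensive.

Import Order.TTheory GRing.Theory Num.Theory.

Local Open Scope classical_set_scope.
Local Open Scope ring_scope.

(* A field extension F|K is given by its structure morphism k : K -> F, and   *)
(* its intermediate fields and subrings are sets of elements of F.            *)

Definition gen_subfield (F : fieldType) (S : set F) : set F :=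
  smallest (fun L : set F => divring_closed [in L]) S.

Definition gen_subring (F : fieldType) (S : set F) : set F :=
  smallest (fun A : set F => subring_closed [in A]) S.

Definition integral_closure (F : fieldType) (A : set F) : set F :=
  [set f | exists p : {poly F},
     [/\ p \is monic, (forall n, A p`_n) & root p f]].

Definition separable_over (F : fieldType) (L : set F) (f : F) : Prop :=
  exists p : {poly F}, [/\ separable_poly p, (forall n, L p`_n) & root p f].

Section Extension.
Variables (K F : fieldType) (k : {rmorphism K -> F}).

Definition adjoin (S : set F) : set F := gen_subfield (range k `|` S).

(* For f.g. extensions of transcendence degree one, separability of F|K is    *)
(* the existence of a separating element t.                                   *)
Definition separable_function_field : Prop :=
  [/\ (exists s : seq F, adjoin [set` s] = setT),
      (exists t : F, ~ algebraicOver k t /\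
         forall f, separable_over (adjoin [set t]) f)
    & forall f, algebraicOver k f -> exists c, f = k c].

(* dim_K (V / W) = n, for K-subspaces W of V. *)
Definition is_quotient_dim (V W : set F) (n : nat) : Prop :=
  W `<=` V /\
  exists e : 'I_n -> F, (forall i, V (e i)) /\
    forall f, V f -> exists! c : 'rV[K]_n, W (f - \sum_i k (c 0 i) * e i).

(* 0 by convention if V / W is infinite dimensional. *)
Definition quotient_dim (V W : set F) : nat :=
  xget 0%N [set n | is_quotient_dim V W n].

(* Normalized discrete valuations of F trivial on K, one for each prime of    *)
(* F|K; the junk value at 0 makes equality of primes the equality of the      *)
(* underlying functions.                                                      *)
Record fprime : Type := Prime {
  val_of :> F -> int;
  val_of0 : val_of 0 = 0;
  val_ofM : forall f g, f != 0 -> g != 0 -> val_of (f * g) = val_of f + val_of g;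
  val_ofD : forall f g, f != 0 -> g != 0 -> f + g != 0 ->
    Num.min (val_of f) (val_of g) <= val_of (f + g);
  val_ofK : forall c, c != 0 -> val_of (k c) = 0;
  val_of_normalized : exists t, val_of t = 1 }.

HB.instance Definition _ := gen_eqMixin fprime.
HB.instance Definition _ := gen_choiceMixin fprime.

Definition valuation_ring (p : fprime) : set F := [set f | f = 0 \/ 0 <= p f].

Definition maximal_ideal (p : fprime) : set F := [set f | f = 0 \/ 0 < p f].

Definition prime_degree (p : fprime) : nat :=
  quotient_dim (valuation_ring p) (maximal_ideal p).

Record divisor : Type := Divisor {
  mult_of :> fprime -> int;
  mult_of_finite : finite_set [set p | mult_of p != 0] }.

Definition degree (D : divisor) : int :=
  \sum_(p \in [set: fprime]) D p * (prime_degree p)%:Z.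

Definition riemann_roch_space (D : divisor) : set F :=
  [set f | f = 0 \/ forall p : fprime, 0 <= p f + D p].

Definition ell (D : divisor) : nat :=
  quotient_dim (riemann_roch_space D) [set 0].

(* The genus is the maximum of deg D - ell D + 1 over all divisors D. *)
Definition is_genus (g : nat) : Prop :=
  (exists D : divisor, degree D - (ell D)%:Z + 1 = g%:Z) /\
  (forall D : divisor, degree D - (ell D)%:Z + 1 <= g%:Z).

(* F_1 = F^2 K *)
Definition frobenius_pullback : set F := adjoin [set f ^+ 2 | f in [set: F]].

(* The residue field of the restriction of p to the subfield L is K. *)
Definition rational_restriction (p : fprime) (L : set F) : Prop :=
  quotient_dim (valuation_ring p `&` L) (maximal_ideal p `&` L) = 1%N.

(* j is the j-invariant of the elliptic function field L|K whose origin is    *)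
(* the restriction of p to L: it is read off any Weierstrass equation of L|K  *)
(* whose functions have their pole at that prime.                             *)
Definition is_j_invariant (p : fprime) (L : set F) (j : K) : Prop :=
  exists (x y : F) (a1 a2 a3 a4 a6 : K),
    let b2 := a1 ^+ 2 + 4 * a2 in
    let b4 := 2 * a4 + a1 * a3 in
    let b6 := a3 ^+ 2 + 4 * a6 in
    let b8 := a1 ^+ 2 * a6 + 4 * a2 * a6 - a1 * a3 * a4 + a2 * a3 ^+ 2
              - a4 ^+ 2 in
    let c4 := b2 ^+ 2 - 24 * b4 in
    let disc := - b2 ^+ 2 * b8 - 8 * b4 ^+ 3 - 27 * b6 ^+ 2
                + 9 * b2 * b4 * b6 in
    [/\ L = adjoin [set x; y],
        y ^+ 2 + k a1 * x * y + k a3 * y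
          = x ^+ 3 + k a2 * x ^+ 2 + k a4 * x + k a6,
        ~ valuation_ring p x,
        disc != 0
      & j = c4 ^+ 3 / disc].

Definition normal_form_A (x y z : F) (a a4 a6 b d : K) : Prop :=
  [/\ frobenius_pullback = adjoin [set x; y],
      y ^+ 2 + k a * y = x ^+ 3 + k a4 * x + k a6 /\ a != 0,
      gen_subfield (frobenius_pullback `|` [set z]) = setT,
      z ^+ 2 = k b * x ^+ 2 + k a^-1 * x + k d
    & ~ exists e : K, b = e ^+ 2].

Definition normal_form_B (j : K) (x y z : F) (a eta b c : K) : Prop :=
  [/\ frobenius_pullback = adjoin [set x; y],
      y ^+ 2 + x * y = x ^+ 3 + k a * x ^+ 2 + k eta * x,
      eta != 0 /\ j = eta ^- 2,
      gen_subfield (frobenius_pullback `|` [set z]) = setT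
    & [/\ z ^+ 2 = k b * y ^+ 2 + k (a * b) * x ^+ 2 + k c * x,
          ~ (exists e : K, b = e ^+ 2) & c != 0]].

Definition transformation_A (x y z x' y' z' : F)
    (alpha sigma tau gamma delta : K) : Prop :=
  [/\ x = k (alpha ^- 4) * x' + k (sigma ^+ 2),
      y = k (alpha ^- 6) * y' + k (sigma * alpha ^- 4) * x' + k tau
    & z = k alpha * z' + k gamma * x' + k delta].

Definition transformation_B (x y z x' y' z' : F)
    (alpha sigma beta gamma : K) : Prop :=
  [/\ x = x',
      y = y' + k sigma * x'
    & z = k alpha * z' + k beta * y' + k gamma * x'].

(* A compositum of F with an algebraic closure Kbar of K.                     *)
(* When F|K is regular, F and Kbar are linearly disjoint over K in any common *)
(* overfield, so that F (x)_K Kbar embeds into any such compositum.           *)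
Record closure_extension : Type := ClosureExtension {
  Kbar : closedFieldType;
  K_Kbar : {rmorphism K -> Kbar};
  K_Kbar_algebraic : forall c, algebraicOver K_Kbar c;
  FKbar : fieldType;
  F_FKbar : {rmorphism F -> FKbar};
  Kbar_FKbar : {rmorphism Kbar -> FKbar};
  closure_extension_comm : forall c, F_FKbar (k c) = Kbar_FKbar (K_Kbar c);
  closure_extension_gen :
    gen_subfield (range F_FKbar `|` range Kbar_FKbar) = setT }.

End Extension.

Arguments is_quotient_dim {K F} k V W n.
Arguments quotient_dim {K F} k V W.

Section GeometricInvariants.
Variables (K F : fieldType) (k : {rmorphism K -> F}).

Definition is_geometric_genus (E : closure_extension k) (g : nat) : Prop :=
  is_genus (Kbar_FKbar E) g.

(* The image of O_p (x)_K Kbar in F Kbar. *)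
Definition extended_ring (E : closure_extension k) (p : fprime k) :
    set (FKbar E) :=
  gen_subring (F_FKbar E @` valuation_ring p `|` range (Kbar_FKbar E)).
Arguments extended_ring : clear implicits.

Definition singularity_degree (E : closure_extension k) (p : fprime k) : nat :=
  quotient_dim (Kbar_FKbar E)
    (integral_closure (extended_ring E p)) (extended_ring E p).

Definition genus3_setting (j : K) : Prop :=
  [/\ 2%N \in [pchar K],
      separable_function_field k,
      is_genus k 3
    & exists E : closure_extension k, is_geometric_genus E 1 /\
      exists p : fprime k,
        [/\ singularity_degree E p = 2%N,
            rational_restriction p (frobenius_pullback k)
          & is_j_invariant p (frobenius_pullback k) j]].

End GeometricInvariants.

Definition rules_A (K : fieldType) (a a4 a6 b d a' a4' a6' b' d' : K)
    (alpha sigma tau gamma delta : K) : Prop :=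
  [/\ alpha ^- 6 * a' = a,
      alpha ^- 8 * a4' = a4 + sigma * a + sigma ^+ 4,
      alpha ^- 12 * a6'
        = a6 + sigma ^+ 2 * a4 + tau * a + sigma ^+ 6 + tau ^+ 2,
      alpha ^+ 2 * b' = alpha ^- 8 * b + gamma ^+ 2
    & alpha ^+ 2 * d' = d + sigma ^+ 4 * b + sigma ^+ 2 * a^-1 + delta ^+ 2].

Definition constraint_B (K : fieldType) (a b sigma beta gamma : K) : Prop :=
  beta ^+ 2 * sigma ^+ 2 + (b + beta ^+ 2) * sigma + gamma ^+ 2
    + a * beta ^+ 2 = 0.

Definition rules_B (K : fieldType) (a eta b c a' eta' b' c' : K)
    (alpha sigma beta : K) : Prop :=
  [/\ eta' = eta,
      a' = a + sigma + sigma ^+ 2,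
      alpha ^+ 2 * b' = b + beta ^+ 2
    & alpha ^+ 2 * c' = c].

Definition isomorphic_over (K F F' : fieldType)
    (k : {rmorphism K -> F}) (k' : {rmorphism K -> F'}) : Prop :=
  exists phi : {rmorphism F -> F'},
    bijective phi /\ forall c, phi (k c) = k' c.

(* Main.v *)
From HB Require Import structures.
Require Import Defs.
From Stdlib Require Import Ring.
From Stdlib Require BinNat.
From mathcomp Require Import all_boot all_order all_algebra.
From mathcomp Require Import boolp classical_sets.
From mathcomp Require Import ring zify.

Set Implicit Arguments.
Unset Strict Implicit.
Unset Printing Implicit Defensive.

Import Order.TTheory GRing.Theory Num.Theory.
Local Open Scope classical_set_scope.
Local Open Scope ring_scope.

(** The transformations are affine changes of coordinates, so that everything
    about them is a comparison of coefficients, except for one point: two triples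
    [(x, y, z)] and [(x', y', z')] in normal form must have their poles at the same
    place of the elliptic function field [F1 = K(x, y) = K(x', y')].

    That point is [same_pole_A] and [same_pole_B].  Write [z' = u + w z] with [u]
    and [w] in [F1].  Squaring puts this into [F1], where it may be differentiated
    by the invariant derivation [D] of the Weierstrass equation
    ([invariant_derivation]); squares have derivative zero, so [w^2] is read off
    from [D x'] and is, up to explicit factors, the ratio of the two invariant
    differentials.  This ratio is regular at all places where [x] is
    ([invariant_ratio_A], [invariant_ratio_B], by [derivation_unramified]), so it
    cannot vanish at the pole of [x], an element without poles being constant.  If
    [x'] were regular at that pole, the term of [z^2] with the coefficient [b] would
    dominate in [u^2 = z'^2 + w^2 z^2], and [b] would be a square in the residue
    field.  But that field is [K] ([pole_square]), and [b] is not a square in [K].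

    Once the poles agree, [x'] and [y'] are regular away from the pole of [x].  The
    curve being smooth, such functions are polynomials in [x] and [y]
    ([smooth_affine_const], [smooth_affine_X]), and comparing pole orders leaves
    affine expressions ([change_of_coordinates]); the same holds for [u], whose
    square is an explicit polynomial ([small_pole]).  The equations then determine
    the coefficients ([transformation_A_exists], [transformation_B_exists]), and
    conversely the rules make the equations correspond ([normal_form_A_transfer],
    [normal_form_B_transfer]).

    Geometric facts are obtained from valuation rings: Chevalley's theorem
    ([valuation_ring_separation]) says that a non-integral element has a pole, and
    the pole of [x] is analysed by leading terms, [x] and [y] having pole orders 2
    and 3.

    For the isomorphism criterion, an isomorphism carries a normal form to a normal
    form in the other field.  Conversely two fields with generators in the same
    normal form are isomorphic, because [K(x)], [K(x, y)] and [K(x, y, z)] are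
    successive quadratic extensions given by the same equations
    ([tower_isomorphism]). *)

(** * Identities in characteristic two *)

Section CharTwo.
Variable F : fieldType.
Hypothesis h2 : 2%:R = 0 :> F.
Implicit Types a b c : F.

Lemma char2_addxx a : a + a = 0.
Proof. by rewrite -mulr2n -mulr_natr h2 mulr0. Qed.
Lemma char2_oppx a : - a = a.
Proof. by apply/eqP; rewrite eq_sym -addr_eq0 char2_addxx. Qed.
Lemma char2_eqD a b : a + b = 0 -> a = b.
Proof. by move=> /eqP; rewrite addr_eq0 char2_oppx => /eqP. Qed.
Lemma char2_sqrD a b : (a + b) ^+ 2 = a ^+ 2 + b ^+ 2.
Proof. by rewrite sqrrD mulr2n char2_addxx addr0. Qed.
(** Copies of the operations of [F] whose types mention only the carrier of [F],
    so that [ring] meets each operation in a single syntactic form; the opposite is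
    the identity. *)
Definition add2 a b : F := a + b.
Definition mul2 a b : F := a * b.
Definition opp2 a : F := a.
Definition zero2 : F := 0.
Definition one2 : F := 1.
Definition exp2 a (n : nat) : F := a ^+ n.
Definition of_bool2 (e : bool) : F := if e then one2 else zero2.

Lemma add2E a b : a + b = add2 a b. Proof. by []. Qed.
Lemma mul2E a b : a * b = mul2 a b. Proof. by []. Qed.
Lemma zero2E : 0 = zero2. Proof. by []. Qed.
Lemma one2E : 1 = one2. Proof. by []. Qed.
Lemma exp2E a n : a ^+ n = exp2 a n. Proof. by []. Qed.

Lemma char2_ring_theory : ring_theory zero2 one2 add2 mul2 add2 opp2 (@eq F).
Proof.
by split=> //; [exact: add0r|exact: addrC|exact: addrA|exact: mul1r|exact: mulrC
  |exact: mulrA|exact: mulrDl|exact: char2_addxx].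
Qed.

(** Booleans as coefficients reduce the integer coefficients modulo 2. *)
Lemma char2_ring_morph : ring_morph zero2 one2 add2 mul2 add2 opp2 (@eq F)
  false true xorb andb xorb id Bool.eqb of_bool2.
Proof.
constructor=> //.
- by case; case; rewrite /= /add2 ?addr0 ?add0r ?char2_addxx.
- by case; case; rewrite /= /add2 ?addr0 ?add0r ?char2_addxx.
- by case; case; rewrite /= /mul2 ?mulr0 ?mul0r ?mulr1.
- by case; case.
Qed.

Lemma char2_power_theory : power_theory one2 mul2 (@eq F) nat_of_bin exp2.
Proof.
split=> a [|n] //=; elim: n => [n IH|n IH|] /=; rewrite /exp2 /mul2 /=.
- by rewrite NatTrec.doubleE exprS -addnn exprD -IH.
- by rewrite NatTrec.doubleE -addnn exprD -IH.
- by rewrite expr1.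
Qed.

(** [ring] looks its structure up by the type of the left-hand side, which is
    syntactically [F] for a variable [u]. *)
Lemma char2_eq a b : (forall u : F, u = add2 u (add2 a b)) -> a = b.
Proof. by move=> /(_ 0); rewrite /add2 add0r => /esym/char2_eqD. Qed.

Lemma char2_eq_lin c a' b' a b : a' = b' -> a + b = c * (a' + b') -> a = b.
Proof. by move=> -> ab; apply: char2_eqD; rewrite ab char2_addxx mulr0. Qed.

End CharTwo.

Ltac char2_constant t :=
  lazymatch t with
  | zero2 _ => constr:(false)
  | one2 _ => constr:(true)
  | _ => constr:(InitialRing.NotConstant)
  end.

Ltac is_nat_constant n :=
  lazymatch n with O => true | S ?n => is_nat_constant n | _ => false end.

Ltac char2_exponent t :=
  lazymatch is_nat_constant t with
  | true => let r := eval compute in (BinNat.N.of_nat t) in r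
  | _ => constr:(InitialRing.NotConstant)
  end.

Tactic Notation "char2_ring" constr(h) :=
  rewrite ?(char2_oppx h) ?exp2E ?mul2E ?add2E ?one2E ?zero2E;
  apply: (char2_eq h); intro;
  let G := Get_goal in ring_lookup (PackRing Ring_gen) [] G.

(** * Subrings and generated subfields *)

Definition is_subring (F : fieldType) (A : set F) : Prop :=
  [/\ A 1, forall f g, A f -> A g -> A (f - g)
    & forall f g, A f -> A g -> A (f * g)].

Definition is_subfield (F : fieldType) (L : set F) : Prop :=
  is_subring L /\ forall f, L f -> L f^-1.

Definition is_valuation_ring (F : fieldType) (O : set F) : Prop :=
  is_subring O /\ forall f, O f \/ O f^-1.

Section Subrings.
Variable F : fieldType.
Implicit Types (A B L O : set F) (f g : F).

Section SubringTheory.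
Variables (A : set F) (hA : is_subring A).

Lemma subring1 : A 1. Proof. by case: hA. Qed.
Lemma subringB f g : A f -> A g -> A (f - g). Proof. by case: hA => _ H _; exact: H. Qed.
Lemma subringM f g : A f -> A g -> A (f * g). Proof. by case: hA => _ _; exact. Qed.
Lemma subring0 : A 0. Proof. by rewrite -(subrr 1); apply: subringB; exact: subring1. Qed.
Lemma subring_bool (b : bool) : A b%:R.
Proof. by case: b; [exact: subring1|exact: subring0]. Qed.
Lemma subringN f : A f -> A (- f).
Proof. by move=> Af; rewrite -sub0r; apply: subringB => //; exact: subring0. Qed.
Lemma subringD f g : A f -> A g -> A (f + g).
Proof. by move=> Af Ag; rewrite -[g]opprK; apply/subringB/subringN. Qed.
Lemma subringX f n : A f -> A (f ^+ n).
Proof.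
by move=> Af; elim: n => [|n IH]; rewrite ?expr0 ?exprS; [exact: subring1|exact: subringM].
Qed.
Lemma subring_sum (I : Type) (r : seq I) (P : pred I) (E : I -> F) :
  (forall i, P i -> A (E i)) -> A (\sum_(i <- r | P i) E i).
Proof. by move=> AE; elim/big_ind: _ => //; [exact: subring0|exact: subringD]. Qed.

End SubringTheory.

Lemma is_subfieldP L : divring_closed [in L] <-> is_subfield L.
Proof.
split=> [[L1 LB LD]|[[L1 LB LM] LV]].
  have {}L1 : L 1 by exact: set_mem.
  have {}LD f g : L f -> L g -> L (f / g).
    by move=> Lf Lg; apply/set_mem/LD; exact/mem_set.
  have LV f : L f -> L f^-1 by move=> Lf; rewrite -div1r; exact: LD.
  split=> //; split=> // f g Lf Lg; last by rewrite -[g]invrK; exact/LD/LV.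
  by apply/set_mem/LB; exact/mem_set.
split; first exact/mem_set.
- by move=> f g /set_mem Lf /set_mem Lg; exact/mem_set/LB.
- by move=> f g /set_mem Lf /set_mem Lg; exact/mem_set/LM/LV.
Qed.

Lemma gen_subfield_subfield (S : set F) : is_subfield (gen_subfield S).
Proof.
split; first split.
- by move=> L [/is_subfieldP [[]]].
- by move=> f g Sf Sg L SL; case: (SL) => /is_subfieldP [[_ LB _] _] _; apply: LB; [exact: Sf|exact: Sg].
- by move=> f g Sf Sg L SL; case: (SL) => /is_subfieldP [[_ _ LM] _] _; apply: LM; [exact: Sf|exact: Sg].
- by move=> f Sf L SL; case: (SL) => /is_subfieldP [_ LV] _; apply: LV; exact: Sf.
Qed.

Lemma gen_subfield_min (S L : set F) :
  is_subfield L -> S `<=` L -> gen_subfield S `<=` L.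
Proof. by move=> /is_subfieldP hL; exact: smallest_sub. Qed.

Lemma gen_subfield_sub (S : set F) : S `<=` gen_subfield S.
Proof. exact: sub_gen_smallest. Qed.

End Subrings.

(** * Valuation rings and integrality *)

Section Chevalley.
Variable F : fieldType.
Implicit Types (A B O : set F) (f g : F).

Definition coefs_in B (P : {poly F}) : Prop := forall i, B P`_i.

Definition adjoin_ring B g : set F :=
  [set f | exists2 P, coefs_in B P & f = P.[g]].

Lemma adjoin_ring_subring B g : is_subring B -> is_subring (adjoin_ring B g).
Proof.
move=> hB; split.
- exists 1%:P; last by rewrite hornerC.
  by move=> i; rewrite coefC; case: ifP => _; [exact: subring1|exact: subring0].
- move=> _ _ [P BP ->] [Q BQ ->]; exists (P - Q); last by rewrite hornerD hornerN.
  by move=> i; rewrite coefB; exact: subringB.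
- move=> _ _ [P BP ->] [Q BQ ->]; exists (P * Q); last by rewrite hornerM.
  by move=> i; rewrite coefM; apply: subring_sum => // j _; exact: subringM.
Qed.

Lemma sub_adjoin_ring B g : is_subring B -> B `<=` adjoin_ring B g.
Proof.
move=> hB f Bf; exists f%:P; last by rewrite hornerC.
by move=> i; rewrite coefC; case: ifP => // _; exact: subring0.
Qed.

Lemma adjoin_ring_gen B g : is_subring B -> adjoin_ring B g g.
Proof.
move=> hB; exists 'X; last by rewrite hornerX.
by move=> i; rewrite coefX; exact: subring_bool.
Qed.

Lemma horner_rev g n (P : {poly F}) : g != 0 -> (size P <= n.+1)%N ->
  g ^+ n * P.[g^-1] = (\poly_(i < n.+1) P`_(n - i)).[g].
Proof.
move=> g0 sP; rewrite horner_poly (horner_coef_wide _ sP) mulr_sumr.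
rewrite (reindex_inj rev_ord_inj) /=; apply: eq_bigr => i _.
have le : (i <= n)%N by rewrite -ltnS.
rewrite subSS mulrCA; congr (_ * _).
by rewrite -{1}(subnKC le) exprD exprVn mulfK ?expf_neq0.
Qed.

(** Clearing denominators in [f = P.[f^-1]] gives a monic equation for [f]. *)
Lemma nonintegral_adjoin_inv A f :
  is_subring A -> ~ integral_closure A f -> ~ adjoin_ring A f^-1 f.
Proof.
move=> hA nf [P AP fE]; apply: nf.
case: (eqVneq f 0) => [->|f0].
  exists 'X; split; rewrite ?monicX ?rootX //.
  by move=> i; rewrite coefX; exact: subring_bool.
pose n := size P; pose Q := \poly_(i < n.+1) P`_(n - i).
exists ('X^(n.+1) - Q); split.
- rewrite monicE lead_coefDl ?lead_coefXn // size_polyN size_polyXn ltnS.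
  exact: size_poly.
- move=> i; rewrite coefB coefXn coef_poly; apply: subringB => //.
    exact: subring_bool.
  by case: ifP => _ //; exact: subring0.
- by rewrite /root hornerD hornerN hornerXn -horner_rev // -fE -exprSr subrr.
Qed.

(** In a subring that is maximal for not containing [f], the ideal generated
    by [f^-1] lies in the Jacobson radical, which lets one cancel leading terms
    in two relations expressing [1] through [g] and through [g^-1]. *)
Section Maximal.
Variables (O : set F) (f : F).
Hypotheses (hO : is_subring O) (Ofi : O f^-1) (nOf : ~ O f).
Hypothesis maxO : forall B, is_subring B -> O `<=` B -> ~ B f -> B `<=` O.

Let I : set F := [set h | O (f * h)].

Let f0 : f != 0.
Proof. by apply/eqP => f0; apply: nOf; rewrite f0; exact: subring0. Qed.

Let IO h : I h -> O h.
Proof. by move=> Ih; rewrite -[h](mulKf f0); exact: subringM. Qed.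
Let IM h c : I h -> O c -> I (h * c).
Proof. by move=> Ih Oc; rewrite /I /= mulrA; exact: subringM. Qed.
Let IB h h' : I h -> I h' -> I (h - h').
Proof. by move=> Ih Ih'; rewrite /I /= mulrBr; exact: subringB. Qed.
Let I0 : I 0.
Proof. by rewrite /I /= mulr0; exact: subring0. Qed.
Let ID h h' : I h -> I h' -> I (h + h').
Proof. by move=> Ih Ih'; rewrite /I /= mulrDr; exact: subringD. Qed.
Let nI1 : ~ I 1. Proof. by rewrite /I /= mulr1. Qed.

(* A maximal [O] contains [u^-1] for [u = 1 - h], as [u ^+ n] is [1] modulo [I]:
   from [f u^n] in [O] one would get [f] in [O]. *)
Let I_radical h : I h -> O (1 - h)^-1.
Proof.
move=> Ih; pose u := 1 - h.
have Ou : O u by apply: subringB; [|exact: subring1|exact: IO].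
have u0 : u != 0.
  by apply/eqP => /eqP; rewrite subr_eq0 => /eqP h1; apply: nI1; rewrite h1.
apply: (maxO (adjoin_ring_subring u^-1 hO)); [exact: sub_adjoin_ring| |exact: adjoin_ring_gen].
move=> [P OP fE]; pose n := size P.
have Ifun : O (f * u ^+ n).
  rewrite fE mulrC horner_rev // horner_poly; apply: subring_sum => // i _.
  by apply: subringM => //; exact: subringX.
have Iun m : I (1 - u ^+ m).
  elim: m => [|m IH]; first by rewrite subrr.
  rewrite (_ : 1 - _ = (1 - u ^+ m) + h * u ^+ m).
    by apply: ID => //; apply: IM => //; exact: subringX.
  have -> : h = 1 - u by rewrite /u opprB addrC subrK.
  by rewrite exprS (mulrBl _ 1 u) mul1r addrA subrK.
apply: nOf; rewrite -[f]mulr1 -(subrK (u ^+ n) 1) mulrDr.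
by apply: subringD => //; exact: Iun.
Qed.

Let rel n g := exists M, [/\ coefs_in I M, (size M <= n.+1)%N & M.[g] = 1].

Let rel_reduce d k g :
  g != 0 -> rel d.+1 g -> rel k g^-1 -> (k <= d.+1)%N -> rel d g.
Proof.
move=> g0 [M [IM' sM Mg]] [N [IN sN Ng]] kd.
pose N' := \poly_(i < k.+1) N`_(k - i).
have N'g : N'.[g] = g ^+ k by rewrite -horner_rev // Ng mulr1.
have IN' : coefs_in I N' by move=> i; rewrite coef_poly; case: ifP.
pose u := 1 - N'`_k; have Ou : O u^-1 by exact: I_radical.
have u0 : u != 0.
  by apply/eqP => /eqP; rewrite subr_eq0 => /eqP h1; apply: nI1; rewrite h1.
(* The relation in [g^-1] gives [u g^k = T.[g]], where [T] has degree below [k];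
   it replaces the leading term of [M]. *)
pose T := N' - N'`_k *: 'X^k; pose m := M`_d.+1.
exists (M - m *: 'X^(d.+1) + (m * u^-1) *: ('X^(d.+1 - k) * T)); split.
- move=> i; rewrite coefD coefB !coefZ coefXn coefXnM; apply: ID.
    apply: IB; first exact: IM'.
    apply: IM; first exact: IM'.
    exact: subring_bool.
  apply: IM; first by apply: IM => //; exact: IM'.
  case: ifP => _; first exact: subring0.
  rewrite coefB coefZ coefXn; apply: subringB => //; first exact: IO.
  apply: subringM => //; first exact: IO.
  exact: subring_bool.
- apply/leq_sizeP => i di; rewrite coefD coefB !coefZ coefXn coefXnM.
  have -> : M`_i - m * (i == d.+1)%:R = 0.
    move: di; rewrite leq_eqVlt => /predU1P[<-|di].
      by rewrite eqxx mulr1 subrr.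
    by rewrite gtn_eqF // mulr0 subr0 nth_default // (leq_trans sM).
  rewrite ltnNge (leq_trans (leq_subr _ _) di) /= coefB coefZ coefXn add0r.
  rewrite [X in _ * X](_ : _ = 0) ?mulr0 //.
  have : (k <= i - (d.+1 - k))%N by rewrite leq_subRL ?subnK // (leq_trans (leq_subr _ _) di).
  rewrite leq_eqVlt => /predU1P[<-|ki].
    by rewrite eqxx mulr1 subrr.
  by rewrite gtn_eqF // mulr0 subr0 coef_poly ltnNge ki.
- rewrite !(hornerD, hornerN, hornerZ, hornerM, hornerXn) Mg N'g.
  rewrite (_ : g ^+ k - N'`_k * g ^+ k = u * g ^+ k); last by rewrite mulrBl mul1r.
  by rewrite (mulrCA (_ ^+ _) u) (mulrA (m / u) u) mulfVK // -exprD subnK // subrK.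
Qed.

Let rel_absurd n : forall d k g, (d + k <= n)%N -> g != 0 ->
  rel d g -> rel k g^-1 -> False.
Proof.
have rel0 g : ~ rel 0 g.
  move=> [M [IM' /size1_polyC ME Mg]]; apply: nI1.
  by move: Mg; rewrite ME hornerC => <-.
elim: n => [|n IH] [|d] [|k] g //= dkn g0 Hg Hgi; try by [apply: rel0 Hg|apply: rel0 Hgi].
case: (leqP k d) => kd.
  by apply: (IH d k.+1 g) => //; exact: rel_reduce Hgi _.
apply: (IH d.+1 k g) => //; first by move: dkn; rewrite addSn addnS ltnS.
by apply: (@rel_reduce k d.+1); rewrite ?invr_eq0 ?invrK // ltnW.
Qed.

Lemma maximal_valuation_ring : is_valuation_ring O.
Proof.
split=> // g; apply: contrapT => /not_orP [ng ngi].
have g0 : g != 0 by apply/eqP => g0; apply: ng; rewrite g0; exact: subring0.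
have relP h : ~ O h -> exists n, rel n h.
  move=> nh; have [P OP fE] : adjoin_ring O h f.
    apply: contrapT => nf; apply: nh; apply: (maxO (adjoin_ring_subring h hO)) => //.
      exact: sub_adjoin_ring.
    exact: adjoin_ring_gen.
  exists (size P), (f^-1 *: P); split.
  - by move=> i; rewrite coefZ /I /= mulVKf.
  - by rewrite (leq_trans (size_scale_leq _ _)).
  - by rewrite hornerZ -fE mulVf.
have [d Hd] := relP _ ng; have [k Hk] := relP _ ngi.
exact: (@rel_absurd (d + k) d k g).
Qed.

End Maximal.

(** Chevalley's extension theorem, in the form that a valuation ring separates
    [A] from any element which is not integral over it. *)
Lemma valuation_ring_separation A f : is_subring A -> ~ integral_closure A f ->
  exists O, [/\ is_valuation_ring O, A `<=` O & ~ O f].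
Proof.
move=> hA nf.
pose good B := [/\ is_subring B, A `<=` B, B f^-1 & ~ B f].
have good0 : good (adjoin_ring A f^-1).
  split; [exact: adjoin_ring_subring|exact: sub_adjoin_ring|exact: adjoin_ring_gen|].
  exact: nonintegral_adjoin_inv.
(* The empty set is admitted as well, so that the empty chain has a bound. *)
have [|O [gO maxO]] := @Zorn_bigcup F [set B | B !=set0 -> good B].
  move=> C gC totC [b [X CX Xb]].
  have gX Y y : C Y -> Y y -> good Y by move=> CY Yy; apply: gC => //; exists y.
  have [hX AX Xfi _] := gX _ _ CX Xb.
  have join Y Y' y y' : C Y -> C Y' -> Y y -> Y' y' -> exists Z, [/\ C Z, good Z, Z y & Z y'].
    move=> CY CY' Yy Yy'; have [YY'|Y'Y] := totC _ _ CY CY'.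
      by exists Y'; split=> //; [exact: gX CY' Yy'|exact: YY'].
    by exists Y; split=> //; [exact: gX CY Yy|exact: Y'Y].
  split.
  - split.
    + by exists X => //; exact: subring1.
    + move=> g h [Y CY Yg] [Z CZ Zh].
      by have [W [CW [hW _ _ _] Wg Wh]] := join _ _ _ _ CY CZ Yg Zh; exists W => //; exact: subringB.
    + move=> g h [Y CY Yg] [Z CZ Zh].
      by have [W [CW [hW _ _ _] Wg Wh]] := join _ _ _ _ CY CZ Yg Zh; exists W => //; exact: subringM.
  - by move=> a Aa; exists X => //; exact: AX.
  - by exists X.
  - by move=> [Y CY Yf]; have [_ _ _] := gX _ _ CY Yf.
have [O1|nO] := pselect (O !=set0); last first.
  case: (maxO (adjoin_ring A f^-1)) => //; split.
    by move=> b Ob; case: nO; exists b.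
  by move=> /(_ f^-1 (adjoin_ring_gen _ hA)) Ofi; case: nO; exists f^-1.
have [hO AO Ofi nOf] := gO O1.
exists O; split=> //; apply: (@maximal_valuation_ring _ f) => //.
move=> B hB OB nBf; apply: contrapT => nBO; apply: (maxO B); first by split.
by move=> _; split=> //; [move=> a /AO; exact: OB|exact: OB].
Qed.

End Chevalley.

(** Multiply the monic equation of [u^-1] by a power of [u]. *)
Lemma inv_integral (F : fieldType) (B : set F) (u : F) :
  is_subring B -> B u -> integral_closure B u^-1 -> B u^-1.
Proof.
move=> hB Bu [M [monM BM rM]].
have [u0|u0] := eqVneq u 0; first by rewrite u0 invr0; exact: subring0.
have M0 : M != 0 by exact: monic_neq0.
have sM : (1 < size M)%N by exact: root_size_gt1 rM.
pose n := (size M).-2.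
have sME : size M = n.+2 by rewrite /n; case: (size M) sM => [|[]].
have : u ^+ n.+1 * M.[u^-1] = 0 by rewrite (eqP rM) mulr0.
rewrite horner_rev ?sME // horner_poly big_ord_recl expr0 subn0 mulr1.
have -> : M`_n.+1 = 1 by move/monicP: monM; rewrite /lead_coef sME.
move=> /eqP; rewrite addr_eq0 => /eqP e1.
have -> : u^-1 = - \sum_(i < n.+1) M`_(n.+1 - bump 0 i) * u ^+ i.
  apply: (mulfI u0); rewrite mulfV // mulrN mulr_sumr [LHS]e1; congr (- _).
  by apply: eq_bigr => i _; rewrite lift0 exprS mulrCA.
apply: subringN => //; apply: subring_sum => // i _.
by apply: subringM => //; exact: subringX.
Qed.

Lemma valuation_ring_integral (F : fieldType) (O : set F) f :
  is_valuation_ring O -> integral_closure O f -> O f.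
Proof.
move=> hO intf; have [//|Ofi] := hO.2 f.
by rewrite -(invrK f); apply: inv_integral hO.1 Ofi _; rewrite invrK.
Qed.

Lemma integral_closureS (F : fieldType) (A B : set F) :
  A `<=` B -> integral_closure A `<=` integral_closure B.
Proof. by move=> AB f [M [mM AM rM]]; exists M; split=> // n; exact: AB. Qed.

(** * Rational functions and quadratic extensions *)

Section Rational.
Variables (K F : fieldType) (k : {rmorphism K -> F}).
Implicit Types (P Q R : {poly K}) (t f : F).

Definition peval t P : F := (map_poly k P).[t].

Lemma pevalD t P Q : peval t (P + Q) = peval t P + peval t Q.
Proof. by rewrite /peval rmorphD hornerD. Qed.
Lemma pevalN t P : peval t (- P) = - peval t P.
Proof. by rewrite /peval rmorphN hornerN. Qed.
Lemma pevalB t P Q : peval t (P - Q) = peval t P - peval t Q.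
Proof. by rewrite pevalD pevalN. Qed.
Lemma pevalM t P Q : peval t (P * Q) = peval t P * peval t Q.
Proof. by rewrite /peval rmorphM hornerM. Qed.
Lemma pevalZ t c P : peval t (c *: P) = k c * peval t P.
Proof. by rewrite /peval map_polyZ hornerZ. Qed.
Lemma pevalC t c : peval t c%:P = k c.
Proof. by rewrite /peval map_polyC hornerC. Qed.
Lemma pevalX t : peval t 'X = t.
Proof. by rewrite /peval map_polyX hornerX. Qed.
Lemma peval0 t : peval t 0 = 0.
Proof. by rewrite /peval rmorph0 horner0. Qed.
Lemma peval1 t : peval t 1 = 1.
Proof. by rewrite /peval rmorph1 hornerC. Qed.
Lemma pevalXn t P n : peval t (P ^+ n) = peval t P ^+ n.
Proof. by rewrite /peval rmorphXn horner_exp. Qed.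

Definition pevalE := (pevalD, pevalN, pevalM, pevalZ, pevalC, pevalX, peval0,
  peval1, pevalXn).

Lemma peval_in (A : set F) t P :
  is_subring A -> range k `<=` A -> A t -> A (peval t P).
Proof.
move=> hA KA At; elim/poly_ind: P => [|P c IH]; rewrite !pevalE; first exact: subring0.
by apply: subringD => //; [exact: subringM|apply: KA; exists c].
Qed.

Definition polynomials_in t : set F := range (peval t).

Definition rational_functions t : set F :=
  [set f | exists P R, peval t R != 0 /\ f = peval t P / peval t R].

Lemma polynomials_in_subring t : is_subring (polynomials_in t).
Proof.
split; first by exists 1; rewrite ?peval1.
  by move=> _ _ [P _ <-] [Q _ <-]; exists (P - Q); rewrite ?pevalB.
by move=> _ _ [P _ <-] [Q _ <-]; exists (P * Q); rewrite ?pevalM.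
Qed.

Lemma rational_polynomial t P : rational_functions t (peval t P).
Proof. by exists P, 1; rewrite peval1 oner_eq0 divr1. Qed.

Lemma rational_const t c : rational_functions t (k c).
Proof. by rewrite -(pevalC t); exact: rational_polynomial. Qed.

Lemma rational_gen t : rational_functions t t.
Proof. by rewrite -{2}(pevalX t); exact: rational_polynomial. Qed.

Lemma rational_subfield t : is_subfield (rational_functions t).
Proof.
split; first split.
- by rewrite -(peval1 t); exact: rational_polynomial.
- move=> _ _ [P [R [R0 ->]]] [Q [S [S0 ->]]]; exists (P * S - Q * R), (R * S).
  by rewrite !pevalE mulf_neq0 // mulrDl mulNr -mulf_div divff // mulr1
    [peval t R * _]mulrC -mulf_div divff // mulr1.
- move=> _ _ [P [R [R0 ->]]] [Q [S [S0 ->]]]; exists (P * Q), (R * S).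
  by rewrite !pevalE mulf_neq0 // mulf_div.
- move=> _ [P [R [R0 ->]]]; have [P0|P0] := eqVneq (peval t P) 0.
    by rewrite P0 mul0r invr0 -(peval0 t); exact: rational_polynomial.
  by exists R, P; rewrite invf_div.
Qed.

Lemma rational_coprime t f : rational_functions t f ->
  exists P R, [/\ coprimep P R, peval t R != 0 & f = peval t P / peval t R].
Proof.
move=> [P [R [R0 ->]]].
have Rp0 : R != 0 by apply: contra_neq R0 => ->; rewrite peval0.
pose G := gcdp P R.
have PE : P = P %/ G * G by rewrite divpK // dvdp_gcdl.
have RE : R = R %/ G * G by rewrite divpK // dvdp_gcdr.
have : peval t R != 0 by [].
rewrite {1}RE pevalM mulf_eq0 negb_or => /andP [R'0 G0].
exists (P %/ G), (R %/ G); split=> //.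
  by rewrite coprimep_div_gcd // Rp0 orbT.
by rewrite [in LHS]PE [in LHS]RE !pevalM -mulf_div divff // mulr1.
Qed.

Lemma rational_min (L : set F) t : is_subfield L -> range k `<=` L -> L t ->
  rational_functions t `<=` L.
Proof.
move=> [hL LV] KL Lt _ [P [R [R0 ->]]].
by apply: subringM => //; [|apply: LV]; exact: peval_in.
Qed.

End Rational.

Section Quadratic.
Variables (F : fieldType).
Implicit Types (L : set F) (s f : F).

Definition quadratic_extension L s : set F :=
  [set f | exists p q, [/\ L p, L q & f = p + q * s]].

Lemma quadratic_base L s f : is_subfield L -> L f -> quadratic_extension L s f.
Proof. by move=> hL Lf; exists f, 0; split; rewrite ?mul0r ?addr0 //; apply: (subring0 hL.1). Qed.

Lemma quadratic_gen L s : is_subfield L -> quadratic_extension L s s.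
Proof.
move=> [hL _]; exists 0, 1; split; rewrite ?mul1r ?add0r //; [exact: subring0|exact: subring1].
Qed.

Lemma quadratic_min L M s : is_subring M -> L `<=` M -> M s ->
  quadratic_extension L s `<=` M.
Proof.
by move=> hM LM Ms _ [p [q [/LM Mp /LM Mq ->]]]; apply: subringD => //; exact: subringM.
Qed.

(** The inverse of [p + q s] is its conjugate divided by its norm; if the norm
    vanishes then [p + q s] itself lies in [L]. *)
Lemma quadratic_subfield L s l c : is_subfield L -> L l -> L c ->
  s ^+ 2 = l * s + c -> is_subfield (quadratic_extension L s).
Proof.
move=> hL Ll Lc s2; have [hLr LV] := hL.
have LM := subringM hLr; have LD := subringD hLr; have LB := subringB hLr.
split; first split.
- by apply: quadratic_base => //; exact: subring1.
- move=> _ _ [p [q [Lp Lq ->]]] [p' [q' [Lp' Lq' ->]]].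
  exists (p - p'), (q - q'); split; [exact: LB|exact: LB|].
  by rewrite mulrBl opprD addrACA.
- move=> _ _ [p [q [Lp Lq ->]]] [p' [q' [Lp' Lq' ->]]].
  exists (p * p' + q * q' * c), (p * q' + q * p' + q * q' * l).
  split; auto 8.
  by transitivity (p * p' + (p * q' + q * p') * s + q * q' * (l * s + c)); [rewrite -s2; ring|ring].
- move=> _ [p [q [Lp Lq ->]]].
  pose g := p + q * l - q * s; pose N := p ^+ 2 + p * q * l - q ^+ 2 * c.
  have LN : L N.
    by rewrite /N !expr2; auto 8.
  have fg : (p + q * s) * g = N.
    by rewrite /g /N (_ : c = s ^+ 2 - l * s); [ring|rewrite s2; ring].
  have [N0|N0] := eqVneq N 0.
    have [f0|f0] := eqVneq (p + q * s) 0.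
      by rewrite f0 invr0; apply: quadratic_base => //; exact: subring0.
    have /eqP := fg; rewrite N0 mulf_eq0 (negPf f0) /= subr_eq0 => /eqP <-.
    by apply: quadratic_base => //; auto 8.
  exists ((p + q * l) / N), (- q / N); split.
  - by auto 8.
  - by apply: subringM => //; [exact: subringN|exact: LV].
  - have f0 : p + q * s != 0 by apply: contra_neq N0 => f0; rewrite -fg f0 mul0r.
    by rewrite mulrAC -mulrDl mulNr -/g -fg invfM [RHS]mulrCA divff ?mulr1 //;
      apply: contra_neq N0 => g0; rewrite -fg g0 mulr0.
Qed.

End Quadratic.

(** * Partial isomorphisms between fields *)

Section PartialIso.
Variables (F F' : fieldType).
Implicit Types (G : F -> F' -> Prop).

(** The graph of an isomorphism between a subfield of [F] and one of [F'].  Graphs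
    allow isomorphisms to be extended without making the subfields into types. *)
Definition is_partial_iso G : Prop :=
  [/\ G 1 1, forall f f' g g', G f f' -> G g g' -> G (f - g) (f' - g'),
      forall f f' g g', G f f' -> G g g' -> G (f * g) (f' * g'),
      forall f f', G f f' -> G f^-1 f'^-1
    & forall f f', G f f' -> (f = 0 <-> f' = 0)].

Section Theory.
Variables (G : F -> F' -> Prop) (hG : is_partial_iso G).
Lemma piso1 : G 1 1. Proof. by case: hG. Qed.
Lemma pisoB f f' g g' : G f f' -> G g g' -> G (f - g) (f' - g').
Proof. by case: hG => _ H _ _ _; exact: H. Qed.
Lemma pisoM f f' g g' : G f f' -> G g g' -> G (f * g) (f' * g').
Proof. by case: hG => _ _ H _ _; exact: H. Qed.
Lemma pisoV f f' : G f f' -> G f^-1 f'^-1.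
Proof. by case: hG => _ _ _ H _; exact: H. Qed.
Lemma piso_eq0 f f' : G f f' -> (f = 0 <-> f' = 0).
Proof. by case: hG => _ _ _ _; apply. Qed.
Lemma piso0 : G 0 0. Proof. by rewrite -(subrr 1) -[in X in G _ X](subrr 1); apply: pisoB; exact: piso1. Qed.
Lemma pisoN f f' : G f f' -> G (- f) (- f').
Proof. by move=> Gf; rewrite -(sub0r f) -(sub0r f'); apply: pisoB => //; exact: piso0. Qed.
Lemma pisoD f f' g g' : G f f' -> G g g' -> G (f + g) (f' + g').
Proof. by move=> Gf Gg; rewrite -(opprK g) -(opprK g'); apply: pisoB => //; exact: pisoN. Qed.
Lemma piso_fun f f' g : G f f' -> G f g -> f' = g.
Proof.
by move=> Gf Gg; apply/subr0_eq/(piso_eq0 (pisoB Gf Gg)); rewrite subrr.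
Qed.
Lemma piso_inj f g f' : G f f' -> G g f' -> f = g.
Proof.
by move=> Gf Gg; apply/subr0_eq/(piso_eq0 (pisoB Gf Gg)); rewrite subrr.
Qed.
End Theory.

Definition quadratic_iso G (s : F) (s' : F') : F -> F' -> Prop :=
  fun f f' => exists p p' q q',
    [/\ G p p', G q q', f = p + q * s & f' = p' + q' * s'].

Section QuadraticIso.
Variables (G : F -> F' -> Prop) (hG : is_partial_iso G) (s l c : F) (s' l' c' : F').
Hypotheses (Gl : G l l') (Gc : G c c').
Hypotheses (s2 : s ^+ 2 = l * s + c) (s2' : s' ^+ 2 = l' * s' + c').
Hypotheses (ns : forall f, ~ G s f) (ns' : forall f, ~ G f s').

Lemma quadratic_iso_base f f' : G f f' -> quadratic_iso G s s' f f'.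
Proof.
by move=> Gf; exists f, f', 0, 0; split; rewrite ?mul0r ?addr0 //; exact: piso0.
Qed.

Lemma quadratic_iso_eq0 p p' q q' : G p p' -> G q q' ->
  (p + q * s = 0 -> p = 0 /\ q = 0) /\ (p' + q' * s' = 0 -> p' = 0 /\ q' = 0).
Proof.
move=> Gp Gq; split=> e0.
  have [q0|q0] := eqVneq q 0; first by move: e0; rewrite q0 mul0r addr0.
  case: (ns (f := - p' / q')); rewrite (_ : s = - p / q).
    by apply: pisoM => //; [exact: pisoN|exact: pisoV].
  by apply: (mulIf q0); rewrite mulfVK // mulrC; apply/eqP; rewrite -addr_eq0 addrC e0.
have [q0|q0] := eqVneq q' 0; first by move: e0; rewrite q0 mul0r addr0.
case: (ns' (f := - p / q)); rewrite (_ : s' = - p' / q').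
  by apply: pisoM => //; [exact: pisoN|exact: pisoV].
by apply: (mulIf q0); rewrite mulfVK // mulrC; apply/eqP; rewrite -addr_eq0 addrC e0.
Qed.

(** Sums, products and inverses in a quadratic extension are computed from the
    coefficients of the quadratic equation, which correspond under [G]. *)
Lemma quadratic_partial_iso : is_partial_iso (quadratic_iso G s s').
Proof.
have GM := pisoM hG; have GB := pisoB hG; have GD := pisoD hG.
have eq0 f f' : quadratic_iso G s s' f f' -> (f = 0 <-> f' = 0).
  move=> [p [p' [q [q' [Gp Gq -> ->]]]]].
  have [H H'] := quadratic_iso_eq0 Gp Gq.
  split=> [/H|/H'] [/(piso_eq0 hG Gp) -> /(piso_eq0 hG Gq) ->]; by rewrite mul0r addr0.
have mulE (E : fieldType) (u v w p q p' q' : E) : u ^+ 2 = v * u + w ->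
    (p + q * u) * (p' + q' * u) = p * p' + q * q' * w + (p * q' + q * p' + q * q' * v) * u.
  move=> u2.
  by transitivity (p * p' + (p * q' + q * p') * u + q * q' * (v * u + w)); [rewrite -u2; ring|ring].
have mul f f' g g' : quadratic_iso G s s' f f' -> quadratic_iso G s s' g g' ->
    quadratic_iso G s s' (f * g) (f' * g').
  move=> [p [p' [q [q' [Gp Gq -> ->]]]]] [r [r' [t [t' [Gr Gt -> ->]]]]].
  exists (p * r + q * t * c), (p' * r' + q' * t' * c'), (p * t + q * r + q * t * l), (p' * t' + q' * r' + q' * t' * l').
  by split; try exact: mulE; auto 8.
split=> //.
- by apply: quadratic_iso_base; exact: piso1.
- move=> _ _ _ _ [p [p' [q [q' [Gp Gq -> ->]]]]] [r [r' [t [t' [Gr Gt -> ->]]]]].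
  exists (p - r), (p' - r'), (q - t), (q' - t'); split; try exact: GB.
    by rewrite mulrBl opprD addrACA.
  by rewrite mulrBl opprD addrACA.
- move=> f f' Gff; have [f0|f0] := eqVneq f 0.
    have /(eq0 _ _ Gff) -> := f0; rewrite f0 !invr0; apply: quadratic_iso_base; exact: piso0.
  have f'0 : f' != 0 by apply: contra_neq f0 => /(eq0 _ _ Gff).
  have [p [p' [q [q' [Gp Gq fE f'E]]]]] := Gff.
  (* the conjugate of [f], multiplied by [f], is the norm *)
  have Gg : quadratic_iso G s s' (p + q * l + (- q) * s) (p' + q' * l' + (- q') * s').
    by exists (p + q * l), (p' + q' * l'), (- q), (- q'); split=> //; [by auto 8|exact: pisoN].
  set g := _ + _ * s in Gg; set g' := _ + _ * s' in Gg.
  pose N := p * (p + q * l) + q * - q * c; pose N' := p' * (p' + q' * l') + q' * - q' * c'.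
  have GN : G N N'.
    by have := pisoN hG Gq; rewrite /N /N'; auto 8.
  have fg : f * g = N.
    rewrite fE /g (mulE _ _ _ _ _ _ _ _ s2) (_ : (_ + _ + _) * s = 0) ?addr0 //; ring.
  have fg' : f' * g' = N'.
    rewrite f'E /g' (mulE _ _ _ _ _ _ _ _ s2') (_ : (_ + _ + _) * s' = 0) ?addr0 //; ring.
  have g0 : g != 0.
    apply/eqP => g0; have [] := (quadratic_iso_eq0 (GD _ _ _ _ Gp (GM _ _ _ _ Gq Gl)) (pisoN hG Gq)).1 g0.
    move=> pq /eqP; rewrite oppr_eq0 => /eqP q0; move: pq f0.
    by rewrite fE q0 !mul0r addr0 => ->; rewrite eqxx.
  have g'0 : g' != 0 by apply: contra_neq g0 => /(eq0 _ _ Gg).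
  rewrite (_ : f^-1 = g * N^-1); last by rewrite -fg invfM mulrCA mulfV // mulr1.
  rewrite (_ : f'^-1 = g' * N'^-1); last by rewrite -fg' invfM mulrCA mulfV // mulr1.
  by apply: mul => //; apply: quadratic_iso_base; exact: pisoV.
Qed.

End QuadraticIso.

Lemma partial_iso_total G : is_partial_iso G ->
  (forall f, exists f', G f f') -> (forall f', exists f, G f f') ->
  exists phi : {rmorphism F -> F'}, bijective phi /\ forall f, G f (phi f).
Proof.
move=> hG /choice [phi phiP] /choice [psi psiP].
have phiB : {morph phi : f g / f - g}.
  by move=> f g; apply: (piso_fun hG (phiP _)); exact: pisoB.
have phiM : monoid_morphism phi.
  split; first by apply: (piso_fun hG (phiP _)); exact: piso1.
  by move=> f g; apply: (piso_fun hG (phiP _)); exact: pisoM.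
pose mB := GRing.isZmodMorphism.Build F F' phi phiB.
pose mM := GRing.isMonoidMorphism.Build F F' phi phiM.
pose phi' : {rmorphism F -> F'} := HB.pack phi mB mM.
exists phi'; split=> //; exists psi => f.
  exact: (piso_inj hG (psiP _)).
exact: (piso_fun hG (phiP _)).
Qed.

End PartialIso.

Section RationalIso.
Variables (K F F' : fieldType) (k : {rmorphism K -> F}) (k' : {rmorphism K -> F'}).

(** For transcendental [t] and [t'], the graph of the isomorphism [K(t) -> K(t')]
    that sends [t] to [t']. *)
Definition rational_iso (t : F) (t' : F') : F -> F' -> Prop :=
  fun f f' => exists P R : {poly K},
    [/\ R != 0, f = peval k t P / peval k t R & f' = peval k' t' P / peval k' t' R].

Lemma rational_partial_iso t t' :
  (forall P, P != 0 -> peval k t P != 0) -> (forall P, P != 0 -> peval k' t' P != 0) ->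
  is_partial_iso (rational_iso t t').
Proof.
move=> tr tr'.
have dB (E : fieldType) (p r q s : E) : r != 0 -> s != 0 -> p / r - q / s = (p * s - q * r) / (r * s).
  by move=> r0 s0; rewrite mulrDl mulNr -mulf_div divff // mulr1 [r * s]mulrC -mulf_div divff // mulr1.
split.
- by exists 1, 1; rewrite !peval1 !divr1 oner_eq0.
- move=> _ _ _ _ [P [R [R0 -> ->]]] [Q [S [S0 -> ->]]]; exists (P * S - Q * R), (R * S).
  by split; [exact: mulf_neq0|rewrite !pevalE dB //; exact: tr|rewrite !pevalE dB //; exact: tr'].
- move=> _ _ _ _ [P [R [R0 -> ->]]] [Q [S [S0 -> ->]]]; exists (P * Q), (R * S).
  by rewrite mulf_neq0 // !pevalE !mulf_div.
- move=> _ _ [P [R [R0 -> ->]]]; have [->|P0] := eqVneq P 0.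
    by exists 0, 1; rewrite !peval0 !peval1 !mul0r !invr0 oner_eq0.
  by exists R, P; rewrite !invf_div.
- move=> _ _ [P [R [R0 -> ->]]]; have [->|P0] := eqVneq P 0.
    by rewrite !peval0 !mul0r.
  split=> /eqP; rewrite mulf_eq0 invr_eq0.
    by rewrite !(negPf (tr _ _)).
  by rewrite !(negPf (tr' _ _)).
Qed.

End RationalIso.

(** * Places and leading terms at a pole *)

Section ValuationRing.
Variables (F : fieldType) (O : set F).
Implicit Types (f g : F).

Definition nonunits : set F := [set f | f = 0 \/ ~ O f^-1].

Hypothesis hO : is_valuation_ring O.
Local Notation m := nonunits.
Let hOr : is_subring O := hO.1.

Lemma valuation_ringV f : ~ O f -> f != 0 /\ m f^-1.
Proof.
move=> nf; split; last by right; rewrite invrK.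
by apply/eqP => f0; apply: nf; rewrite f0; exact: subring0.
Qed.
Lemma nonunits_sub f : m f -> O f.
Proof. by move=> [->|nf]; [exact: subring0|case: (hO.2 f)]. Qed.
Lemma nonunitsMr f g : m f -> O g -> m (f * g).
Proof.
move=> [->|nf] Og; first by rewrite mul0r; left.
have [->|g0] := eqVneq g 0; first by rewrite mulr0; left.
right; rewrite invfM => Ofg; apply: nf.
by rewrite -(mulfVK g0 f^-1); exact: subringM.
Qed.
Lemma nonunitsMl f g : O f -> m g -> m (f * g).
Proof. by move=> Of mg; rewrite mulrC; exact: nonunitsMr. Qed.
Lemma nonunitsN f : m f -> m (- f).
Proof. by move=> mf; rewrite -mulrN1; apply: nonunitsMr => //; apply: subringN => //; exact: subring1. Qed.
Lemma nonunitsD f g : m f -> m g -> m (f + g).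
Proof.
have aux f' g' : g' != 0 -> m g' -> O (f' / g') -> m (f' + g').
  move=> g0 mg Ofg; rewrite (_ : f' + g' = g' * (f' / g' + 1)).
    by apply: nonunitsMr => //; apply: subringD => //; exact: subring1.
  by rewrite mulrDr mulr1 mulrC mulfVK.
move=> mf mg; have [->|f0] := eqVneq f 0; first by rewrite add0r.
have [->|g0] := eqVneq g 0; first by rewrite addr0.
have [Ofg|] := hO.2 (f / g); first exact: aux.
by rewrite invf_div addrC; exact: aux.
Qed.
Lemma nonunitsB f g : m f -> m g -> m (f - g).
Proof. by move=> mf mg; apply: nonunitsD => //; exact: nonunitsN. Qed.
Lemma nonunits1 : ~ m 1.
Proof. by move=> [/eqP|]; rewrite ?oner_eq0 // invr1; apply; exact: subring1. Qed.
Lemma unitP f : O f -> ~ m f -> f != 0 /\ O f^-1.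
Proof.
move=> Of nmf; split; first by apply/eqP => f0; apply: nmf; left.
by apply: contrapT => nf; apply: nmf; right.
Qed.
Lemma nonunits_inv f : m f -> O f^-1 -> f = 0.
Proof. by case. Qed.
Lemma unitD1 f : m f -> 1 + f != 0 /\ O (1 + f)^-1.
Proof.
move=> mf; apply: unitP.
  by apply: subringD => //; [exact: subring1|exact: nonunits_sub].
move=> m1f; apply: nonunits1; rewrite -(addrK f 1); exact: nonunitsB.
Qed.
Lemma valuation_ring_sqr f : O (f ^+ 2) -> O f.
Proof.
move=> Off; apply: contrapT => nf; have [f0 mf] := valuation_ringV nf.
by apply: nf; rewrite -(mulfK f0 f) -expr2; apply: subringM => //; exact: nonunits_sub.
Qed.
Lemma nonunits_sqr f : m (f ^+ 2) -> m f.
Proof.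
move=> mff; have [->|f0] := eqVneq f 0; first by left.
right => Of; have := nonunitsMr mff Of; rewrite expr2 mulfK // => mf.
by apply: nonunits1; rewrite -(mulfV f0); exact: nonunitsMr.
Qed.

End ValuationRing.

Section Places.
Variables (K F : fieldType) (k : {rmorphism K -> F}).
Implicit Types (O : set F) (x f g : F) (P Q : {poly K}).

Definition is_place O : Prop := is_valuation_ring O /\ range k `<=` O.

Lemma place_const O c : is_place O -> O (k c).
Proof. by move=> [_ KO]; apply: KO; exists c. Qed.

Lemma place_nonunit_const O c : is_place O -> nonunits O (k c) -> c = 0.
Proof.
move=> hO [/eqP|]; first by rewrite fmorph_eq0 => /eqP.
by rewrite -fmorphV; case; exact: place_const.
Qed.

Lemma range_subring : is_subring (range k).
Proof.
split; first by exists 1; rewrite ?rmorph1.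
  by move=> _ _ [c _ <-] [d _ <-]; exists (c - d); rewrite ?rmorphB.
by move=> _ _ [c _ <-] [d _ <-]; exists (c * d); rewrite ?rmorphM.
Qed.

(** [f = c x^n] up to terms of higher order at [O]. *)
Definition leading_term O x f (n : int) (c : K) : Prop :=
  nonunits O (f / x ^ n - k c).

Section Pole.
Variables (O : set F) (x : F).
Hypotheses (hO : is_place O) (nOx : ~ O x).
Let hOv : is_valuation_ring O := hO.1.
Let hOr : is_subring O := hO.1.1.
Local Notation m := (nonunits O).
Local Notation lt := (leading_term O x).

Lemma pole_neq0 : x != 0.
Proof. by have [] := valuation_ringV hOv nOx. Qed.
Let x0 := pole_neq0.

Lemma pole_inv : m x^-1.
Proof. by have [] := valuation_ringV hOv nOx. Qed.

Lemma pole_exprz n : n < 0 -> m (x ^ n).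
Proof.
case: n => // n _; rewrite NegzE -exprz_inv -exprnP exprS.
apply: nonunitsMr => //; first exact: pole_inv.
by apply: subringX => //; apply: nonunits_sub => //; exact: pole_inv.
Qed.

Lemma leading_term_integral f n c : lt f n c -> O (f / x ^ n).
Proof.
move=> mf; rewrite -[_ / _](subrK (k c)); apply: subringD => //.
  exact: nonunits_sub.
exact: place_const.
Qed.

Lemma leading_term_const c : lt (k c) 0 c.
Proof. by rewrite /leading_term expr0z divr1 subrr; left. Qed.

Lemma leading_term_gen : lt x 1 1.
Proof. by rewrite /leading_term expr1z divff // rmorph1 subrr; left. Qed.

Lemma leading_termM f g n n' c c' :
  lt f n c -> lt g n' c' -> lt (f * g) (n + n') (c * c').
Proof.
move=> mf mg; rewrite /leading_term expfzDr // -mulf_div rmorphM /=.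
set u := f / _; set v := g / _.
rewrite (_ : u * v - _ = (u - k c) * v + k c * (v - k c')); last by ring.
apply: nonunitsD => //; first by apply: nonunitsMr => //; exact: leading_term_integral mg.
by apply: nonunitsMl => //; exact: place_const.
Qed.

Lemma leading_termX f n c i : lt f n c -> lt (f ^+ i) (n *+ i) (c ^+ i).
Proof.
move=> mf; elim: i => [|i IH]; last by rewrite !exprS mulrS; exact: leading_termM.
by rewrite !expr0 mulr0n -(rmorph1 k); exact: leading_term_const.
Qed.

Lemma leading_term_neq0 f n c : c != 0 -> lt f n c -> f != 0.
Proof.
move=> c0 mf; apply: contra_neq c0 => f0; move: mf; rewrite /leading_term f0 mul0r sub0r.
by move/(nonunitsN hOv); rewrite opprK; exact: place_nonunit_const.
Qed.

Lemma leading_termV f n c : c != 0 -> lt f n c -> lt f^-1 (- n) c^-1.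
Proof.
move=> c0 mf; have f0 := leading_term_neq0 c0 mf.
rewrite /leading_term -invr_expz invrK fmorphV.
set u := f / x ^ n in mf.
have xn0 : x ^ n != 0 by exact: expfz_neq0.
have u0 : u != 0 by rewrite mulf_neq0 // invr_eq0.
have kc0 : k c != 0 by rewrite fmorph_eq0.
have Ou : O u^-1.
  apply: (proj2 (unitP _ _)); first exact: leading_term_integral mf.
  move=> mu; have /(place_nonunit_const hO) c0' : m (k c).
    by rewrite -(subKr u (k c)); exact: nonunitsB.
  by rewrite c0' eqxx in c0.
rewrite (_ : f^-1 * x ^ n - (k c)^-1 = (u - k c) * (- (u^-1 * k c^-1))).
  apply: nonunitsMr => //; apply: subringN => //; apply: subringM => //; exact: place_const.
have -> : f^-1 * x ^ n = u^-1 by rewrite invf_div mulrC.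
by rewrite fmorphV; field; rewrite kc0 u0.
Qed.

Lemma leading_termD f g n n' c c' :
  n' < n -> lt f n c -> lt g n' c' -> lt (f + g) n c.
Proof.
move=> nn mf mg; rewrite /leading_term mulrDl addrAC; apply: nonunitsD => //.
rewrite (_ : g / x ^ n = g / x ^ n' * x ^ (n' - n)).
  apply: nonunitsMl => //; first exact: leading_term_integral mg.
  by apply: pole_exprz; rewrite subr_lt0.
by rewrite expfzDr // mulrA mulfVK ?expfz_neq0 // invr_expz.
Qed.

Lemma leading_term_lt0 f n c : n < 0 -> lt f n c -> m f.
Proof.
move=> n0 mf; rewrite -(mulfVK (expfz_neq0 n x0) f).
by apply: nonunitsMl => //; [exact: leading_term_integral mf|exact: pole_exprz].
Qed.

Lemma leading_term_le0 f n c : n <= 0 -> lt f n c -> O f.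
Proof.
rewrite le_eqVlt => /predU1P[->|n0] mf.
  by have := leading_term_integral mf; rewrite expr0z divr1.
by apply: nonunits_sub => //; exact: leading_term_lt0 mf.
Qed.

Lemma leading_term_integralP f n c : c != 0 -> lt f n c -> O f -> n <= 0.
Proof.
move=> c0 mf Of; rewrite leNgt; apply/negP => n0.
have mfi : m f^-1.
  by apply: (leading_term_lt0 _ (leading_termV c0 mf)); rewrite oppr_lt0.
have /eqP : f^-1 = 0 by apply: (nonunits_inv mfi); rewrite invrK.
by rewrite invr_eq0 (negPf (leading_term_neq0 c0 mf)).
Qed.

Lemma leading_term_uniq f n n' c c' :
  c != 0 -> c' != 0 -> lt f n c -> lt f n' c' -> n = n'.
Proof.
suff le p p' d d' : d != 0 -> d' != 0 -> lt f p d -> lt f p' d' -> p <= p'.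
  by move=> c0 c0' mf mf'; apply/eqP; rewrite eq_le (le _ _ _ _ c0 c0') // (le _ _ _ _ c0' c0).
move=> d0 d0' mf mf'; rewrite -subr_le0.
have := leading_termM mf (leading_termV d0' mf').
rewrite mulfV ?(leading_term_neq0 d0 mf) // => m1.
by apply: (leading_term_integralP _ m1); [rewrite mulf_neq0 ?invr_eq0|exact: subring1].
Qed.

Lemma leading_term_peval P : P != 0 ->
  lt (peval k x P) (size P).-1%:Z (lead_coef P).
Proof.
elim/poly_ind: P => [|P c IH]; first by rewrite eqxx.
have [->|P0] := eqVneq P 0.
  rewrite mul0r add0r polyC_eq0 => c0; rewrite pevalC size_polyC c0 lead_coefC.
  exact: leading_term_const.
move=> _; rewrite !pevalE size_MXaddC (negPf P0) /= lead_coefDl; last first.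
  by rewrite size_polyC size_mulX //; case: (c != 0) => //=; rewrite ltnS size_poly_gt0.
rewrite lead_coefMX -[lead_coef P]mulr1.
apply: (@leading_termD _ _ _ 0 _ c); last exact: leading_term_const.
  by rewrite ltz_nat size_poly_gt0.
rewrite -(prednK (_ : 0 < size P)%N) ?size_poly_gt0 // -addn1 PoszD.
by apply: leading_termM; [exact: IH|exact: leading_term_gen].
Qed.

Lemma peval_bounded P n : (size P <= n.+1)%N -> O (peval k x P / x ^ n%:Z).
Proof.
move=> sP; have [->|P0] := eqVneq P 0; first by rewrite peval0 mul0r; exact: subring0.
have := leading_term_integral (leading_term_peval P0).
rewrite (_ : _ / x ^ n%:Z = peval k x P / x ^ (size P).-1%:Z * x ^ ((size P).-1%:Z - n%:Z)); last first.
  by rewrite expfzDr // mulrA mulfVK ?expfz_neq0 // invr_expz.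
move=> OP; apply: subringM => //.
have : (size P).-1%:Z - n%:Z <= 0 by lia.
rewrite le_eqVlt => /predU1P[->|n0]; first by rewrite expr0z; exact: subring1.
by apply: nonunits_sub => //; exact: pole_exprz.
Qed.

Section Weierstrass.
Variables (y : F) (L C : {poly K}).
Hypotheses (sL : (size L <= 2)%N) (sC : size C = 4%N) (mC : C \is monic).
Hypothesis eqn : y ^+ 2 + peval k x L * y = peval k x C.

(** The function [s = y / x^2] satisfies [s^2 + u s = v] with [u] and [v] in the
    maximal ideal, so it lies there itself, and [y^2 / x^3 - 1] is small. *)
Lemma weierstrass_y : lt (y ^+ 2) 3 1.
Proof.
have xz2 : x ^ (2%:Z) = x ^+ 2 by [].
have xz3 : x ^ (3%:Z) = x ^+ 3 by [].
have mC3 : m (peval k x C / x ^+ 3 - 1).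
  have C0 : C != 0 by rewrite -size_poly_eq0 sC.
  by have := leading_term_peval C0; rewrite /leading_term sC (monicP mC) rmorph1.
have OL : O (peval k x L / x) by have := peval_bounded sL; rewrite expr1z.
have mxi := pole_inv.
pose s := y / x ^+ 2; pose u := peval k x L / x / x; pose v := peval k x C / x ^+ 3 / x.
have mu : m u by exact: nonunitsMl.
have mv : m v.
  apply: nonunitsMl => //; rewrite -[_ / _](subrK 1).
  by apply: subringD => //; [exact: nonunits_sub|exact: subring1].
have s2 : s ^+ 2 = v - u * s.
  by rewrite /s /u /v -eqn; field.
have Os : O s.
  apply: contrapT => nOs; have [s0 ms] := valuation_ringV hOv nOs.
  apply: nOs; rewrite (_ : s = v * s^-1 - u).
    apply: subringB => //; last exact: nonunits_sub.
    by apply: subringM => //; exact: nonunits_sub.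
  by apply: (mulIf s0); rewrite -expr2 s2 mulrBl mulfVK.
have ms : m s.
  by apply: nonunits_sqr => //; rewrite s2; apply: nonunitsB => //; exact: nonunitsMr.
rewrite /leading_term xz3 rmorph1.
rewrite (_ : _ - 1 = (peval k x C / x ^+ 3 - 1) - (peval k x L / x) * s).
  by apply: nonunitsB => //; exact: nonunitsMl.
by rewrite /s -eqn; field.
Qed.

(** In characteristic two [(p + q y)^2 = p^2 + q^2 y^2], and the exponents of the two
    terms have different parities, so no cancellation occurs. *)
Lemma leading_term_pair p q n n' c c' : 2%:R = 0 :> F -> lt p n c -> lt q n' c' ->
  if n + n < n' + n' + 3 then lt ((p + q * y) ^+ 2) (n' + n' + 3) (c' ^+ 2)
  else lt ((p + q * y) ^+ 2) (n + n) (c ^+ 2).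
Proof.
move=> h2 mp mq.
rewrite (_ : (p + q * y) ^+ 2 = p * p + q * q * y ^+ 2); last first.
  rewrite sqrrD exprMn -!expr2 addrAC -[X in _ + X = _]mulr_natr h2 mulr0 addr0 //.
have mp2 := leading_termM mp mp.
have := leading_termM (leading_termM mq mq) weierstrass_y; rewrite mulr1 => mq2.
rewrite !expr2; case: ifP => [lt|/negbT nlt]; last first.
  by apply: (leading_termD _ mp2 mq2); rewrite lt_neqAle leNgt nlt andbT; lia.
by rewrite addrC; exact: (leading_termD lt mq2 mp2).
Qed.

End Weierstrass.
End Pole.
End Places.

(** * Derivations and valuation rings *)

Section Derivations.
Variables (K F : fieldType) (k : {rmorphism K -> F}).
Hypothesis h2 : 2%:R = 0 :> F.
Add Ring char2_F : (char2_ring_theory h2) (morphism (char2_ring_morph h2),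
  constants [char2_constant], power_tac (char2_power_theory F) [char2_exponent]).

Definition derivation_on (E : set F) (D : F -> F) : Prop :=
  [/\ forall c, D (k c) = 0,
      forall f g, E f -> E g -> D (f + g) = D f + D g
    & forall f g, E f -> E g -> D (f * g) = f * D g + g * D f].

Section DerivationTheory.
Variables (E : set F) (D : F -> F).
Hypotheses (hE : is_subfield E) (KE : range k `<=` E) (hD : derivation_on E D).
Let EM := subringM hE.1.
Let EV := hE.2.

Lemma der_const c : D (k c) = 0. Proof. by case: hD. Qed.
Lemma derD f g : E f -> E g -> D (f + g) = D f + D g. Proof. by case: hD => _ + _; apply. Qed.
Lemma derM f g : E f -> E g -> D (f * g) = f * D g + g * D f. Proof. by case: hD => _ _; apply. Qed.
Lemma der1 : D 1 = 0. Proof. by rewrite -(rmorph1 k) der_const. Qed.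
Lemma derZ c f : E f -> D (k c * f) = k c * D f.
Proof. by move=> Ef; rewrite derM ?der_const ?mulr0 ?addr0 //; apply: KE; exists c. Qed.
Lemma der_sqr f : E f -> D (f ^+ 2) = 0.
Proof. by move=> Ef; rewrite expr2 derM // (char2_addxx h2). Qed.
Lemma der_sqrM f g : E f -> E g -> D (f ^+ 2 * g) = f ^+ 2 * D g.
Proof.
by move=> Ef Eg; rewrite derM ?der_sqr ?mulr0 ?addr0 //; apply: subringX => //; exact: hE.1.
Qed.
Lemma derV f : E f -> D f^-1 = D f / f ^+ 2.
Proof.
move=> Ef; have [f0|f0] := eqVneq f 0.
  by rewrite f0 -(rmorph0 k) -fmorphV !der_const mul0r.
apply: (mulfI f0); rewrite mulrCA expr2 invfM mulVKf //.
apply: char2_eqD => //; rewrite [_ / f]mulrC -derM //; last exact: EV.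
by rewrite divff // der1.
Qed.
Lemma der_peval t P : E t -> D (peval k t P) = peval k t P^`() * D t.
Proof.
move=> Et; elim/poly_ind: P => [|P c IH].
  by rewrite !pevalE deriv0 peval0 mul0r -(rmorph0 k) der_const rmorph0.
have EP : E (peval k t P) by exact: peval_in hE.1 KE Et.
rewrite derivMXaddC !pevalE derD ?der_const ?addr0 //; [|exact: EM|by apply: KE; exists c].
by rewrite derM // IH mulrDl mulrA [t * _]mulrC.
Qed.
End DerivationTheory.

(** The valuation ring [O] is unramified over [K(t)], since the trace [L(t)] of [s]
    is a unit.  If the conjugate of [f = p + q s] lies in [O] as well, the trace
    shows that [q] and [p] do, and the claim reduces to [K(t)].  Otherwise [f] is the
    quotient of [f e], which lies in [K(t)], by the unit [e = f' / (f + f')] with [f']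
    the conjugate of [f]; the conjugate of [e] does lie in [O]. *)
Lemma derivation_unramified (E O : set F) (D : F -> F) (s t : F) (L C : {poly K}) :
  is_subfield E -> range k `<=` E -> derivation_on E D ->
  is_place k O -> E t -> E s -> E `<=` quadratic_extension (rational_functions k t) s ->
  s ^+ 2 + peval k t L * s = peval k t C ->
  O t -> peval k t L != 0 -> O (peval k t L)^-1 -> O (D t) ->
  forall f, E f -> O f -> O (D f).
Proof.
move=> hE KE hD hO Et Es Equad eqn Ot L0 OLi ODt.
set l := peval k t L in eqn L0 OLi.
have hOv := hO.1; have hOr := hOv.1; have hEr := hE.1; have EV := hE.2.
have OP P : O (peval k t P) by exact: peval_in hOr hO.2 Ot.
have EP P : E (peval k t P) by exact: peval_in hEr KE Et.
have OB := subringB hOr; have OD := subringD hOr; have OM := subringM hOr.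
have EB := subringB hEr; have ED := subringD hEr; have EM := subringM hEr.
have ratE : rational_functions k t `<=` E by exact: rational_min.
have ODP P : O (D (peval k t P)) by rewrite (der_peval hE KE hD) //; exact: OM.
(* on [K(t)]: write [f] as a reduced fraction; its denominator is a unit *)
have ODrat f : rational_functions k t f -> O f -> O (D f).
  move=> /rational_coprime [P [R [/Bezout_eq1_coprimepP [[U V] /= UV] R0 fE]]] Of.
  have ORi : O (peval k t R)^-1.
    apply: contrapT => nR; have mR : nonunits O (peval k t R) by right.
    have mP : nonunits O (peval k t P).
      by rewrite -(mulfVK R0 (peval k t P)) -fE; exact: nonunitsMl.
    apply: (nonunits1 hOv); rewrite -(peval1 k t) -UV pevalD !pevalM.
    by apply: nonunitsD => //; exact: nonunitsMl.
  rewrite fE (derM hD) //; last exact: EV.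
  by rewrite (derV hE hD) // -exprVn; auto 8 using (subringX hOr).
have EL : E l by exact: EP.
have OL : O l by exact: OP.
have ODl : O (D l) by exact: ODP.
have Os : O s.
  apply: contrapT => ns; have [s0 ms] := valuation_ringV hOv ns.
  apply: ns; rewrite (_ : s = peval k t C / s - l).
    by apply: OB => //; apply: OM => //; exact: nonunits_sub.
  by rewrite -eqn; field.
have ODs : O (D s).
  have : D (s ^+ 2 + l * s) = D (peval k t C) by rewrite eqn.
  have Ess : E (s ^+ 2) by rewrite expr2; exact: EM.
  have Els : E (l * s) by exact: EM.
  rewrite (derD hD Ess Els) (der_sqr hD Es) add0r (derM hD EL Es) => e.
  rewrite -(mulKf L0 (D s)).
  by rewrite (_ : l * D s = D (peval k t C) - s * D l); [auto|rewrite -e addrK].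
have base f p q : rational_functions k t p -> rational_functions k t q ->
    f = p + q * s -> O f -> O (p + q * (s + l)) -> O (D f).
  move=> Rp Rq fE Of Og.
  have Oq : O q.
    rewrite -(mulfK L0 q) (_ : q * l = p + q * (s + l) - f); last by rewrite fE; ring.
    by auto.
  have Op : O p by rewrite (_ : p = f - q * s); [auto|rewrite fE; ring].
  have Ep := ratE _ Rp; have Eq := ratE _ Rq.
  by rewrite fE (derD hD) ?(derM hD) //; auto 8.
move=> f Ef Of; have [p [q [Rp Rq fE]]] := Equad _ Ef.
pose g := p + q * (s + l).
have [Og|nOg] := pselect (O g); first exact: base fE Of Og.
pose T := f + g.
have TE : T = q * l by rewrite /T fE /g; char2_ring h2.
have nOT : ~ O T by move=> OT; apply: nOg; rewrite (_ : g = T - f) /T; [auto|ring].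
have [T0 mT] := valuation_ringV hOv nOT.
pose e := g / T.
have eE : e = 1 + f / T.
  by rewrite /e (_ : g = T - f); [rewrite char2_oppx //; field|rewrite /T; ring].
have [e0 Oei] : e != 0 /\ O e^-1 by rewrite eE; apply: unitD1 => //; exact: nonunitsMl.
have Oe : O e.
  by rewrite eE; apply: OD; [exact: subring1|apply: OM => //; exact: nonunits_sub].
have hR := rational_subfield k t; have RM := subringM hR.1; have RD := subringD hR.1.
have RT : rational_functions k t T^-1.
  by apply: hR.2; rewrite TE; apply: RM => //; exact: rational_polynomial.
have Rl : rational_functions k t l by exact: rational_polynomial.
have ODe : O (D e).
  apply: (@base _ ((p + q * l) / T) (q / T)); try by auto.
    by rewrite /e /g; ring.
  rewrite (_ : _ + _ = f / T); first by apply: OM => //; exact: nonunits_sub.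
  by rewrite fE; char2_ring h2.
have ODfe : O (D (f * e)).
  apply: ODrat; last exact: OM.
  rewrite (_ : f * e = (p * p + p * q * l + q * q * peval k t C) / T).
    by have RC := rational_polynomial k t C; auto 8.
  by rewrite /e /g fE -eqn; char2_ring h2.
have Ee : E e.
  have Ep := ratE _ Rp; have Eq := ratE _ Rq; have ET := ratE _ RT.
  by rewrite /e /g; auto 8.
rewrite -(mulfK e0 f) (derM hD) ?(derV hE hD) //; try by auto.
by rewrite -exprVn; auto 8 using (subringX hOr).
Qed.
End Derivations.

(** * Places of the function field of a Weierstrass equation *)

Section Constants.
Variables (K F : fieldType) (k : {rmorphism K -> F}).
Implicit Types (f t : F).

Lemma peval_transcendental t P : ~ algebraicOver k t -> P != 0 -> peval k t P != 0.
Proof. by move=> nt P0; apply/eqP => Pt; apply: nt; exists P => //; apply/rootP. Qed.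

Lemma peval_inj t P Q : ~ algebraicOver k t -> peval k t P = peval k t Q -> P = Q.
Proof.
move=> nt PQ; apply/eqP; rewrite -subr_eq0; apply: contraT.
by move/(peval_transcendental nt); rewrite pevalB PQ subrr eqxx.
Qed.

Lemma integral_over_constants f : integral_closure (range k) f -> algebraicOver k f.
Proof.
move=> [M [mM KM rM]].
have /choice [c cM] : forall n, exists c, k c = M`_n by move=> n; have [c _ <-] := KM n; exists c.
have ME : map_poly k (\poly_(i < size M) c i) = M.
  apply/polyP => i; rewrite coef_map /= coef_poly; case: ltnP => [_|sM]; first exact: cM.
  by rewrite rmorph0 nth_default.
exists (\poly_(i < size M) c i); last by rewrite ME.
by apply: contraTneq mM => p0; rewrite -ME p0 rmorph0 monicE lead_coef0 eq_sym oner_eq0.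
Qed.

(** An element that lies in every place is integral over [K], by Chevalley's
    theorem. *)
Lemma regular_algebraic f : (forall O, is_place k O -> O f) -> algebraicOver k f.
Proof.
move=> Of; apply: integral_over_constants; apply: contrapT => nf.
have [O [hO KO nOf]] := valuation_ring_separation (range_subring k) nf.
by apply: nOf; apply: Of; split.
Qed.

Lemma exists_pole t : ~ algebraicOver k t -> exists O, is_place k O /\ ~ O t.
Proof.
move=> nt; apply: contrapT => nO; apply: nt; apply: regular_algebraic => O hO.
by apply: contrapT => nOt; apply: nO; exists O.
Qed.

End Constants.

Section Curve.
Variables (K F : fieldType) (k : {rmorphism K -> F}).
Hypothesis h2 : 2%:R = 0 :> F.
Variables (x y : F) (L C : {poly K}).
Hypotheses (sL : (size L <= 2)%N) (sC : size C = 4%N) (mC : C \is monic).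
Hypothesis eqn : y ^+ 2 + peval k x L * y = peval k x C.
Hypothesis ntx : ~ algebraicOver k x.
Add Ring char2_F : (char2_ring_theory h2) (morphism (char2_ring_morph h2),
  constants [char2_constant], power_tac (char2_power_theory F) [char2_exponent]).

Local Notation E := (adjoin k [set x; y]).
Local Notation rat := (rational_functions k x).
Local Notation ev := (peval k x).
Let hrat : is_subfield rat := rational_subfield k x.

Lemma adjoin_subfield (S : set F) : is_subfield (adjoin k S).
Proof. exact: gen_subfield_subfield. Qed.
Lemma adjoin_const (S : set F) : range k `<=` adjoin k S.
Proof. by move=> f Kf; apply: gen_subfield_sub; left. Qed.
Lemma adjoin_sub (S : set F) : S `<=` adjoin k S.
Proof. by move=> f Sf; apply: gen_subfield_sub; right. Qed.
Lemma adjoin_min (S M : set F) :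
  is_subfield M -> range k `<=` M -> S `<=` M -> adjoin k S `<=` M.
Proof. by move=> hM KM SM; apply: gen_subfield_min => // f [/KM|/SM]. Qed.

Lemma curve_x : E x. Proof. by apply: adjoin_sub; left. Qed.
Lemma curve_y : E y. Proof. by apply: adjoin_sub; right. Qed.

Lemma curve_quadratic : E = quadratic_extension rat y.
Proof.
have hE := adjoin_subfield [set x; y].
apply/seteqP; split.
  apply: adjoin_min.
  - apply: (@quadratic_subfield _ _ _ (ev L) (ev C)) => //; try exact: rational_polynomial.
    by rewrite -eqn; char2_ring h2.
  - by move=> _ [c _ <-]; apply: quadratic_base => //; exact: rational_const.
  - move=> _ [->|->]; last exact: quadratic_gen.
    by apply: quadratic_base => //; exact: rational_gen.
apply: quadratic_min; [exact: hE.1| |exact: curve_y].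
by apply: rational_min; [|exact: adjoin_const|exact: curve_x].
Qed.

Lemma rational_leading f : rat f -> f != 0 -> exists n c, c != 0 /\
  forall O, is_place k O -> ~ O x -> leading_term k O x f n c.
Proof.
move=> [P [R [R0 ->]]] f0.
have Rp : R != 0 by apply: contra_neq R0 => ->; rewrite peval0.
have Pp : P != 0 by apply: contra_neq f0 => ->; rewrite peval0 mul0r.
exists ((size P).-1%:Z - (size R).-1%:Z), (lead_coef P / lead_coef R); split.
  by rewrite mulf_neq0 // ?invr_eq0 lead_coef_eq0.
move=> O hO nO; apply: leading_termM => //; first exact: leading_term_peval.
by apply: leading_termV; rewrite ?lead_coef_eq0 //; exact: leading_term_peval.
Qed.

(** A rational function of [x] has a square with an even leading exponent, whereas
    [y^2] has leading exponent 3. *)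
Lemma curve_y_irrational : ~ rat y.
Proof.
move=> ry; have [O [hO nO]] := exists_pole ntx.
have y3 := weierstrass_y hO nO sL sC mC eqn.
have y0 : y != 0.
  have := leading_term_neq0 hO (oner_neq0 _) y3.
  by apply: contra_neq => ->; rewrite expr0n.
have [n [c [c0 /(_ O hO nO) yn]]] := rational_leading ry y0.
have yn2 := leading_termM hO nO yn yn.
have := leading_term_uniq hO nO (oner_neq0 _) _ y3 yn2.
by rewrite mulf_neq0 // => /(_ isT); lia.
Qed.

Lemma curve_free p q : rat p -> rat q -> p + q * y = 0 -> p = 0 /\ q = 0.
Proof.
move=> rp rq e0; have [q0|q0] := eqVneq q 0; first by move: e0; rewrite q0 mul0r addr0.
case: curve_y_irrational; rewrite (_ : y = - p / q).
  by apply: (subringM hrat.1); [exact: (subringN hrat.1)|exact: hrat.2].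
by apply: (mulIf q0); rewrite mulfVK // mulrC; apply/eqP; rewrite -addr_eq0 addrC e0.
Qed.

Lemma curve_free_poly P Q : ev P + ev Q * y = 0 -> P = 0 /\ Q = 0.
Proof.
move/(curve_free (rational_polynomial _ _ _) (rational_polynomial _ _ _)) => [P0 Q0].
by split; apply: (peval_inj ntx); rewrite peval0.
Qed.

Lemma curve_leading f : E f -> f != 0 -> exists n c, c != 0 /\
  forall O, is_place k O -> ~ O x -> leading_term k O x (f ^+ 2) n (c ^+ 2).
Proof.
rewrite curve_quadratic => - [p [q [rp rq ->]]].
have [->|q0] := eqVneq q 0.
  rewrite mul0r addr0 => p0; have [n [c [c0 pn]]] := rational_leading rp p0.
  exists (n + n), c; split=> // O hO nO; rewrite !expr2.
  by apply: leading_termM => //; exact: pn.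
have [m [d [d0 qm]]] := rational_leading rq q0.
have [->|p0] := eqVneq p 0 => [_|_].
  exists (m + m + 3), d; split=> // O hO nO.
  rewrite add0r exprMn -[d ^+ 2]mulr1 expr2; apply: leading_termM => //.
    by rewrite [d ^+ 2]expr2; apply: leading_termM => //; exact: qm.
  exact: (weierstrass_y hO nO sL sC mC eqn).
have [n [c [c0 pn]]] := rational_leading rp p0.
case lt : (n + n < m + m + 3).
  exists (m + m + 3), d; split=> // O hO nO.
  by have := leading_term_pair hO nO sL sC mC eqn h2 (pn _ hO nO) (qm _ hO nO); rewrite lt.
exists (n + n), c; split=> // O hO nO.
by have := leading_term_pair hO nO sL sC mC eqn h2 (pn _ hO nO) (qm _ hO nO); rewrite lt.
Qed.

(** The leading exponent of [f^4] at a pole of [x] decides whether [f] is regular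
    there, and it is the same for all places; hence [x] has a single pole. *)
Lemma pole_unique O O' : is_place k O -> ~ O x -> is_place k O' -> ~ O' x ->
  forall f, E (f ^+ 2) -> O f -> O' f.
Proof.
move=> hO nO hO' nO' f Ef Of; have [->|f0] := eqVneq f 0; first exact: (subring0 hO'.1.1).
have [n [c [c0 fn]]] := curve_leading Ef (expf_neq0 2 f0).
apply: (valuation_ring_sqr hO'.1); apply: (valuation_ring_sqr hO'.1).
apply: (leading_term_le0 hO' nO' _ (fn O' hO' nO')).
apply: (leading_term_integralP hO nO _ (fn O hO nO)); first by rewrite expf_neq0.
by do 2!apply: (subringX hO.1.1).
Qed.

(** The residue field at the pole of [x] is [K]: if [f^2] has the leading term [c^2]
    then [(f - c)^2 = f^2 - c^2] vanishes there. *)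
Lemma pole_residue O f : is_place k O -> ~ O x -> E f -> O f ->
  exists c, nonunits O (f - k c).
Proof.
move=> hO nO Ef Of; have [->|f0] := eqVneq f 0.
  by exists 0; rewrite rmorph0 subrr; left.
have [n [c [c0 /(_ O hO nO) fn]]] := curve_leading Ef f0.
have := leading_term_integralP hO nO (expf_neq0 2 c0) fn (subringX hO.1.1 2 Of).
rewrite le_eqVlt => /predU1P[n0|n0].
  exists c; apply: (nonunits_sqr hO.1).
  by rewrite (char2_oppx h2) (char2_sqrD h2) -[k c ^+ 2](char2_oppx h2) -rmorphXn;
    move: fn; rewrite n0 /leading_term expr0z divr1.
exists 0; rewrite rmorph0 subr0; apply: (nonunits_sqr hO.1).
exact: (leading_term_lt0 hO nO n0 fn).
Qed.

(** A constant that is a square modulo the maximal ideal at the pole of [x] is a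
    square, because the residue field there is [K]. *)
Lemma pole_square O f b : is_place k O -> ~ O x -> E f ->
  nonunits O (f ^+ 2 - k b) -> exists e, b = e ^+ 2.
Proof.
move=> hO nO Ef mf.
have Of : O f.
  apply: (valuation_ring_sqr hO.1); rewrite -[_ ^+ 2](subrK (k b)).
  by apply: (subringD hO.1.1); [exact: (nonunits_sub hO.1)|exact: place_const].
have [c mc] := pole_residue hO nO Ef Of.
exists c; apply/eqP; rewrite -subr_eq0; apply/eqP/(place_nonunit_const hO).
rewrite rmorphB rmorphXn.
rewrite (_ : k b - k c ^+ 2 = (f - k c) ^+ 2 - (f ^+ 2 - k b)); last by char2_ring h2.
apply: (nonunitsB hO.1) => //; rewrite expr2; apply: (nonunitsMr hO.1) => //.
exact: (nonunits_sub hO.1).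
Qed.

(** Here [n] is the pole order of [P(x) + Q(x) y]; the value 1 is the gap of an
    elliptic curve. *)
Lemma curve_leading_poly P Q O : is_place k O -> ~ O x -> (P, Q) != (0, 0) ->
  exists (n : nat) c,
    [/\ c != 0, leading_term k O x ((ev P + ev Q * y) ^+ 2) n%:Z c, n != 1%N,
        ((size P).-1.*2 <= n)%N
      & Q != 0 -> ((size Q).-1.*2 + 3 <= n)%N] /\ (odd n -> Q != 0).
Proof.
move=> hO nO PQ0.
have ltP := leading_term_peval hO nO (P := P).
have ltQ := leading_term_peval hO nO (P := Q).
have [Q0|Q0] := eqVneq Q 0.
  have P0 : P != 0 by apply: contra_neq PQ0 => ->; rewrite Q0.
  exists ((size P).-1).*2, (lead_coef P * lead_coef P); split; last by lia.
  split=> //; [by rewrite mulf_neq0 // lead_coef_eq0| |by lia].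
  by rewrite Q0 peval0 mul0r addr0 expr2 -addnn PoszD; apply: leading_termM => //; exact: ltP.
have [P0|P0] := eqVneq P 0.
  exists (((size Q).-1).*2 + 3)%N, (lead_coef Q * lead_coef Q); split; last by [].
  split=> //; first by rewrite mulf_neq0 // lead_coef_eq0.
  - rewrite P0 peval0 add0r exprMn PoszD -addnn PoszD -[X in leading_term _ _ _ _ _ X]mulr1.
    rewrite [ev Q ^+ 2]expr2; apply: leading_termM => //.
      by apply: leading_termM => //; exact: ltQ.
    exact: (weierstrass_y hO nO sL sC mC eqn).
  - by lia.
  - by rewrite P0 size_poly0; lia.
have := leading_term_pair hO nO sL sC mC eqn h2 (ltP P0) (ltQ Q0).
case: ifP => [lt|/negbT nlt] ltPQ.
  exists (((size Q).-1).*2 + 3)%N, (lead_coef Q ^+ 2); split; last by [].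
  split=> //; [by rewrite expf_neq0 // lead_coef_eq0| |by lia|by lia].
  by rewrite PoszD -addnn PoszD.
exists ((size P).-1).*2, (lead_coef P ^+ 2); split; last by lia.
split=> //; [by rewrite expf_neq0 // lead_coef_eq0| |by lia|by lia].
by rewrite -addnn PoszD.
Qed.

Definition regular_at_finite f : Prop := forall O, is_place k O -> O x -> O f.

Lemma regularP f : regular_at_finite f <-> integral_closure (polynomials_in k x) f.
Proof.
have hB := polynomials_in_subring k x.
split=> [rf|intf O hO Ox].
  apply: contrapT => nf; have [O [hO BO nOf]] := valuation_ring_separation hB nf.
  apply: nOf; apply: rf; last by apply: BO; exists 'X; rewrite ?pevalX.
  by split=> // _ [c _ <-]; apply: BO; exists c%:P; rewrite ?pevalC.
apply: (valuation_ring_integral hO.1); apply: integral_closureS intf.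
by move=> _ [P _ <-]; exact: (peval_in P hO.1.1 hO.2 Ox).
Qed.

Lemma regular_poly P : regular_at_finite (ev P).
Proof. by move=> O hO Ox; exact: (peval_in P hO.1.1 hO.2 Ox). Qed.
Lemma regularM f g : regular_at_finite f -> regular_at_finite g -> regular_at_finite (f * g).
Proof. by move=> rf rg O hO Ox; apply: (subringM hO.1.1); [exact: rf|exact: rg]. Qed.
Lemma regularD f g : regular_at_finite f -> regular_at_finite g -> regular_at_finite (f + g).
Proof. by move=> rf rg O hO Ox; apply: (subringD hO.1.1); [exact: rf|exact: rg]. Qed.
Lemma regularB f g : regular_at_finite f -> regular_at_finite g -> regular_at_finite (f - g).
Proof. by move=> rf rg O hO Ox; apply: (subringB hO.1.1); [exact: rf|exact: rg]. Qed.
Lemma regular_sqr f : regular_at_finite (f ^+ 2) -> regular_at_finite f.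
Proof. by move=> rf O hO Ox; apply: (valuation_ring_sqr hO.1); exact: rf. Qed.

Lemma regular_y : regular_at_finite y.
Proof.
move=> O hO Ox; apply: contrapT => nO; have [y0 my] := valuation_ringV hO.1 nO.
have hOr := hO.1.1.
apply: nO; rewrite (_ : y = ev C / y - ev L); last by rewrite -eqn; field.
apply: (subringB hOr); last exact: regular_poly.
by apply: (subringM hOr); [exact: regular_poly|exact: (nonunits_sub hO.1)].
Qed.

(** [K[x]] is integrally closed: for a reduced fraction [f = P / R] a Bezout relation
    makes [1 / R] integral over [K[x]] too, and then [1 / R] lies in [K[x]]. *)
Lemma regular_rational f : rat f -> regular_at_finite f -> exists P, f = ev P.
Proof.
move=> /rational_coprime [P [R [/Bezout_eq1_coprimepP [[U V] /= UV] R0 ->]]] rf.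
have Ri : (ev R)^-1 = ev U * (ev P / ev R) + ev V.
  apply: (mulIf R0); rewrite mulVf // mulrDl -mulrA mulfVK //.
  by rewrite -!pevalM -pevalD UV peval1.
have : polynomials_in k x (ev R)^-1.
  apply: inv_integral; [exact: polynomials_in_subring|by exists R|].
  apply/regularP; rewrite Ri; apply: regularD; last exact: regular_poly.
  by apply: regularM => //; exact: regular_poly.
by move=> [S _ <-]; exists (P * S); rewrite pevalM.
Qed.

(** The conjugate [p + q (y + L(x))] of a regular [p + q y] satisfies the same
    integral equation over [K[x]], hence is regular too. *)
Lemma regular_conjugate p q : rat p -> rat q ->
  regular_at_finite (p + q * y) -> regular_at_finite (p + q * (y + ev L)).
Proof.
move=> rp rq /regularP [M [mM PM rM]]; apply/regularP; exists M; split=> //.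
pose G f g := rat f /\ f = g.
have hG : is_partial_iso G.
  split=> //.
  - by split=> //; exact: (subring1 hrat.1).
  - by move=> f _ g _ [rf <-] [rg <-]; split=> //; exact: (subringB hrat.1).
  - by move=> f _ g _ [rf <-] [rg <-]; split=> //; exact: (subringM hrat.1).
  - by move=> f _ [rf <-]; split=> //; exact: hrat.2.
  - by move=> f _ [rf <-].
have RL := rational_polynomial k x L; have RC := rational_polynomial k x C.
have hG' : is_partial_iso (quadratic_iso G y (y + ev L)).
  apply: (quadratic_partial_iso hG (l := ev L) (c := ev C) (l' := ev L) (c' := ev C)).
  - by [].
  - by [].
  - by rewrite -eqn; char2_ring h2.
  - by rewrite -eqn; char2_ring h2.
  - by move=> f [ry _]; exact: curve_y_irrational.
  - move=> f [rf fE]; apply: curve_y_irrational; rewrite -(addrK (ev L) y) -fE.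
    exact: (subringB hrat.1).
have Gf : quadratic_iso G y (y + ev L) (p + q * y) (p + q * (y + ev L)).
  by exists p, p, q, q.
have GM (N : {poly F}) : (forall n, polynomials_in k x N`_n) ->
    quadratic_iso G y (y + ev L) N.[p + q * y] N.[p + q * (y + ev L)].
  elim/poly_ind: N => [|N c IH] PN; first by rewrite !horner0; exact: (piso0 hG').
  have Pc : polynomials_in k x c by have := PN 0%N; rewrite coefD coefMX coefC add0r.
  have PN' n : polynomials_in k x N`_n by have := PN n.+1; rewrite coefD coefMX coefC addr0.
  rewrite !hornerMXaddC; apply: (pisoD hG'); first by apply: (pisoM hG'); [exact: IH|].
  apply: (quadratic_iso_base hG); split=> //.
  by have [S _ <-] := Pc; exact: rational_polynomial.
by rewrite /root; apply/eqP/(piso_eq0 hG' (GM M PM))/eqP.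
Qed.

(** The trace [q L] and the norm of a regular element are polynomials, which bounds
    the denominators of [p] and [q] by [L]. *)
Lemma regular_denominators f : E f -> regular_at_finite f ->
  exists p q r s n, [/\ f = p + q * y, q * ev L = ev r, p * ev L = ev s
    & s ^+ 2 + s * r * L + r ^+ 2 * C = L ^+ 2 * n].
Proof.
rewrite curve_quadratic => - [p [q [rp rq ->]]] rf.
have rg := regular_conjugate rp rq rf.
have RL := rational_polynomial k x L; have RC := rational_polynomial k x C.
have RM := subringM hrat.1; have RD := subringD hrat.1.
have [|r qL] := regular_rational (RM _ _ rq RL).
  rewrite (_ : q * ev L = (p + q * y) + (p + q * (y + ev L))); last by char2_ring h2.
  exact: regularD.
have [|s pL] := regular_rational (RM _ _ rp RL).
  rewrite (_ : p * ev L = (p + q * y) * ev L - q * ev L * y); last by ring.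
  apply: regularB; first by apply: regularM => //; exact: regular_poly.
  by rewrite qL; apply: regularM; [exact: regular_poly|exact: regular_y].
have [||n nE] := @regular_rational (p * p + p * q * ev L + q * q * ev C).
- by auto 8.
- rewrite (_ : _ + _ = (p + q * y) * (p + q * (y + ev L))); last by rewrite -eqn; char2_ring h2.
  exact: regularM.
exists p, q, r, s, n; split=> //; apply: (peval_inj ntx).
by rewrite !pevalE -qL -pL -nE; ring.
Qed.

(** For a singular equation [K[x, y]] is not integrally closed; its integral
    closedness is the form in which smoothness of the affine curve enters. *)
Definition smooth_affine : Prop := forall f, E f -> regular_at_finite f ->
  exists P Q, f = ev P + ev Q * y.

End Curve.

(** Both [p L] and [q L] are polynomials, and the nonzero constant [L] can be divided
    out; the curve is then unramified over the affine [x]-line. *)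
Lemma smooth_affine_const (K F : fieldType) (k : {rmorphism K -> F}) (x y : F) (L C : {poly K}) :
  2%:R = 0 :> F -> (size L <= 2)%N -> size C = 4%N -> C \is monic ->
  y ^+ 2 + peval k x L * y = peval k x C -> ~ algebraicOver k x ->
  size L = 1%N -> smooth_affine k x y.
Proof.
move=> h2 sL sC mC eqn ntx /eqP/size_poly1P [a a0 LE] f Ef rf.
have [p [q [r [s [n [-> qL pL _]]]]]] := regular_denominators h2 sL sC mC eqn ntx Ef rf.
have ka0 : k a != 0 by rewrite fmorph_eq0.
exists (a^-1 *: s), (a^-1 *: r); rewrite !pevalZ -qL -pL LE pevalC fmorphV.
by rewrite ![_ * k a]mulrC !mulKf.
Qed.

(** When [L = X], the curve is smooth at the points with [x = 0] provided that
    [C] has a simple zero at [0]; there the norm equation forces [X] to divide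
    both numerators. *)
Lemma smooth_affine_X (K F : fieldType) (k : {rmorphism K -> F}) (x y : F) (L C : {poly K}) :
  2%:R = 0 :> F -> (size L <= 2)%N -> size C = 4%N -> C \is monic ->
  y ^+ 2 + peval k x L * y = peval k x C -> ~ algebraicOver k x ->
  L = 'X -> C`_0 = 0 -> C`_1 != 0 -> smooth_affine k x y.
Proof.
move=> h2 sL sC mC eqn ntx LE C0 C1 f Ef rf.
have X0 : ('X : {poly K}) != 0 by rewrite polyX_eq0.
have x0 : x != 0.
  by have := peval_transcendental ntx X0; rewrite pevalX.
have [p [q [r [s [n [-> qL pL N]]]]]] := regular_denominators h2 sL sC mC eqn ntx Ef rf.
have dvdX (P : {poly K}) : P.[0] = 0 -> exists Q, P = Q * 'X.
  move=> P0; have /factor_theorem [Q QE] : root P 0 by rewrite /root P0.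
  by exists Q; rewrite QE subr0.
have /dvdX [s' sE] : s.[0] = 0.
  have /eqP := congr1 (horner^~ 0) N.
  rewrite LE /= !(hornerD, hornerM, horner_exp) hornerX (horner_coef0 C) C0.
  by rewrite !(mulr0, mul0r, expr0n, addr0) sqrf_eq0 => /eqP.
have [D CE] : exists D, C = D * 'X by apply: dvdX; rewrite horner_coef0.
have /dvdX [r' rE] : r.[0] = 0.
  have : 'X * (s' ^+ 2 * 'X + s' * r * 'X + r ^+ 2 * D) = 'X * ('X * n).
    by rewrite mulrA -expr2 -[in RHS]LE -N sE CE LE; ring.
  move/(mulfI X0)/(congr1 (horner^~ 0)) => /eqP.
  have D0 : D.[0] = C`_1 by rewrite CE coefMX horner_coef0.
  rewrite /= !(hornerD, hornerM, horner_exp) hornerX D0 !(mulr0, mul0r, add0r).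
  by rewrite mulf_eq0 (negPf C1) orbF sqrf_eq0 => /eqP.
exists s', r'; move: qL pL; rewrite sE rE LE !pevalM pevalX => qx px.
by rewrite (mulIf x0 qx) (mulIf x0 px).
Qed.

(** * Changes of Weierstrass coordinates *)

Section Coordinates.
Variables (K F : fieldType) (k : {rmorphism K -> F}).
Hypothesis h2 : 2%:R = 0 :> F.
Variables (x y : F) (L C : {poly K}).
Hypotheses (sL : (size L <= 2)%N) (sC : size C = 4%N) (mC : C \is monic).
Hypothesis eqn : y ^+ 2 + peval k x L * y = peval k x C.
Hypothesis smooth : smooth_affine k x y.
Local Notation E := (adjoin k [set x; y]).
Local Notation lt O := (leading_term k O x).

Lemma peval_affine t (P : {poly K}) : (size P <= 2)%N ->
  peval k t P = k P`_1 * t + k P`_0.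
Proof.
move=> sP; rewrite /peval (@horner_coef_wide _ 2) ?size_map_poly //.
by rewrite !big_ord_recl big_ord0 !coef_map /= expr0 expr1 mulr1 addr0 addrC.
Qed.

(** The pole order [n] of a regular function skips the value 1, and it bounds the
    degrees of the polynomials in [f = P(x) + Q(x) y]. *)
Lemma regular_leading O f : is_place k O -> ~ O x -> E f ->
  regular_at_finite k x f -> f != 0 ->
  exists (n : nat) c, [/\ c != 0, lt O (f ^+ 2) n%:Z c, n != 1%N
    & (n <= 3)%N -> exists b g d, [/\ f = k b * y + k g * x + k d,
        (n <= 2)%N -> b = 0 & n = 3%N -> b != 0]].
Proof.
move=> hO nO Ef rf f0; have [P [Q fE]] := smooth Ef rf.
have PQ0 : (P, Q) != (0, 0).
  by apply: contra_neq f0 => -[P0 Q0]; rewrite fE P0 Q0 !peval0 mul0r addr0.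
have [n [c [[c0 fn n1 sP sQ] oQ]]] := curve_leading_poly h2 sL sC mC eqn hO nO PQ0.
exists n, c; rewrite fE; split=> // n3.
have Q0 : (n <= 2)%N -> Q = 0.
  move=> n2; apply/eqP; apply: contraT => /sQ; lia.
have sQ1 : (size Q <= 1)%N.
  have [->|/sQ] := eqVneq Q 0; first by rewrite size_poly0.
  by lia.
have sP2 : (size P <= 2)%N by lia.
exists Q`_0, P`_1, P`_0; split.
- by rewrite (peval_affine x sP2) {1}(size1_polyC sQ1) pevalC addrC addrA.
- by move=> /Q0 ->; rewrite coef0.
- move=> n3'; have : Q != 0 by apply: oQ; rewrite n3'.
  by rewrite {1}(size1_polyC sQ1) polyC_eq0.
Qed.

(** The Riemann-Roch spaces of [2P] and [3P], where [P] is the pole of [x]. *)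
Lemma small_pole O f N : is_place k O -> ~ O x -> E f ->
  regular_at_finite k x f -> (N <= 3)%N -> O (f ^+ 2 / x ^+ N) ->
  exists b g d, f = k b * y + k g * x + k d /\ ((N <= 2)%N -> b = 0).
Proof.
move=> hO nO Ef rf N3 Of; have [->|f0] := eqVneq f 0.
  by exists 0, 0, 0; rewrite rmorph0 !mul0r !addr0.
have [n [c [c0 fn _ H]]] := regular_leading hO nO Ef rf f0.
have nN : (n <= N)%N.
  have xN : lt O (x ^+ N) (1 *+ N) 1.
    rewrite -[X in leading_term _ _ _ _ _ X](expr1n K N).
    by apply: leading_termX => //; exact: leading_term_gen.
  have fx := leading_termM hO nO fn (leading_termV hO nO (oner_neq0 _) xN).
  rewrite invr1 mulr1 in fx.
  have := leading_term_integralP hO nO c0 fx Of.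
  by rewrite -[1 *+ N]/(N%:R) natz; lia.
have [b [g [d [fE b0 _]]]] := H (leq_trans nN N3).
by exists b, g, d; split=> // N2; apply: b0; lia.
Qed.

End Coordinates.

(** By uniqueness of the pole, a place where [x'] is regular is not the common pole
    of [x] and [x']. *)
Lemma same_pole_regular (K F : fieldType) (k : {rmorphism K -> F}) (x y x' y' : F)
    (L C : {poly K}) (O : set F) f :
  2%:R = 0 :> F -> (size L <= 2)%N -> size C = 4%N -> C \is monic ->
  y ^+ 2 + peval k x L * y = peval k x C ->
  adjoin k [set x; y] = adjoin k [set x'; y'] ->
  is_place k O -> ~ O x -> ~ O x' ->
  regular_at_finite k x f -> regular_at_finite k x' f.
Proof.
move=> h2 sL sC mC eqn EE' hO nO nO' rf O1 hO1 O1x'.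
apply: rf => //; apply: contrapT => nO1.
apply: nO'; apply: (pole_unique h2 sL sC mC eqn hO1 nO1 hO nO _ O1x').
by rewrite EE'; apply: (subringX (adjoin_subfield k _).1); exact: curve_x.
Qed.

Section ChangeOfCoordinates.
Variables (K F : fieldType) (k : {rmorphism K -> F}).
Hypothesis h2 : 2%:R = 0 :> F.
Variables (x y x' y' : F) (L C L' C' : {poly K}).
Hypotheses (sL : (size L <= 2)%N) (sC : size C = 4%N) (mC : C \is monic).
Hypotheses (sL' : (size L' <= 2)%N) (sC' : size C' = 4%N) (mC' : C' \is monic).
Hypothesis eqn : y ^+ 2 + peval k x L * y = peval k x C.
Hypothesis eqn' : y' ^+ 2 + peval k x' L' * y' = peval k x' C'.
Hypothesis ntx : ~ algebraicOver k x.
Hypotheses (smooth : smooth_affine k x y) (smooth' : smooth_affine k x' y').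
Hypothesis EE' : adjoin k [set x; y] = adjoin k [set x'; y'].
Variable O : set F.
Hypotheses (hO : is_place k O) (nO : ~ O x) (nO' : ~ O x').
Local Notation E := (adjoin k [set x; y]).
Local Notation E' := (adjoin k [set x'; y']).

(** Let [x^2] have exponent [n] with respect to [x'] and [x'^2] exponent [m] with
    respect to [x].  Then [n m = 4], and since neither is 1, both are 2; hence [y^2]
    has exponent 3 with respect to [x'], and regular functions of pole order at most
    3 are affine in [x'] and [y']. *)
Lemma change_of_coordinates : exists l m n p q,
  [/\ l != 0, n != 0, x = k l * x' + k m & y = k n * y' + k p * x' + k q].
Proof.
have x0 := pole_neq0 hO nO; have x'0 := pole_neq0 hO nO'.
have rx' := same_pole_regular h2 sL sC mC eqn EE' hO nO nO'.
have rx := same_pole_regular h2 sL' sC' mC' eqn' (esym EE') hO nO' nO.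
have regX (t : F) : regular_at_finite k t t by move=> O1 _.
have Ex' : E x' by rewrite EE'; exact: curve_x.
have Ex : E' x by rewrite -EE'; exact: curve_x.
have [n [c [c0 xn n1 xE]]] := regular_leading h2 sL' sC' mC' eqn' smooth' hO nO' Ex
  (rx' _ (regX x)) x0.
have [m [d [d0 xm m1 _]]] := regular_leading h2 sL sC mC eqn smooth hO nO Ex'
  (rx _ (regX x')) x'0.
have lx' := leading_term_gen (k := k) hO nO'.
have nm : (n * m = 4)%N.
  have u0 : leading_term k O x' (x' ^+ 2 / x ^ m%:Z) 0 d.
    by rewrite /leading_term expr0z divr1.
  have e1 := leading_termM hO nO' (leading_termX hO nO' 2 u0) (leading_termX hO nO' m xn).
  have : (x' ^+ 2 / x ^ m%:Z) ^+ 2 * x ^+ 2 ^+ m = x' ^+ 4.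
    rewrite -exprnP exprMn exprVn -!exprM [(m * 2)%N]mulnC mulfVK ?expf_neq0 //.
  move=> e2; rewrite {}e2 in e1.
  have := leading_term_uniq hO nO' _ _ (leading_termX hO nO' 4 lx') e1.
  rewrite expr1n oner_eq0 mulf_neq0 ?expf_neq0 // => /(_ isT isT).
  have nz (a i : nat) : a%:Z *+ i = (a * i)%:Z by rewrite -mulr_natr natz PoszM.
  by rewrite mul0rn add0r (nz 1%N) nz mul1n => -[].
have n2 : n = 2%N.
  by move: nm n1 m1; clear; move: n m => [|[|[|[|[|n]]]]] [|[|[|[|[|m]]]]]; lia.
have n3 : (n <= 3)%N by rewrite n2.
have [b' [l [e [xE' b0' _]]]] := xE n3.
move: xE'; rewrite b0' ?n2 // rmorph0 mul0r add0r => {b' b0'}xE'.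
have l0 : l != 0.
  apply/eqP => l0; apply: ntx; rewrite xE' l0 rmorph0 mul0r add0r.
  exact: algebraic_id.
have Ey : E' y by rewrite -EE'; exact: curve_y.
have y0 : y != 0.
  have := leading_term_neq0 hO (oner_neq0 _) (weierstrass_y hO nO sL sC mC eqn).
  by apply: contra_neq => ->; rewrite expr0n.
have [h [g [g0 yh _ yE]]] := regular_leading h2 sL' sC' mC' eqn' smooth' hO nO' Ey
  (rx' _ (regular_y eqn)) y0.
have h3 : h = 3%N.
  have xl : leading_term k O x' x 1 l.
    rewrite xE'; apply: (leading_termD hO nO' (n' := 0) _ _ (leading_term_const k O x' e)) => //.
    by have := leading_termM hO nO' (leading_term_const k O x' l) lx'; rewrite add0r mulr1.
  have y3 : leading_term k O x' (y ^+ 2 / x ^+ 3) 0 1.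
    by rewrite /leading_term expr0z divr1; exact: (weierstrass_y hO nO sL sC mC eqn).
  have := leading_termM hO nO' y3 (leading_termX hO nO' 3 xl).
  rewrite mulfVK ?expf_neq0 // => y3'.
  have := leading_term_uniq hO nO' g0 _ yh y3'.
  by rewrite mul1r expf_neq0 // => /(_ isT); lia.
have h3' : (h <= 3)%N by rewrite h3.
have [b [p [q [yE' _ b0]]]] := yE h3'.
by exists l, e, b, p, q; split=> //; exact: b0.
Qed.

End ChangeOfCoordinates.

(** * The invariant derivation of an elliptic function field *)

Section WeierstrassPolynomials.
Variables (K F : fieldType) (k : {rmorphism K -> F}).

Definition weierstrass_trace (a1 a3 : K) : {poly K} := a1 *: 'X + a3%:P.
Definition weierstrass_cubic (a2 a4 a6 : K) : {poly K} :=
  'X^3 + (a2 *: 'X^2 + a4 *: 'X + a6%:P).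

Lemma size_weierstrass_trace a1 a3 : (size (weierstrass_trace a1 a3) <= 2)%N.
Proof.
rewrite (leq_trans (size_polyD _ _)) // geq_max (leq_trans (size_scale_leq _ _)) ?size_polyX //.
by rewrite (leq_trans (size_polyC_leq1 _)).
Qed.

Let size_tail (a2 a4 a6 : K) : (size (a2 *: 'X^2 + a4 *: 'X + a6%:P)%R < 4)%N.
Proof.
rewrite ltnS (leq_trans (size_polyD _ _)) // geq_max (leq_trans (size_polyC_leq1 _)) // andbT.
rewrite (leq_trans (size_polyD _ _)) // geq_max !(leq_trans (size_scale_leq _ _)) ?size_polyX //.
by rewrite size_polyXn.
Qed.

Lemma size_weierstrass_cubic a2 a4 a6 : size (weierstrass_cubic a2 a4 a6) = 4%N.
Proof. by rewrite size_polyDl size_polyXn // size_tail. Qed.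

Lemma monic_weierstrass_cubic a2 a4 a6 : weierstrass_cubic a2 a4 a6 \is monic.
Proof. by rewrite monicE lead_coefDl ?lead_coefXn // size_polyXn size_tail. Qed.

Lemma peval_weierstrass_trace t a1 a3 :
  peval k t (weierstrass_trace a1 a3) = k a1 * t + k a3.
Proof. by rewrite !pevalE. Qed.

Lemma peval_weierstrass_cubic t a2 a4 a6 :
  peval k t (weierstrass_cubic a2 a4 a6) = t ^+ 3 + (k a2 * t ^+ 2 + k a4 * t + k a6).
Proof. by rewrite !pevalE. Qed.

End WeierstrassPolynomials.

Section InvariantDerivation.
Variables (K F : fieldType) (k : {rmorphism K -> F}).
Hypothesis h2 : 2%:R = 0 :> F.
Variables (x y : F) (a1 a2 a3 a4 a6 : K).
Local Notation L := (weierstrass_trace a1 a3).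
Local Notation C := (weierstrass_cubic a2 a4 a6).
Hypothesis eqn : y ^+ 2 + peval k x L * y = peval k x C.
Hypothesis ntx : ~ algebraicOver k x.
Hypothesis L0 : L != 0.
Local Notation E := (adjoin k [set x; y]).
Local Notation M := (adjoin k [set x ^+ 2; y ^+ 2]).
Add Ring char2_F : (char2_ring_theory h2) (morphism (char2_ring_morph h2),
  constants [char2_constant], power_tac (char2_power_theory F) [char2_exponent]).

Let sL := size_weierstrass_trace a1 a3.
Let sC := size_weierstrass_cubic a2 a4 a6.
Let mC := monic_weierstrass_cubic a2 a4 a6.

(** [x^2] and [y^2] satisfy the Weierstrass equation with squared coefficients,
    so pole orders of elements of [M] at the pole of [x] are even. *)
Lemma frobenius_y : ~ M y.
Proof.
move=> My; have [O [hO nO]] := exists_pole ntx.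
have nO2 : ~ O (x ^+ 2) by move/(valuation_ring_sqr hO.1).
have ntx2 : ~ algebraicOver k (x ^+ 2).
  move=> [P P0 /rootP rP]; apply: ntx; exists (P \Po 'X^2).
    by rewrite comp_poly_eq0 ?size_polyXn.
  by rewrite map_comp_poly rmorphXn /= map_polyX /root horner_comp hornerXn rP.
have y3 := weierstrass_y hO nO sL sC mC eqn.
have y0 : y != 0.
  have := leading_term_neq0 hO (oner_neq0 _) y3.
  by apply: contra_neq => ->; rewrite expr0n.
have eqn2 : (y ^+ 2) ^+ 2 + peval k (x ^+ 2) (weierstrass_trace (a1 ^+ 2) (a3 ^+ 2)) * y ^+ 2
    = peval k (x ^+ 2) (weierstrass_cubic (a2 ^+ 2) (a4 ^+ 2) (a6 ^+ 2)).
  have := congr1 (fun f => f ^+ 2) eqn.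
  rewrite !peval_weierstrass_trace !peval_weierstrass_cubic !rmorphXn.
  by move=> e; apply: (char2_eq_lin h2 (c := 1) e); char2_ring h2.
have [n [c [c0 /(_ O hO nO2) yn]]] := curve_leading h2 (size_weierstrass_trace _ _)
  (size_weierstrass_cubic _ _ _) (monic_weierstrass_cubic _ _ _) eqn2 My y0.
have yn' : leading_term k O x (y ^+ 2) (2 * n) (c ^+ 2).
  by move: yn; rewrite /leading_term -(exprz_exp x 2).
have := leading_term_uniq hO nO (oner_neq0 _) _ y3 yn'.
by rewrite expf_neq0 // => /(_ isT); lia.
Qed.

(** Odd powers of [x] are multiples of [x] by powers of [x^2], so over [M] the
    equation has degree 1 in [x] and can be solved for [x] in terms of [y]. *)
Lemma frobenius_quadratic : E `<=` quadratic_extension M y.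
Proof.
have hM := adjoin_subfield k [set x ^+ 2; y ^+ 2].
have Mk c : M (k c) by apply: adjoin_const; exists c.
have Mx : M (x ^+ 2) by apply: adjoin_sub; left.
have My : M (y ^+ 2) by apply: adjoin_sub; right.
have hQ : is_subfield (quadratic_extension M y).
  apply: (quadratic_subfield hM (l := 0) (c := y ^+ 2)) => //; last by rewrite mul0r add0r.
  exact: (subring0 hM.1).
have base f : M f -> quadratic_extension M y f by exact: quadratic_base.
have Qy : quadratic_extension M y y by exact: quadratic_gen.
apply: adjoin_min => //; first by move=> _ [c _ <-]; exact: base.
move=> _ [->|-> //].
pose u := x ^+ 2 + k a4 + k a1 * y.
have u0 : u != 0.
  apply/eqP => u0; have [] := curve_free_poly sL sC mC eqn ntx (P := 'X^2 + a4%:P) (Q := a1%:P).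
    by rewrite !pevalE.
  move=> /(congr1 (fun P : {poly K} => P`_2)); rewrite coefD coefXn coefC coef0 addr0 => /eqP.
  by rewrite oner_eq0.
have xE : x = (y ^+ 2 + k a3 * y + k a2 * x ^+ 2 + k a6) / u.
  apply: (mulIf u0); rewrite mulfVK //.
  apply: (char2_eq_lin h2 (c := 1) eqn).
  by rewrite peval_weierstrass_trace peval_weierstrass_cubic /u; char2_ring h2.
have QM := subringM hQ.1; have QD := subringD hQ.1; have QV := hQ.2.
have Qk c : quadratic_extension M y (k c) by exact: base.
have Qx2 := base _ Mx; have Qy2 := base _ My.
have Qu : quadratic_extension M y u by rewrite /u; auto.
by rewrite [X in quadratic_extension _ _ X]xE; auto 10.
Qed.

(** On [E = M + M y] the map [p + q y |-> q] is a derivation.  It does not kill [x],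
    by differentiating the equation, so it can be rescaled to the derivation dual to
    the invariant differential [dx / L(x)]. *)
Lemma invariant_derivation : exists D, derivation_on k E D /\ D x = peval k x L.
Proof.
have hM := adjoin_subfield k [set x ^+ 2; y ^+ 2].
have hE := adjoin_subfield k [set x; y].
have My : M (y ^+ 2) by apply: adjoin_sub; right.
have /choice [D0 D0P] : forall f, exists q,
    quadratic_extension M y f -> M q /\ exists2 p, M p & f = p + q * y.
  move=> f; have [[p [q [Mp Mq fE]]]|nf] := pselect (quadratic_extension M y f).
    by exists q => _; split=> //; exists p.
  by exists 0.
have D0E p q : M p -> M q -> D0 (p + q * y) = q.
  move=> Mp Mq; have [|Mq' [p' Mp' e]] := D0P (p + q * y); first by exists p, q.
  set q' := D0 _ in Mq' e *.
  have [/eqP|qq] := eqVneq (q' - q) 0; first by rewrite subr_eq0 => /eqP.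
  have yE : y = (p - p') / (q' - q).
    apply: (mulIf qq); rewrite mulfVK // mulrC.
    have -> : p = p' + q' * y - q * y by rewrite -e addrK.
    by ring.
  case: frobenius_y; rewrite [X in adjoin _ _ X]yE.
  by apply: (subringM hM.1); [|apply: hM.2]; exact: (subringB hM.1).
have MD := subringD hM.1; have MM := subringM hM.1.
have D0k c : D0 (k c) = 0.
  have := D0E (k c) 0; rewrite mul0r addr0; apply; last exact: (subring0 hM.1).
  by apply: adjoin_const; exists c.
have D0D f g : E f -> E g -> D0 (f + g) = D0 f + D0 g.
  move=> /frobenius_quadratic [p [q [Mp Mq ->]]] /frobenius_quadratic [r [s [Mr Ms ->]]].
  by rewrite !D0E // addrACA -mulrDl D0E //; auto.
have D0M f g : E f -> E g -> D0 (f * g) = f * D0 g + g * D0 f.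
  move=> /frobenius_quadratic [p [q [Mp Mq ->]]] /frobenius_quadratic [r [s [Mr Ms ->]]].
  rewrite !(D0E p q, D0E r s) //.
  rewrite (_ : _ * _ = (p * r + q * s * y ^+ 2) + (p * s + q * r) * y); last by ring.
  by rewrite D0E; [char2_ring h2|auto|auto].
have D0y : D0 y = 1.
  have := D0E 0 1; rewrite add0r mul1r; apply; [exact: (subring0 hM.1)|exact: (subring1 hM.1)].
have hD0 : derivation_on k E D0 by split.
have KE : range k `<=` E by exact: adjoin_const.
have Ex : E x by exact: curve_x. have Ey : E y by exact: curve_y.
have EM := subringM hE.1; have ED := subringD hE.1; have Ek c : E (k c) by apply: KE; exists c.
have l0 : peval k x L != 0 by exact: peval_transcendental.
have ED0 : peval k x L * 1 + y * (peval k x L^`() * D0 x) = peval k x C^`() * D0 x.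
  rewrite -!(der_peval hE KE hD0) // -D0y -eqn.
  have EL : E (peval k x L) by exact: (peval_in _ hE.1 KE Ex).
  rewrite (derD hD0); [|by rewrite expr2; exact: EM|exact: EM].
  by rewrite (der_sqr h2 hD0) // add0r (derM hD0).
have xi0 : D0 x != 0.
  by apply: contra_neq l0 => xi0; move: ED0; rewrite xi0 !mulr0 addr0 mulr1.
exists (fun f => peval k x L / D0 x * D0 f); split; last by rewrite mulfVK.
split=> [c|f g Ef Eg|f g Ef Eg]; first by rewrite D0k mulr0.
  by rewrite D0D // mulrDr.
by rewrite D0M //; ring.
Qed.

End InvariantDerivation.

(** * The two families of elliptic function fields *)

Section Families.
Variables (K F : fieldType) (k : {rmorphism K -> F}).
Hypothesis h2 : 2%:R = 0 :> F.
Add Ring char2_F : (char2_ring_theory h2) (morphism (char2_ring_morph h2),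
  constants [char2_constant], power_tac (char2_power_theory F) [char2_exponent]).

Definition curve_A (x y : F) (a a4 a6 : K) : Prop :=
  y ^+ 2 + k a * y = x ^+ 3 + k a4 * x + k a6.

Definition curve_B (x y : F) (a eta : K) : Prop :=
  y ^+ 2 + x * y = x ^+ 3 + k a * x ^+ 2 + k eta * x.

Lemma curve_A_weierstrass x y a a4 a6 : curve_A x y a a4 a6 ->
  y ^+ 2 + peval k x (weierstrass_trace 0 a) * y = peval k x (weierstrass_cubic 0 a4 a6).
Proof.
move=> e; rewrite peval_weierstrass_trace peval_weierstrass_cubic rmorph0.
by rewrite !mul0r !add0r addrA.
Qed.

Lemma curve_B_weierstrass x y a eta : curve_B x y a eta ->
  y ^+ 2 + peval k x (weierstrass_trace 1 0) * y = peval k x (weierstrass_cubic a eta 0).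
Proof.
move=> e; rewrite peval_weierstrass_trace peval_weierstrass_cubic rmorph1 rmorph0.
by rewrite mul1r !addr0 addrA.
Qed.

Lemma trace_A (a : K) : weierstrass_trace 0 a = a%:P.
Proof. by rewrite /weierstrass_trace scale0r add0r. Qed.

Lemma trace_B : weierstrass_trace 1 0 = 'X :> {poly K}.
Proof. by rewrite /weierstrass_trace scale1r addr0. Qed.

Lemma smooth_A x y a a4 a6 : curve_A x y a a4 a6 -> a != 0 -> ~ algebraicOver k x ->
  smooth_affine k x y.
Proof.
move=> e a0 ntx; apply: (smooth_affine_const h2 _ _ _ (curve_A_weierstrass e)) => //.
- exact: size_weierstrass_trace.
- exact: size_weierstrass_cubic.
- exact: monic_weierstrass_cubic.
- by rewrite trace_A size_polyC a0.
Qed.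

Lemma smooth_B x y a eta : curve_B x y a eta -> eta != 0 -> ~ algebraicOver k x ->
  smooth_affine k x y.
Proof.
move=> e eta0 ntx; apply: (smooth_affine_X h2 _ _ _ (curve_B_weierstrass e)) => //.
- exact: size_weierstrass_trace.
- exact: size_weierstrass_cubic.
- exact: monic_weierstrass_cubic.
- exact: trace_B.
- by rewrite !coefD !coefZ !coefXn coefX coefC !mulr0 !addr0.
- by rewrite !coefD !coefZ !coefXn coefX coefC mulr0 mulr1 add0r add0r addr0.
Qed.

Section Pole.
Variables (O : set F) (x y : F).
Hypotheses (hO : is_place k O) (nO : ~ O x).
Hypothesis y3 : leading_term k O x (y ^+ 2) 3 1.
Let x0 := pole_neq0 hO nO.
Let lx : leading_term k O x x 1 1 := leading_term_gen hO nO.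

Lemma pole_y_neq0 : y != 0.
Proof.
by have := leading_term_neq0 hO (oner_neq0 _) y3; apply: contra_neq => ->; rewrite expr0n.
Qed.

Lemma pole_x_y2 : nonunits O (x / y ^+ 2).
Proof.
have := leading_termM hO nO lx (leading_termV hO nO (oner_neq0 _) y3).
exact: (leading_term_lt0 hO nO).
Qed.

Lemma pole_x_y : nonunits O (x / y).
Proof.
apply: (nonunits_sqr hO.1).
have := leading_termM hO nO (leading_termX hO nO 2 lx) (leading_termV hO nO (oner_neq0 _) y3).
by rewrite expr_div_n; exact: (leading_term_lt0 hO nO).
Qed.

Lemma pole_y_x2 : nonunits O (y / x ^+ 2).
Proof.
apply: (nonunits_sqr hO.1).
have lx4 : leading_term k O x (x ^+ 4) 4 1.
  by have := leading_termX hO nO 4 lx; rewrite expr1n.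
have := leading_termM hO nO y3 (leading_termV hO nO (oner_neq0 _) lx4).
by rewrite expr_div_n -exprM; exact: (leading_term_lt0 hO nO).
Qed.
End Pole.

Definition pole_y_leading_A O x y a a4 a6 (hO : is_place k O) (nO : ~ O x) (e : curve_A x y a a4 a6) :=
  weierstrass_y hO nO (size_weierstrass_trace _ _) (size_weierstrass_cubic _ _ _)
    (monic_weierstrass_cubic _ _ _) (curve_A_weierstrass e).
Definition pole_y_leading_B O x y a eta (hO : is_place k O) (nO : ~ O x) (e : curve_B x y a eta) :=
  weierstrass_y hO nO (size_weierstrass_trace _ _) (size_weierstrass_cubic _ _ _)
    (monic_weierstrass_cubic _ _ _) (curve_B_weierstrass e).

(** If [x'] has a pole at [O], the function [y' / x'^2] is regular there and its
    derivative is [D x' / a'] times a unit. *)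
Lemma invariant_ratio_A (E O : set F) (D : F -> F) x' y' a' a4' a6' :
  is_subfield E -> range k `<=` E -> derivation_on k E D -> is_place k O ->
  E x' -> E y' -> (forall f, E f -> O f -> O (D f)) ->
  curve_A x' y' a' a4' a6' -> a' != 0 -> O (D x').
Proof.
move=> hE KE hD hO Ex Ey DO e a0.
have [Ox|nOx] := pselect (O x'); first exact: DO.
have x0 := pole_neq0 hO nOx.
have y3 := pole_y_leading_A hO nOx e.
have my := pole_y_x2 hO nOx y3.
have Eyx : E (x'^-1 ^+ 2 * y').
  by apply: (subringM hE.1) => //; apply: (subringX hE.1); exact: hE.2.
have ka0 : k a' != 0 by rewrite fmorph_eq0.
have EM := subringM hE.1; have Ek c : E (k c) by apply: KE; exists c.
have Dy : D y' = (x' ^+ 2 + k a4') * D x' / k a'.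
  apply: (mulIf ka0); rewrite mulfVK // mulrC -(derZ KE hD) //.
  have Ex2 : E (x' ^+ 2) by exact: (subringX hE.1).
  have Ey2 : E (y' ^+ 2) by exact: (subringX hE.1).
  have ED := subringD hE.1.
  have -> : k a' * y' = y' ^+ 2 + x' ^+ 2 * x' + k a4' * x' + k a6'.
    by apply: (char2_eq_lin h2 (c := 1) e); char2_ring h2.
  rewrite !(derD hD) ?(der_const hD) ?(der_sqr h2 hD) ?(der_sqrM h2 hE hD) ?(derZ KE hD) //; auto 8.
  by rewrite add0r addr0 mulrDl.
have mu : nonunits O (k a4' * x'^-1 ^+ 2).
  apply: (nonunitsMl hO.1); first exact: place_const.
  apply: (nonunitsMr hO.1); first exact: (pole_inv hO nOx).
  by apply: (nonunits_sub hO.1); exact: (pole_inv hO nOx).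
have [u0 Oui] := unitD1 hO.1 mu.
rewrite (_ : D x' = k a' * (1 + k a4' * x'^-1 ^+ 2)^-1 * D (x'^-1 ^+ 2 * y')).
  apply: (subringM hO.1.1); last first.
    apply: DO => //; apply: (nonunits_sub hO.1).
    by rewrite mulrC exprVn.
  by apply: (subringM hO.1.1) => //; exact: place_const.
have Exi : E x'^-1 by exact: hE.2.
rewrite (der_sqrM h2 hE hD) // Dy.
set u := 1 + _ in u0 *.
have -> : x' ^+ 2 + k a4' = x' ^+ 2 * u by rewrite /u; field.
by field; rewrite x0 u0 ka0.
Qed.

End Families.

Section InvariantDifferentials.
Variables (K F : fieldType) (k : {rmorphism K -> F}).
Hypothesis h2 : 2%:R = 0 :> F.
Add Ring char2_F : (char2_ring_theory h2) (morphism (char2_ring_morph h2),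
  constants [char2_constant], power_tac (char2_power_theory F) [char2_exponent]).

Section Ratio.
Variables (E O : set F) (D : F -> F).
Hypotheses (hE : is_subfield E) (KE : range k `<=` E) (hD : derivation_on k E D).
Hypothesis hO : is_place k O.
Hypothesis DO : forall f, E f -> O f -> O (D f).
Let EM := subringM hE.1.
Let ED := subringD hE.1.
Let EX := subringX hE.1.
Let EV := hE.2.
Let Ek c : E (k c). Proof. by apply: KE; exists c. Qed.

Lemma deriv_curve_B x y a eta : E x -> E y -> curve_B k x y a eta ->
  x * D y = (x ^+ 2 + k eta + y) * D x.
Proof.
move=> Ex Ey e.
have Exy : E (x * y) by exact: EM.
have : D (y ^+ 2 + x * y) = D (x ^+ 2 * x + k a * x ^+ 2 + k eta * x) by rewrite e -exprSr.
have Ex2 := EX 2 Ex; have Ey2 := EX 2 Ey.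
rewrite !(derD hD) ?(der_sqr h2 hD) ?(der_sqrM h2 hE hD) ?(derZ KE hD) ?(derM hD Ex Ey) //; auto 8.
rewrite (der_sqr h2 hD) // mulr0 addr0 add0r => e'.
by apply: (char2_eq_lin h2 (c := 1) e'); char2_ring h2.
Qed.

(** Again [y / x^2] is regular, with derivative [D x / x] times a unit. *)
Lemma invariant_ratio_B_pole x y a eta : E x -> E y -> curve_B k x y a eta ->
  ~ O x -> O (D x / x).
Proof.
move=> Ex Ey e nOx.
have x0 := pole_neq0 hO nOx.
have y3 := pole_y_leading_B hO nOx e.
have my := pole_y_x2 hO nOx y3.
have mx := pole_inv hO nOx.
have Exi := EV Ex.
have mu : nonunits O (k eta * x^-1 ^+ 2 + y / x ^+ 2).
  apply: (nonunitsD hO.1) => //; apply: (nonunitsMl hO.1); first exact: place_const.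
  by apply: (nonunitsMr hO.1) => //; exact: (nonunits_sub hO.1).
have [u0 Oui] := unitD1 hO.1 mu.
have ODyx : O (D (x^-1 ^+ 2 * y)).
  by apply: DO; [by auto|apply: (nonunits_sub hO.1); rewrite mulrC exprVn].
rewrite (_ : D x / x = D (x^-1 ^+ 2 * y) * (1 + (k eta * x^-1 ^+ 2 + y / x ^+ 2))^-1).
  exact: (subringM hO.1.1).
apply: (mulIf u0); rewrite mulfVK // (der_sqrM h2 hE hD) //.
apply: (mulfI x0); rewrite mulrCA [x * (_ * D y)]mulrCA (deriv_curve_B Ex Ey e).
by field.
Qed.

(** Translation by the 2-torsion point [(0, 0)] exchanges zeros and poles. *)
Lemma curve_B_translate x y a eta : x != 0 -> curve_B k x y a eta ->
  curve_B k (k eta / x) (k eta * y / x ^+ 2) a eta.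
Proof.
move=> x0 e; rewrite /curve_B.
have -> : (k eta * y / x ^+ 2) ^+ 2 + k eta / x * (k eta * y / x ^+ 2)
  = (k eta / x ^+ 2) ^+ 2 * (y ^+ 2 + x * y) by field.
by rewrite e; field.
Qed.

Lemma invariant_ratio_B x y a eta : E x -> E y -> curve_B k x y a eta ->
  eta != 0 -> O (D x / x).
Proof.
move=> Ex Ey e eta0.
have [Ox|nOx] := pselect (O x); last exact: invariant_ratio_B_pole e nOx.
have [Oxi|nOxi] := pselect (O x^-1).
  by apply: (subringM hO.1.1) => //; exact: DO.
have x0 : x != 0 by have [] := valuation_ringV hO.1 nOxi; rewrite invr_eq0.
have keta0 : k eta != 0 by rewrite fmorph_eq0.
have -> : D x / x = D (k eta / x) / (k eta / x).
  by rewrite (derZ KE hD) ?(derV h2 hE hD) //; [field; rewrite x0 keta0|exact: EV].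
apply: (invariant_ratio_B_pole _ _ (curve_B_translate x0 e)).
- by auto.
- by have := EX 2 Ex; auto.
- move=> Oetax; apply: nOxi; rewrite -(mulKf keta0 x^-1).
  by apply: (subringM hO.1.1) => //; rewrite -fmorphV; exact: place_const.
Qed.

End Ratio.

Variables (x y : F).
Local Notation E := (adjoin k [set x; y]).
Let hE := adjoin_subfield k [set x; y].
Let KE := @adjoin_const _ _ k [set x; y].
Let Ex : E x. Proof. exact: curve_x. Qed.
Let Ey : E y. Proof. exact: curve_y. Qed.

Lemma derivation_regular_A D O a a4 a6 : derivation_on k E D ->
  curve_A k x y a a4 a6 -> a != 0 -> O (D x) -> is_place k O -> O x ->
  forall f, E f -> O f -> O (D f).
Proof.
move=> hD e a0 ODx hO Ox.
have e' := curve_A_weierstrass e.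
apply: (derivation_unramified h2 hE KE hD hO (t := x) (s := y) _ _ _ e') => //.
- by rewrite -(curve_quadratic h2 e').
- by rewrite trace_A pevalC fmorph_eq0.
- by rewrite trace_A pevalC -fmorphV; exact: place_const.
Qed.

(** Where [x] has a zero the curve is ramified over the [x]-line; there it is
    unramified over the [t]-line for [t = x / y], with [s = t^2 x] as the second
    coordinate. *)
Lemma derivation_regular_B D O a eta : derivation_on k E D ->
  curve_B k x y a eta -> eta != 0 -> D x = x -> is_place k O -> O x -> x != 0 -> y != 0 ->
  forall f, E f -> O f -> O (D f).
Proof.
move=> hD e eta0 Dx hO Ox x0 y0.
have e' := curve_B_weierstrass e.
have [Oxi|nOxi] := pselect (O x^-1).
  apply: (derivation_unramified h2 hE KE hD hO (t := x) (s := y) _ _ _ e') => //.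
  - by rewrite -(curve_quadratic h2 e').
  - by rewrite trace_B pevalX.
  - by rewrite trace_B pevalX.
  - by rewrite Dx.
have keta0 : k eta != 0 by rewrite fmorph_eq0.
pose t := x / y; pose s := t ^+ 2 * x.
have t0 : t != 0 by rewrite mulf_neq0 // invr_eq0.
have OM := subringM hO.1.1; have OD := subringD hO.1.1; have OB := subringB hO.1.1.
have Ok c : O (k c) by exact: place_const.
have yx : (y / x) ^+ 2 + y / x = x + k a + k eta / x.
  have -> : (y / x) ^+ 2 + y / x = (y ^+ 2 + x * y) / x ^+ 2 by field.
  by rewrite e; field.
have nOyx : ~ O (y / x).
  move=> Oyx; apply: nOxi; rewrite -(mulKf keta0 x^-1) -fmorphV.
  apply: (OM) => //; rewrite (_ : k eta / x = (y / x) ^+ 2 + y / x - (x + k a)).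
    by apply: (OB); [apply: (OD) => //; rewrite expr2; exact: OM|exact: OD].
  by rewrite yx; ring.
have mt : nonunits O t.
  by have [_] := valuation_ringV hO.1 nOyx; rewrite invf_div.
have Ot := nonunits_sub hO.1 mt.
pose P : {poly K} := 1 + ('X + a *: 'X^2).
have PE : peval k t P = 1 + (t + k a * t ^+ 2) by rewrite !pevalE.
have [P0 OPi] : peval k t P != 0 /\ O (peval k t P)^-1.
  rewrite PE; apply: (unitD1 hO.1); rewrite (_ : _ + _ = t * (1 + k a * t)); last by ring.
  apply: (nonunitsMr hO.1) => //; apply: (OD); first exact: (subring1 hO.1.1).
  exact: OM.
have EM := subringM hE.1; have EX := subringX hE.1; have EV := hE.2.
have Et : E t by apply: (EM) => //; exact: EV.
have Es : E s by apply: (EM) => //; exact: EX.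
have eqs : s ^+ 2 + peval k t P * s = peval k t (eta *: 'X^4).
  rewrite PE !pevalE /s /t.
  have -> : ((x / y) ^+ 2 * x) ^+ 2 + (1 + (x / y + k a * (x / y) ^+ 2)) * ((x / y) ^+ 2 * x)
    = (x ^+ 3 / y ^+ 4) * (x ^+ 3 + (y ^+ 2 + x * y) + k a * x ^+ 2) by field.
  rewrite e (_ : x ^+ 3 + _ + k a * x ^+ 2 = k eta * x); last by char2_ring h2.
  by field.
have hR := rational_subfield k t.
have hQ : is_subfield (quadratic_extension (rational_functions k t) s).
  apply: (quadratic_subfield hR (l := peval k t P) (c := peval k t (eta *: 'X^4))).
  - exact: rational_polynomial.
  - exact: rational_polynomial.
  - by rewrite -eqs; char2_ring h2.
apply: (derivation_unramified h2 hE KE hD hO (t := t) (s := s) _ _ _ eqs) => //.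
  have Qt : quadratic_extension (rational_functions k t) s t.
    by apply: quadratic_base => //; exact: rational_gen.
  have Qs : quadratic_extension (rational_functions k t) s s by exact: quadratic_gen.
  have QM := subringM hQ.1; have QX := subringX hQ.1; have QV := hQ.2.
  have xE : x = s * t^-1 ^+ 2 by rewrite /s; field.
  have yE : y = s * t^-1 ^+ 3 by rewrite /s /t; field; rewrite x0 y0.
  have KQ : range k `<=` quadratic_extension (rational_functions k t) s.
    by move=> _ [c _ <-]; apply: quadratic_base => //; exact: rational_const.
  have Qx : quadratic_extension (rational_functions k t) s x.
    by rewrite [X in quadratic_extension _ _ X]xE; auto.
  have Qy : quadratic_extension (rational_functions k t) s y.
    by rewrite [X in quadratic_extension _ _ X]yE; auto.
  by apply: adjoin_min => // _ [->|->].
have xDy := deriv_curve_B hE KE hD Ex Ey e.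
rewrite (_ : D t = peval k t P).
  by rewrite PE; apply: (OD); [exact: (subring1 hO.1.1)|apply: (OD) => //; apply: (OM) => //; exact: (subringX hO.1.1)].
rewrite PE /t (derM hD) //; last exact: EV.
rewrite (derV h2 hE hD) // mulrA xDy Dx.
have -> : (x ^+ 2 + k eta + y) * x = y ^+ 2 + k a * x ^+ 2.
  by apply: (char2_eq_lin h2 (c := 1) e); char2_ring h2.
by field.
Qed.

End InvariantDifferentials.

(** * Uniqueness of the pole *)

Section Uniqueness.
Variables (K F : fieldType) (k : {rmorphism K -> F}).
Hypothesis h2 : 2%:R = 0 :> F.
Hypothesis constants_closed : forall f, algebraicOver k f -> exists c, f = k c.
Hypothesis transcendental_exists : exists t, ~ algebraicOver k t.
Local Notation F1 := (frobenius_pullback k).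
Add Ring char2_F : (char2_ring_theory h2) (morphism (char2_ring_morph h2),
  constants [char2_constant], power_tac (char2_power_theory F) [char2_exponent]).

Lemma frobenius_sqr f : F1 (f ^+ 2).
Proof. by apply: adjoin_sub; exists f. Qed.

Lemma frobenius_subfield : is_subfield F1.
Proof. exact: adjoin_subfield. Qed.

Lemma frobenius_const c : F1 (k c).
Proof. by apply: adjoin_const; exists c. Qed.

Lemma quadratic_constant f l c : range k l -> range k c -> f ^+ 2 + l * f = c -> range k f.
Proof.
move=> [l' _ <-] [c' _ <-] e; have [|c1 ->] := @constants_closed f; last by exists c1.
exists ('X^2 + l' *: 'X - c'%:P).
  apply/eqP => /(congr1 (fun P : {poly K} => P`_2)) /eqP.
  by rewrite !(coefB, coefD) coefZ coefXn coefX coefC coef0 mulr0 addr0 subr0 oner_eq0.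
by apply/rootP; rewrite -[_.[_]]/(peval k f _) !pevalE e subrr.
Qed.

Lemma generated_quadratic z : gen_subfield (F1 `|` [set z]) = setT ->
  forall f, quadratic_extension F1 z f.
Proof.
move=> gz f; have : gen_subfield (F1 `|` [set z]) f by rewrite gz.
have hF := frobenius_subfield.
apply: gen_subfield_min.
  apply: (quadratic_subfield hF (l := 0) (c := z ^+ 2)).
  - exact: (subring0 hF.1).
  - exact: frobenius_sqr.
  - by rewrite mul0r add0r.
by move=> g [Fg| ->]; [exact: quadratic_base|exact: quadratic_gen].
Qed.

(** If [x] were constant, then so would be [y] and [z], which generate [F]. *)
Lemma generator_transcendental x y z (L C : {poly K}) : F1 = adjoin k [set x; y] ->
  y ^+ 2 + peval k x L * y = peval k x C ->
  gen_subfield (F1 `|` [set z]) = setT -> ~ algebraicOver k x.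
Proof.
move=> F1E e gz /constants_closed [c xE].
have [t nt] := transcendental_exists.
have hK : is_subfield (range k).
  split; first exact: range_subring.
  by move=> _ [d _ <-]; exists d^-1; rewrite ?fmorphV.
have Kx : range k x by exists c.
have KP P : range k (peval k x P) by exact: (peval_in P hK.1).
have Ky : range k y by apply: quadratic_constant e.
have F1K : F1 `<=` range k by rewrite F1E; apply: adjoin_min => // _ [->|->].
have Kz : range k z.
  apply: (@quadratic_constant z 0 (z ^+ 2)); last by rewrite mul0r addr0.
    by exists 0; rewrite ?rmorph0.
  by apply: F1K; exact: frobenius_sqr.
apply: nt; have [d _ <-] : range k t; last exact: algebraic_id.
apply: (quadratic_min hK.1 F1K Kz); exact: generated_quadratic.
Qed.

Section NormalFormA.
Variables (x y z : F) (a a4 a6 b d : K).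
Hypothesis nf : normal_form_A k x y z a a4 a6 b d.

Lemma normal_form_A_transcendental : ~ algebraicOver k x.
Proof.
case: nf => F1E [/curve_A_weierstrass e _] gz _ _.
exact: generator_transcendental F1E e gz.
Qed.

(** The term [b x^2] dominates [z^2] at the pole of [x]. *)
Lemma normal_form_A_z_pole O : is_place k O -> ~ O x ->
  nonunits O ((z / x) ^+ 2 - k b).
Proof.
move=> hO nO; have x0 := pole_neq0 hO nO; have mx := pole_inv hO nO.
case: nf => _ [_ a0] _ zE _; rewrite expr_div_n zE.
rewrite (_ : _ - k b = k a^-1 * x^-1 + k d * x^-1 * x^-1); last first.
  by field; rewrite fmorph_eq0 a0 x0.
apply: (nonunitsD hO.1); last apply: (nonunitsMr hO.1); last exact: (nonunits_sub hO.1).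
  by apply: (nonunitsMl hO.1) => //; exact: place_const.
by apply: (nonunitsMl hO.1) => //; exact: place_const.
Qed.

Lemma normal_form_A_square O f : is_place k O -> ~ O x -> F1 f ->
  ~ nonunits O (f ^+ 2 - k b).
Proof.
case: nf => F1E [/curve_A_weierstrass e _] _ _ nb hO nO; rewrite F1E => Ef mf.
apply: nb; apply: (pole_square h2 _ _ _ e hO nO Ef mf).
- exact: size_weierstrass_trace.
- exact: size_weierstrass_cubic.
- exact: monic_weierstrass_cubic.
Qed.

Lemma normal_form_A_z_notin : ~ F1 z.
Proof.
have [O [hO nO]] := exists_pole normal_form_A_transcendental.
have F1x : F1 x by case: nf => -> *; exact: curve_x.
move=> F1z; apply: (normal_form_A_square hO nO) (normal_form_A_z_pole hO nO).
by apply: (subringM frobenius_subfield.1) => //; exact: frobenius_subfield.2.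
Qed.
End NormalFormA.

(** If the poles were distinct then, in [z' = u + w z], the square of [w] would be the
    ratio of two invariant differentials, regular wherever [x] is.  It does not
    vanish at the pole of [x], for otherwise it would be constant; so [b x^2]
    dominates [(u / w)^2 = (z' / w)^2 + z^2], and [b] is a square. *)
Lemma same_pole_A x y z x' y' z' a a4 a6 b d a' a4' a6' b' d' O :
  normal_form_A k x y z a a4 a6 b d -> normal_form_A k x' y' z' a' a4' a6' b' d' ->
  is_place k O -> ~ O x -> ~ O x'.
Proof.
move=> nf nf' hO nO Ox'.
have ntx := normal_form_A_transcendental nf.
have hF := frobenius_subfield.
have KF : range k `<=` F1 by exact: adjoin_const.
have := nf; case=> F1E [e a0] gz zE nb.
have := nf'; case=> F1E' [e' a'0] gz' zE' nb'.
have ew := curve_A_weierstrass e.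
have [|D [hD Dx]] := invariant_derivation h2 ew ntx; first by rewrite trace_A polyC_eq0.
rewrite trace_A pevalC in Dx; rewrite -F1E in hD.
have F1x : F1 x by rewrite F1E; exact: curve_x.
have F1x' : F1 x' by rewrite F1E'; exact: curve_x.
have F1y' : F1 y' by rewrite F1E'; exact: curve_y.
have FM := subringM hF.1; have FD := subringD hF.1; have FX := subringX hF.1; have FV := hF.2.
have Fk := frobenius_const.
have [u [w [F1u F1w z'E]]] := generated_quadratic gz z'.
have w0 : w != 0.
  apply/eqP => w0; apply: (normal_form_A_z_notin nf').
  by rewrite z'E w0 mul0r addr0.
have ka0 : k a != 0 by rewrite fmorph_eq0.
have ka'0 : k a' != 0 by rewrite fmorph_eq0.
have z'2 : z' ^+ 2 = u ^+ 2 + w ^+ 2 * z ^+ 2 by rewrite z'E (char2_sqrD h2) exprMn.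
have Dsq (b1 c1 d1 : K) f : F1 f -> D (k b1 * f ^+ 2 + k c1 * f + k d1) = k c1 * D f.
  move=> F1f; have Ff2 := FX _ 2 F1f.
  rewrite !(derD hD) ?(der_const hD) ?(derZ KF hD) ?(der_sqr h2 hD) //; auto.
  by rewrite mulr0 add0r addr0.
have w2 : w ^+ 2 = k a'^-1 * D x'.
  have := congr1 D z'2; rewrite zE' zE Dsq // => ->.
  have Fz2 : F1 (k b * x ^+ 2 + k a^-1 * x + k d) by have := FX x 2%N F1x; auto.
  rewrite (derD hD) ?(der_sqr h2 hD) ?(der_sqrM h2 hF hD) ?Dsq ?Dx //.
  - by rewrite add0r fmorphV mulVf // mulr1.
  - exact: FX.
  - by apply: (FM) => //; exact: FX.
have Ow2 : O (w ^+ 2)^-1.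
  apply: contrapT => nw; have mw : nonunits O (w ^+ 2) by right.
  have [|c wc] := @constants_closed (w ^+ 2).
    apply: regular_algebraic => O1 hO1; have [O1x|nO1x] := pselect (O1 x).
      rewrite w2; apply: (subringM hO1.1.1); first exact: place_const.
      apply: (invariant_ratio_A h2 hF KF hD hO1 F1x' F1y' _ e') => //.
      rewrite F1E; apply: (derivation_regular_A h2 _ e a0) => //; first by rewrite -F1E.
      by rewrite Dx; exact: place_const.
    apply: (pole_unique h2 _ _ _ ew hO nO hO1 nO1x _ (nonunits_sub hO.1 mw)).
    - exact: size_weierstrass_trace.
    - exact: size_weierstrass_cubic.
    - exact: monic_weierstrass_cubic.
    - by rewrite -F1E; exact: frobenius_sqr.
  move: mw; rewrite wc => /(place_nonunit_const hO) c0.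
  by move/eqP: wc; rewrite c0 rmorph0 sqrf_eq0 (negPf w0).
have x0 := pole_neq0 hO nO; have mx := pole_inv hO nO.
apply: (normal_form_A_square nf (f := u / (w * x)) hO nO); first by auto 8.
rewrite (_ : (u / (w * x)) ^+ 2 - k b
    = z' ^+ 2 * (w ^+ 2)^-1 * x^-1 * x^-1 + ((z / x) ^+ 2 - k b)).
  apply: (nonunitsD hO.1); last exact: normal_form_A_z_pole nf _ _ _.
  apply: (nonunitsMl hO.1) => //; apply: (subringM hO.1.1); last exact: (nonunits_sub hO.1).
  apply: (subringM hO.1.1) => //; rewrite zE'.
  have Ok := place_const _ hO; have OM := subringM hO.1.1; have OD := subringD hO.1.1.
  by rewrite expr2; auto 8.
have -> : z' ^+ 2 * (w ^+ 2)^-1 * x^-1 * x^-1 = (u / (w * x)) ^+ 2 + (z / x) ^+ 2.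
  by rewrite z'2; field; rewrite w0 x0.
by char2_ring h2.
Qed.
Section NormalFormB.
Variables (j : K) (x y z : F) (a eta b c : K).
Hypothesis nf : normal_form_B k j x y z a eta b c.

Lemma normal_form_B_transcendental : ~ algebraicOver k x.
Proof.
case: nf => F1E /curve_B_weierstrass e _ gz _.
exact: generator_transcendental F1E e gz.
Qed.

(** The term [b y^2] dominates [z^2] at the pole of [x]. *)
Lemma normal_form_B_z_pole O : is_place k O -> ~ O x ->
  nonunits O ((z / y) ^+ 2 - k b).
Proof.
move=> hO nO; case: nf => _ e _ _ [zE _ _].
have y3 := pole_y_leading_B hO nO e.
have y0 := pole_y_neq0 hO y3.
have mxy := pole_x_y hO nO y3; have mxy2 := pole_x_y2 hO nO y3.
rewrite expr_div_n zE.
rewrite (_ : _ - k b = k (a * b) * (x / y) * (x / y) + k c * (x / y ^+ 2)); last by field.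
have Ok := place_const _ hO.
apply: (nonunitsD hO.1); apply: (nonunitsMl hO.1) => //.
by apply: (subringM hO.1.1) => //; exact: (nonunits_sub hO.1).
Qed.

Lemma normal_form_B_square O f : is_place k O -> ~ O x -> F1 f ->
  ~ nonunits O (f ^+ 2 - k b).
Proof.
case: nf => F1E /curve_B_weierstrass e _ _ [_ nb _] hO nO; rewrite F1E => Ef mf.
apply: nb; apply: (pole_square h2 _ _ _ e hO nO Ef mf).
- exact: size_weierstrass_trace.
- exact: size_weierstrass_cubic.
- exact: monic_weierstrass_cubic.
Qed.

Lemma normal_form_B_z_notin : ~ F1 z.
Proof.
have [O [hO nO]] := exists_pole normal_form_B_transcendental.
have F1y : F1 y by case: nf => -> *; exact: curve_y.
move=> F1z; apply: (normal_form_B_square hO nO) (normal_form_B_z_pole hO nO).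
by apply: (subringM frobenius_subfield.1) => //; exact: frobenius_subfield.2.
Qed.
End NormalFormB.

(** The argument of [same_pole_A] with [y] in place of [x].  Here [D x = x], the ratio
    of the invariant differentials is [g = D x' / x'], and [w^2] is a constant times
    [g x' / x]. *)
Lemma same_pole_B j j' x y z x' y' z' a eta b c a' eta' b' c' O :
  normal_form_B k j x y z a eta b c -> normal_form_B k j' x' y' z' a' eta' b' c' ->
  is_place k O -> ~ O x -> ~ O x'.
Proof.
move=> nf nf' hO nO Ox'.
have ntx := normal_form_B_transcendental nf.
have ntx' := normal_form_B_transcendental nf'.
have hF := frobenius_subfield.
have KF : range k `<=` F1 by exact: adjoin_const.
have := nf; case=> F1E e [eta0 _] gz [zE nb c0].
have := nf'; case=> F1E' e' [eta'0 _] gz' [zE' nb' c'0].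
have ew := curve_B_weierstrass e; have ew' := curve_B_weierstrass e'.
have [|D [hD Dx]] := invariant_derivation h2 ew ntx; first by rewrite trace_B polyX_eq0.
rewrite trace_B pevalX in Dx; rewrite -F1E in hD.
have F1x : F1 x by rewrite F1E; exact: curve_x.
have F1y : F1 y by rewrite F1E; exact: curve_y.
have F1x' : F1 x' by rewrite F1E'; exact: curve_x.
have F1y' : F1 y' by rewrite F1E'; exact: curve_y.
have FM := subringM hF.1; have FD := subringD hF.1; have FX := subringX hF.1; have FV := hF.2.
have Fk := frobenius_const.
have [u [w [F1u F1w z'E]]] := generated_quadratic gz z'.
have w0 : w != 0.
  apply/eqP => w0; apply: (normal_form_B_z_notin nf').
  by rewrite z'E w0 mul0r addr0.
have x'0 : x' != 0.
  by apply/eqP => x'0; apply: ntx'; rewrite x'0 -(rmorph0 k); exact: algebraic_id.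
have x0 := pole_neq0 hO nO.
have y3 := pole_y_leading_B hO nO e.
have y0 := pole_y_neq0 hO y3.
have kc0 : k c != 0 by rewrite fmorph_eq0.
have kc'0 : k c' != 0 by rewrite fmorph_eq0.
have z'2 : z' ^+ 2 = u ^+ 2 + w ^+ 2 * z ^+ 2 by rewrite z'E (char2_sqrD h2) exprMn.
have Dsq (b1 b2 c1 : K) f g : F1 f -> F1 g ->
    D (k b1 * g ^+ 2 + k b2 * f ^+ 2 + k c1 * f) = k c1 * D f.
  move=> F1f F1g; have Ff2 := FX _ 2 F1f; have Fg2 := FX _ 2 F1g.
  rewrite !(derD hD) ?(derZ KF hD) ?(der_sqr h2 hD) //; auto.
  by rewrite !mulr0 !add0r.
pose g := D x' / x'.
have w2 : w ^+ 2 = k c' / k c * g * x' / x.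
  have := congr1 D z'2; rewrite zE' zE Dsq // => e1.
  have Fz2 : F1 (k b * y ^+ 2 + k (a * b) * x ^+ 2 + k c * x).
    by have := FX x 2%N F1x; have := FX y 2%N F1y; auto 8.
  have e2 : k c' * D x' = w ^+ 2 * (k c * x).
    rewrite e1 (derD hD) ?(der_sqr h2 hD) ?(der_sqrM h2 hF hD) ?Dsq ?Dx ?add0r //.
    - exact: FX.
    - by apply: (FM) => //; exact: FX.
  by rewrite /g -[w ^+ 2](mulfK (mulf_neq0 kc0 x0)) -e2; field; rewrite x'0 kc0 x0.
have g0 : g != 0.
  apply: contra_neq w0 => g0; apply/eqP; rewrite -sqrf_eq0 w2 g0 mulr0 !mul0r //.
have Ogi : O g^-1.
  apply: contrapT => ng; have mg : nonunits O g by right.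
  have [|e1 ge] := @constants_closed g.
    apply: regular_algebraic => O1 hO1; have [O1x|nO1x] := pselect (O1 x).
      apply: (invariant_ratio_B h2 hF KF hD hO1 _ F1x' F1y' e' eta'0).
      by rewrite F1E; apply: (derivation_regular_B h2 _ e) => //; rewrite -F1E.
    apply: (pole_unique h2 _ _ _ ew hO nO hO1 nO1x _ (nonunits_sub hO.1 mg)).
    - exact: size_weierstrass_trace.
    - exact: size_weierstrass_cubic.
    - exact: monic_weierstrass_cubic.
    - by rewrite -F1E; exact: frobenius_sqr.
  move: mg; rewrite ge => /(place_nonunit_const hO) e10.
  by move: g0; rewrite ge e10 rmorph0 eqxx.
have OM := subringM hO.1.1; have OD := subringD hO.1.1; have OB := subringB hO.1.1.
have Ok c1 : O (k c1) by exact: place_const.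
have Oy' : O y' by exact: (regular_y ew').
apply: (normal_form_B_square nf (f := u / (w * y)) hO nO); first by auto 8.
pose v := k b' * (x' * x' + k a' * x' + k eta' - y') + k (a' * b') * x' + k c'.
have vE : z' ^+ 2 = v * x'.
  rewrite zE' (_ : y' ^+ 2 = (x' * x' + k a' * x' + k eta' - y') * x'); first by rewrite /v; ring.
  by apply: (char2_eq_lin h2 (c := 1) e'); char2_ring h2.
have Ov : O v by rewrite /v; auto 10.
rewrite (_ : (u / (w * y)) ^+ 2 - k b
    = v * (k c * k c'^-1) * g^-1 * (x / y ^+ 2) + ((z / y) ^+ 2 - k b)).
  apply: (nonunitsD hO.1); last exact: normal_form_B_z_pole nf _ _ _.
  apply: (nonunitsMl hO.1); last exact: (pole_x_y2 hO nO y3).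
  by auto 8.
have -> : v * (k c * k c'^-1) * g^-1 * (x / y ^+ 2) = z' ^+ 2 / (w ^+ 2 * y ^+ 2).
  rewrite vE w2 fmorphV; field.
  by rewrite y0 kc'0 kc0 g0 x'0 x0.
have -> : z' ^+ 2 / (w ^+ 2 * y ^+ 2) = (u / (w * y)) ^+ 2 + (z / y) ^+ 2.
  by rewrite z'2; field; rewrite w0 y0.
by char2_ring h2.
Qed.

End Uniqueness.

(** * Comparison of coefficients *)

Section Transformations.
Variables (K F : fieldType) (k : {rmorphism K -> F}).
Hypothesis h2 : 2%:R = 0 :> F.
Hypothesis constants_closed : forall f, algebraicOver k f -> exists c, f = k c.
Hypothesis transcendental_exists : exists t, ~ algebraicOver k t.
Local Notation F1 := (frobenius_pullback k).
Add Ring char2_F : (char2_ring_theory h2) (morphism (char2_ring_morph h2),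
  constants [char2_constant], power_tac (char2_power_theory F) [char2_exponent]).

Lemma char2_base : 2%:R = 0 :> K.
Proof. by apply: (fmorph_inj k); rewrite rmorph_nat rmorph0. Qed.
Let h2K := char2_base.
Add Ring char2_K : (char2_ring_theory h2K) (morphism (char2_ring_morph h2K),
  constants [char2_constant], power_tac (char2_power_theory K) [char2_exponent]).

Lemma cubic_free x y (L : {poly K}) a2 a4 a6 c0 c1 c2 c3 d0 d1 :
  (size L <= 2)%N -> y ^+ 2 + peval k x L * y = peval k x (weierstrass_cubic a2 a4 a6) ->
  ~ algebraicOver k x ->
  k c3 * x ^+ 3 + k c2 * x ^+ 2 + k c1 * x + k c0 + (k d1 * x + k d0) * y = 0 ->
  [/\ c3 = 0, c2 = 0, c1 = 0 & c0 = 0] /\ (d1 = 0 /\ d0 = 0).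
Proof.
move=> sL e ntx e0.
have [|||P0 Q0] := curve_free_poly sL _ _ e ntx
    (P := c3 *: 'X^3 + c2 *: 'X^2 + c1 *: 'X + c0%:P) (Q := d1 *: 'X + d0%:P).
- exact: size_weierstrass_cubic.
- exact: monic_weierstrass_cubic.
- by rewrite !pevalE.
have cP i := congr1 (fun P : {poly K} => P`_i) P0.
have cQ i := congr1 (fun P : {poly K} => P`_i) Q0.
split; split.
- by have := cP 3%N; rewrite !coefD !coefZ !coefXn coefX coefC coef0 mulr1 !mulr0 !addr0.
- by have := cP 2%N; rewrite !coefD !coefZ !coefXn coefX coefC coef0 mulr1 !mulr0 !addr0 add0r.
- by have := cP 1%N; rewrite !coefD !coefZ !coefXn coefX coefC coef0 mulr1 !mulr0 addr0 !add0r.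
- by have := cP 0%N; rewrite !coefD !coefZ !coefXn coefX coefC coef0 !mulr0 !add0r.
- by have := cQ 1%N; rewrite coefD coefZ coefX coefC coef0 mulr1 addr0.
- by have := cQ 0%N; rewrite coefD coefZ coefX coefC coef0 mulr0 add0r.
Qed.

Section CoefficientsA.
Variables (x y z x' y' z' : F) (a a4 a6 b d a' a4' a6' b' d' : K).

Lemma coefficients_A l m n p q : ~ algebraicOver k x' ->
  curve_A k x y a a4 a6 -> curve_A k x' y' a' a4' a6' ->
  x = k l * x' + k m -> y = k n * y' + k p * x' + k q ->
  [/\ n ^+ 2 = l ^+ 3, p ^+ 2 = l ^+ 2 * m, n ^+ 2 * a' = a * n,
      n ^+ 2 * a4' = a * p + l * m ^+ 2 + a4 * l
    & n ^+ 2 * a6' = q ^+ 2 + a * q + m ^+ 3 + a4 * m + a6].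
Proof.
move=> ntx' e e' xE yE.
have [|[c3 c2 c1 c0] [d1 d0]] := @cubic_free x' y' _ 0 a4' a6'
  (n ^+ 2 * a6' + q ^+ 2 + a * q + m ^+ 3 + a4 * m + a6)
  (n ^+ 2 * a4' + a * p + l * m ^+ 2 + a4 * l) (p ^+ 2 + l ^+ 2 * m)
  (n ^+ 2 + l ^+ 3) (n ^+ 2 * a' + a * n) 0 (size_weierstrass_trace _ _)
  (curve_A_weierstrass e') ntx'.
  rewrite !(rmorphD, rmorphM, rmorphXn, rmorph0) /=.
  have S0 : (y ^+ 2 + k a * y) + (x ^+ 3 + k a4 * x + k a6)
      + k n ^+ 2 * ((y' ^+ 2 + k a' * y') + (x' ^+ 3 + k a4' * x' + k a6')) = 0.
    by rewrite e e' !(char2_addxx h2) mulr0 addr0.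
  by rewrite -[RHS]S0 xE yE; char2_ring h2.
split; apply: (char2_eqD h2K).
- exact: c3.
- exact: c2.
- exact: d0.
- by rewrite -c1; char2_ring h2K.
- by rewrite -c0; char2_ring h2K.
Qed.

Lemma coefficients_zA l m al ga de : ~ algebraicOver k x' ->
  curve_A k x' y' a' a4' a6' ->
  z ^+ 2 = k b * x ^+ 2 + k a^-1 * x + k d ->
  z' ^+ 2 = k b' * x' ^+ 2 + k a'^-1 * x' + k d' ->
  x = k l * x' + k m -> z = k al * z' + k ga * x' + k de ->
  [/\ al ^+ 2 * b' = l ^+ 2 * b + ga ^+ 2, al ^+ 2 * a'^-1 = a^-1 * l
    & al ^+ 2 * d' = d + m ^+ 2 * b + m * a^-1 + de ^+ 2].
Proof.
move=> ntx' e' ez ez' xE zE.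
have [|[_ c2 c1 c0] _] := @cubic_free x' y' _ 0 a4' a6'
  (al ^+ 2 * d' + (d + m ^+ 2 * b + m * a^-1 + de ^+ 2)) (al ^+ 2 * a'^-1 + a^-1 * l)
  (al ^+ 2 * b' + (l ^+ 2 * b + ga ^+ 2)) 0 0 0 (size_weierstrass_trace _ _)
  (curve_A_weierstrass e') ntx'.
  have S0 : (z ^+ 2 + (k b * x ^+ 2 + k a^-1 * x + k d))
      + k al ^+ 2 * (z' ^+ 2 + (k b' * x' ^+ 2 + k a'^-1 * x' + k d')) = 0.
    by rewrite ez ez' !(char2_addxx h2) mulr0 addr0.
  rewrite !(rmorphD, rmorphM, rmorphXn, rmorph0) /= -[RHS]S0 xE zE.
  by char2_ring h2.
by split; apply: (char2_eqD h2K).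
Qed.

Section Affine.
Variables (l m n p q : K).
Hypotheses (l0 : l != 0) (n0 : n != 0).
Hypotheses (xE : x = k l * x' + k m) (yE : y = k n * y' + k p * x' + k q).

Lemma adjoin_affine : adjoin k [set x; y] = adjoin k [set x'; y'].
Proof.
have hE := adjoin_subfield k [set x; y]; have hE' := adjoin_subfield k [set x'; y'].
have Ex : adjoin k [set x; y] x by exact: curve_x.
have Ey : adjoin k [set x; y] y by exact: curve_y.
have Ex' : adjoin k [set x'; y'] x' by exact: curve_x.
have Ey' : adjoin k [set x'; y'] y' by exact: curve_y.
have Ek c : adjoin k [set x; y] (k c) by apply: adjoin_const; exists c.
have Ek' c : adjoin k [set x'; y'] (k c) by apply: adjoin_const; exists c.
have kl0 : k l != 0 by rewrite fmorph_eq0.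
have kn0 : k n != 0 by rewrite fmorph_eq0.
have EM := subringM hE.1; have EB := subringB hE.1; have EV := hE.2.
have EM' := subringM hE'.1; have ED' := subringD hE'.1.
apply/seteqP; split; apply: adjoin_min => //; try exact: adjoin_const.
  by move=> _ [->|->]; [rewrite [X in adjoin _ _ X]xE|rewrite [X in adjoin _ _ X]yE]; auto.
have Ex'' : adjoin k [set x; y] x'.
  rewrite (_ : x' = (x - k m) / k l); first by auto.
  by rewrite xE; field.
move=> _ [->|->] //.
rewrite (_ : y' = (y - k p * x' - k q) / k n); first by auto 8.
by rewrite yE; field.
Qed.

End Affine.
End CoefficientsA.

Lemma gen_subfield_affine (L : set F) z z' u al : range k `<=` L -> L u -> al != 0 ->
  z = k al * z' + u -> gen_subfield (L `|` [set z]) = gen_subfield (L `|` [set z']).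
Proof.
move=> KL Lu al0 zE.
have hG := gen_subfield_subfield (L `|` [set z]).
have hG' := gen_subfield_subfield (L `|` [set z']).
have kal0 : k al != 0 by rewrite fmorph_eq0.
have sub : L `<=` gen_subfield (L `|` [set z]) by move=> f Lf; apply: gen_subfield_sub; left.
have sub' : L `<=` gen_subfield (L `|` [set z']) by move=> f Lf; apply: gen_subfield_sub; left.
have Kal : range k (k al) by exists al.
apply/seteqP; split; apply: gen_subfield_min => // f [|->]; [exact: sub'| |exact: sub|].
  have Gz : gen_subfield (L `|` [set z']) z' by apply: gen_subfield_sub; right.
  rewrite [X in gen_subfield _ X]zE; apply: (subringD hG'.1); last exact: sub'.
  by apply: (subringM hG'.1) => //; apply: sub'; exact: KL.
have Gz : gen_subfield (L `|` [set z]) z by apply: gen_subfield_sub; right.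
rewrite (_ : z' = (z - u) / k al); last by rewrite zE; field.
apply: (subringM hG.1); first by apply: (subringB hG.1) => //; exact: sub.
by apply: hG.2; apply: sub; exact: KL.
Qed.

Section FamilyA.
Variables (x y z x' y' z' : F) (a a4 a6 b d a' a4' a6' b' d' : K).

(** The curve equations give [n^2 = l^3] for the scaling factors of [x] and [y].
    Differentiating [z^2 = u^2 + w^2 z'^2] shows that [w] is a constant [alpha] with
    [alpha^2 n = l], hence [l = alpha^-4] and [n = alpha^-6]. *)
Lemma transformation_A_exists :
  normal_form_A k x y z a a4 a6 b d -> normal_form_A k x' y' z' a' a4' a6' b' d' ->
  exists alpha sigma tau gamma delta, alpha != 0 /\
    transformation_A k x y z x' y' z' alpha sigma tau gamma delta.
Proof.
move=> nf nf'.
have ntx : ~ algebraicOver k x by exact: (normal_form_A_transcendental _ _ nf).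
have ntx' : ~ algebraicOver k x' by exact: (normal_form_A_transcendental _ _ nf').
have [O [hO nO]] := exists_pole ntx.
have nO' : ~ O x' by exact: (same_pole_A h2 _ _ nf nf').
have := nf; case=> F1E [e a0] gz zE nb.
have := nf'; case=> F1E' [e' a'0] gz' zE' nb'.
have ew := curve_A_weierstrass e; have ew' := curve_A_weierstrass e'.
have sm := smooth_A h2 e a0 ntx; have sm' := smooth_A h2 e' a'0 ntx'.
have [|l [m [n [p [q [l0 n0 xE yE]]]]]] := change_of_coordinates h2
  (size_weierstrass_trace _ _) (size_weierstrass_cubic _ _ _) (monic_weierstrass_cubic _ _ _)
  (size_weierstrass_trace _ _) (size_weierstrass_cubic _ _ _) (monic_weierstrass_cubic _ _ _)
  ew ew' ntx sm sm' _ hO nO nO'; first by rewrite -F1E -F1E'.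
have [c3 c2 d0 _ _] := coefficients_A ntx' e e' xE yE.
have hF := frobenius_subfield k.
have KF : range k `<=` F1 by exact: adjoin_const.
have [|D [hD Dx]] := invariant_derivation h2 ew' ntx'; first by rewrite trace_A polyC_eq0.
rewrite trace_A pevalC in Dx; rewrite -F1E' in hD.
have F1x' : F1 x' by rewrite F1E'; exact: curve_x.
have FM := subringM hF.1; have FD := subringD hF.1; have FX := subringX hF.1; have FV := hF.2.
have Fk c : F1 (k c) by exact: frobenius_const.
have [u [w [F1u F1w zz']]] := generated_quadratic gz' z.
have z2 : z ^+ 2 = u ^+ 2 + w ^+ 2 * z' ^+ 2 by rewrite zz' (char2_sqrD h2) exprMn.
have ka0 : k a != 0 by rewrite fmorph_eq0.
have ka'0 : k a' != 0 by rewrite fmorph_eq0.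
have F1x : F1 x by rewrite F1E; exact: curve_x.
have Dsq (b1 c1 d1 : K) f : F1 f -> D (k b1 * f ^+ 2 + k c1 * f + k d1) = k c1 * D f.
  move=> F1f; have Ff2 := FX _ 2 F1f.
  rewrite !(derD hD) ?(der_const hD) ?(derZ KF hD) ?(der_sqr h2 hD) //; auto.
  by rewrite mulr0 add0r addr0.
have w2 : w ^+ 2 = k (a^-1 * l * a').
  have Fz2 : F1 (k b' * x' ^+ 2 + k a'^-1 * x' + k d') by have := FX x' 2%N F1x'; auto.
  have := congr1 D z2; rewrite zE' zE Dsq // (derD hD) ?(der_sqr h2 hD) ?(der_sqrM h2 hF hD) ?Dsq //;
    [|exact: FX|by apply: (FM) => //; exact: FX].
  rewrite Dx add0r [k a'^-1]fmorphV mulVf // mulr1 => <-.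
  rewrite xE (derD hD) ?(derZ KF hD) ?(der_const hD) //; last exact: FM.
  by rewrite Dx addr0 !rmorphM fmorphV mulrA.
have [|al wE] := @constants_closed w.
  have [|||c _ <-] := quadratic_constant constants_closed (f := w) (l := 0) (c := w ^+ 2).
  - by exists 0; rewrite ?rmorph0.
  - by rewrite w2; eexists.
  - by rewrite mul0r addr0.
  exact: algebraic_id.
have al2 : al ^+ 2 * n = l.
  have : al ^+ 2 = a^-1 * l * a' by apply: (fmorph_inj k); rewrite rmorphXn -wE.
  move=> ->; apply: (mulfI a0); rewrite (_ : a * _ = l * (n * a')); last by field.
  by have := d0; rewrite expr2 -mulrA [a * n]mulrC => /(mulfI n0) ->; rewrite mulrC.
have al0 : al != 0.
  by apply: contra_neq l0 => al0; rewrite -al2 al0 expr0n mul0r.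
have x'0 := pole_neq0 hO nO'; have mx' := pole_inv hO nO'.
have al2' : al ^+ 2 * a'^-1 = a^-1 * l.
  have -> : al ^+ 2 = a^-1 * l * a' by apply: (fmorph_inj k); rewrite rmorphXn -wE.
  by field; rewrite a0 a'0.
have u2 : u ^+ 2 = k (b * l ^+ 2 + al ^+ 2 * b') * x' ^+ 2
    + k (b * m ^+ 2 + a^-1 * m + d + al ^+ 2 * d').
  have -> : u ^+ 2 = z ^+ 2 + w ^+ 2 * z' ^+ 2 by rewrite z2; char2_ring h2.
  have e1 : k al ^+ 2 * k a'^-1 = k a^-1 * k l.
    by rewrite -rmorphXn -!rmorphM al2'.
  rewrite zE zE' xE wE !(rmorphD, rmorphM, rmorphXn).
  by apply: (char2_eq_lin h2 (c := x') e1); char2_ring h2.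
have ru : regular_at_finite k x' u.
  by apply: regular_sqr; rewrite u2 => O1 hO1 O1x'; have Ok := place_const _ hO1;
    have OM := subringM hO1.1.1; have OD := subringD hO1.1.1; rewrite [x' ^+ 2]expr2; auto.
have [||be [ga [de [uE be0]]]] := small_pole h2 (size_weierstrass_trace _ _)
    (size_weierstrass_cubic _ _ _) (monic_weierstrass_cubic _ _ _) ew' sm' hO nO' _ ru (N := 2) isT.
- by rewrite -F1E'.
- have Ok := place_const _ hO; have OM := subringM hO.1.1; have OD := subringD hO.1.1.
  have Oxi := nonunits_sub hO.1 mx'.
  rewrite u2; set c := k (_ + _); set c' := k (_ + _ + _ + _).
  rewrite (_ : _ / _ = c + c' * (x'^-1 * x'^-1)); last first.
    by field; rewrite x'0 ka0.
  by rewrite /c /c'; auto.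
have l2 : l ^+ 2 * al ^+ 4 = l.
  apply: (mulfI l0); rewrite mulrA -exprS -c3 (_ : n ^+ 2 * _ = (al ^+ 2 * n) ^+ 2); last by ring.
  by rewrite al2 expr2.
have lE : l = al ^- 4.
  apply: (mulIf (expf_neq0 4 al0)); rewrite mulVf ?expf_neq0 //.
  by apply: (mulfI l0); rewrite mulr1 mulrA -expr2.
have nE : n = al ^- 6.
  apply: (mulIf (expf_neq0 6 al0)); rewrite mulVf ?expf_neq0 //.
  rewrite (_ : n * al ^+ 6 = (al ^+ 2 * n) * al ^+ 4); last by ring.
  by rewrite al2 lE mulVf // expf_neq0.
have mE : m = (p / l) ^+ 2.
  by rewrite expr_div_n c2 mulrC mulKf // expf_neq0.
exists al, (p / l), q, ga, de; split=> //; split.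
- by rewrite -mE -lE.
- by rewrite -lE -nE mulfVK.
- by rewrite zz' uE wE be0 // rmorph0 mul0r add0r [LHS]addrC addrA.
Qed.

Lemma transformation_A_rules alpha sigma tau gamma delta :
  normal_form_A k x y z a a4 a6 b d -> normal_form_A k x' y' z' a' a4' a6' b' d' ->
  alpha != 0 -> transformation_A k x y z x' y' z' alpha sigma tau gamma delta ->
  rules_A a a4 a6 b d a' a4' a6' b' d' alpha sigma tau gamma delta.
Proof.
move=> nf nf' al0 [xE yE zzE].
have ntx' : ~ algebraicOver k x' by exact: (normal_form_A_transcendental _ _ nf').
have := nf; case=> F1E [e a0] gz zE nb.
have := nf'; case=> F1E' [e' a'0] gz' zE' nb'.
have [_ _ d0 c1 c0] := coefficients_A ntx' e e' xE yE.
have [cb _ cd] := coefficients_zA ntx' e' zE zE' xE zzE.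
split.
- apply: (mulfI (_ : alpha ^- 6 != 0)); first by rewrite invr_eq0 expf_neq0.
  by rewrite mulrA -expr2 d0 mulrC.
- apply: (mulfI (_ : alpha ^- 4 != 0)); first by rewrite invr_eq0 expf_neq0.
  rewrite mulrA -invfM -exprD.
  have <- : (alpha ^- 6) ^+ 2 = (alpha ^+ (4 + 8))^-1 by rewrite exprVn -exprM.
  by rewrite c1; ring.
- have <- : (alpha ^- 6) ^+ 2 = alpha ^- 12 by rewrite exprVn -exprM.
  by rewrite c0; ring.
- by rewrite cb exprVn -exprM.
- by rewrite cd -exprM.
Qed.

(** Under a transformation obeying the rules, each equation for [x, y, z] is a
    constant multiple of the corresponding equation for [x', y', z']. *)
Lemma normal_form_A_transfer alpha sigma tau gamma delta :
  alpha != 0 -> transformation_A k x y z x' y' z' alpha sigma tau gamma delta ->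
  rules_A a a4 a6 b d a' a4' a6' b' d' alpha sigma tau gamma delta ->
  normal_form_A k x y z a a4 a6 b d <-> normal_form_A k x' y' z' a' a4' a6' b' d'.
Proof.
move=> al0 [xE yE zE] [ra ra4 ra6 rb rd].
have [al2 al6] : alpha ^+ 2 != 0 /\ alpha ^- 6 != 0 by rewrite invr_eq0 !expf_neq0.
have al4 : alpha ^- 4 != 0 by rewrite invr_eq0 expf_neq0.
have adjE := adjoin_affine al4 al6 xE yE.
have a0E : (a != 0) = (a' != 0) by rewrite -ra mulf_eq0 (negPf al6).
have [r rdef] : exists r, r = alpha ^- 2 by eexists.
have rE n : alpha ^- (2 * n) = r ^+ n by rewrite rdef exprVn -exprM.
rewrite (rE 3%N) in ra; rewrite (rE 4%N) in ra4; rewrite (rE 6%N) in ra6; rewrite (rE 4%N) in rb.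
rewrite (rE 2%N) in xE; rewrite (rE 3%N) (rE 2%N) in yE.
have r0 : r != 0 by rewrite rdef invr_eq0.
have curve_eq : (y ^+ 2 + k a * y) + (x ^+ 3 + k a4 * x + k a6)
    = k r ^+ 6 * ((y' ^+ 2 + k a' * y') + (x' ^+ 3 + k a4' * x' + k a6')).
  have -> : a4 = r ^+ 4 * a4' + sigma * (r ^+ 3 * a') + sigma ^+ 4.
    by rewrite ra4 ra; char2_ring h2K.
  have -> : a6 = r ^+ 6 * a6' + (sigma ^+ 2 * a4 + tau * (r ^+ 3 * a') + sigma ^+ 6 + tau ^+ 2).
    by rewrite ra6 ra; char2_ring h2K.
  have -> : a4 = r ^+ 4 * a4' + sigma * (r ^+ 3 * a') + sigma ^+ 4.
    by rewrite ra4 ra; char2_ring h2K.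
  rewrite -ra xE yE !(rmorphD, rmorphM, rmorphXn) /=.
  by char2_ring h2.
have kr6 : k r ^+ 6 != 0 by rewrite expf_neq0 // fmorph_eq0.
have curve : curve_A k x y a a4 a6 <-> curve_A k x' y' a' a4' a6'.
  split=> e.
    apply: (char2_eqD h2); apply: (mulfI kr6).
    by rewrite -curve_eq e (char2_addxx h2) mulr0.
  by apply: (char2_eqD h2); rewrite curve_eq e (char2_addxx h2) mulr0.
have ai : alpha ^+ 2 * a'^-1 = a^-1 * r ^+ 2.
  have [a'0|a'0] := eqVneq a' 0.
    by rewrite -ra a'0 !(mulr0, invr0, mul0r).
  rewrite -ra invfM (_ : _ * r ^+ 2 = a'^-1 * (r ^+ 3)^-1 * r ^+ 2); last by ring.
  by rewrite rdef; field; rewrite a'0 al0 oner_eq0.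
have kal2 : k alpha ^+ 2 != 0 by rewrite expf_neq0 // fmorph_eq0.
have zeq : z ^+ 2 + (k b * x ^+ 2 + k a^-1 * x + k d)
    = k alpha ^+ 2 * (z' ^+ 2 + (k b' * x' ^+ 2 + k a'^-1 * x' + k d')).
  have e1 : k alpha ^+ 2 * k b' = k r ^+ 4 * k b + k gamma ^+ 2.
    by rewrite -!rmorphXn -!rmorphM -rmorphD rb.
  have e2 : k alpha ^+ 2 * k a'^-1 = k a^-1 * k r ^+ 2.
    by rewrite -!rmorphXn -!rmorphM ai.
  have e3 : k alpha ^+ 2 * k d' = k d + k sigma ^+ 4 * k b + k sigma ^+ 2 * k a^-1 + k delta ^+ 2.
    by rewrite -!rmorphXn -!rmorphM -!rmorphD rd.
  rewrite !mulrDr ![k alpha ^+ 2 * (_ * _)]mulrA e1 e2 e3 xE zE !(rmorphD, rmorphM, rmorphXn) /=.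
  by char2_ring h2.
have zcurve : z ^+ 2 = k b * x ^+ 2 + k a^-1 * x + k d <->
    z' ^+ 2 = k b' * x' ^+ 2 + k a'^-1 * x' + k d'.
  split=> e.
    apply: (char2_eqD h2); apply: (mulfI kal2).
    by rewrite -zeq e (char2_addxx h2) mulr0.
  by apply: (char2_eqD h2); rewrite zeq e (char2_addxx h2) mulr0.
have genE : F1 = adjoin k [set x'; y'] ->
    gen_subfield (F1 `|` [set z]) = gen_subfield (F1 `|` [set z']).
  move=> F1E; apply: (gen_subfield_affine (u := k gamma * x' + k delta) (al := alpha)) => //.
  - exact: adjoin_const.
  - have hF := frobenius_subfield k; have Fk c : F1 (k c) by exact: frobenius_const.
    have F1x' : F1 x' by rewrite F1E; exact: curve_x.
    have FM := subringM hF.1; have FD := subringD hF.1; auto.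
  - by rewrite zE addrA.
have sq : (exists e, b = e ^+ 2) <-> (exists e, b' = e ^+ 2).
  split=> -[e eE].
    exists (alpha^-1 * (r ^+ 2 * e + gamma)); apply: (mulfI al2).
    rewrite rb eE (_ : alpha ^+ 2 * _ = (r ^+ 2 * e + gamma) ^+ 2); first by char2_ring h2K.
    by field.
  exists ((r ^+ 2)^-1 * (alpha * e + gamma)); apply: (mulfI (expf_neq0 4 r0)).
  rewrite [RHS](_ : _ = (alpha * e + gamma) ^+ 2); last first.
    by field.
  by rewrite (char2_sqrD h2K) exprMn -eE rb; char2_ring h2K.
split=> -[F1E [e a0] gz ez nb].
  split; rewrite -?adjE -?a0E //; first by split=> //; exact/curve.
  - by rewrite -genE // -adjE.
  - exact/zcurve.
  - by move=> /sq.
split; rewrite ?adjE ?a0E //; first by split=> //; exact/curve.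
- by rewrite genE.
- exact/zcurve.
- by move=> /sq.
Qed.

End FamilyA.

Section FamilyB.
Variables (j j' : K) (x y z x' y' z' : F) (a eta b c a' eta' b' c' : K).

Lemma coefficients_B l m n p q : ~ algebraicOver k x' ->
  curve_B k x y a eta -> curve_B k x' y' a' eta' ->
  x = k l * x' + k m -> y = k n * y' + k p * x' + k q ->
  [/\ n ^+ 2 = l ^+ 3, n ^+ 2 = l * n, m * n = 0
    & q ^+ 2 + m * q + m ^+ 3 + a * m ^+ 2 + eta * m = 0] /\
  (n ^+ 2 * a' = p ^+ 2 + l * p + l ^+ 2 * m + a * l ^+ 2 /\
   n ^+ 2 * eta' = l * q + m * p + l * m ^+ 2 + eta * l).
Proof.
move=> ntx' e e' xE yE.
have [|[c3 c2 c1 c0] [d1 d0]] := @cubic_free x' y' _ a' eta' 0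
  (q ^+ 2 + m * q + m ^+ 3 + a * m ^+ 2 + eta * m)
  (n ^+ 2 * eta' + (l * q + m * p + l * m ^+ 2 + eta * l))
  (n ^+ 2 * a' + (p ^+ 2 + l * p + l ^+ 2 * m + a * l ^+ 2))
  (n ^+ 2 + l ^+ 3) (m * n) (n ^+ 2 + l * n) (size_weierstrass_trace _ _)
  (curve_B_weierstrass e') ntx'.
  have S0 : (y ^+ 2 + x * y) + (x ^+ 3 + k a * x ^+ 2 + k eta * x)
      + k n ^+ 2 * ((y' ^+ 2 + x' * y') + (x' ^+ 3 + k a' * x' ^+ 2 + k eta' * x')) = 0.
    by rewrite e e' !(char2_addxx h2) mulr0 addr0.
  rewrite !(rmorphD, rmorphM, rmorphXn, rmorph0) /= -[RHS]S0 xE yE.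
  by char2_ring h2.
by split; split=> //; apply: (char2_eqD h2K).
Qed.

(** Replacing [y'^2] by the equation produces the term [e x' y']. *)
Lemma quadratic_form_free_B e f g h : ~ algebraicOver k x' -> curve_B k x' y' a' eta' ->
  k e * y' ^+ 2 + k f * x' ^+ 2 + k g * x' + k h = 0 ->
  [/\ e = 0, f = 0, g = 0 & h = 0].
Proof.
move=> ntx' e' S0.
have [|[_ c2 c1 c0] [d1 _]] := @cubic_free x' y' _ a' eta' 0
  h (e * eta' + g) (e * a' + f) e 0 e (size_weierstrass_trace _ _)
  (curve_B_weierstrass e') ntx'.
  rewrite -[RHS]S0 !(rmorphD, rmorphM, rmorph0) /=.
  by apply: (char2_eq_lin h2 (c := k e) e'); char2_ring h2.
by move: c1 c2; rewrite d1 !mul0r !add0r.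
Qed.

Lemma coefficients_zB p al be ga de : ~ algebraicOver k x' ->
  curve_B k x' y' a' eta' ->
  z ^+ 2 = k b * y ^+ 2 + k (a * b) * x ^+ 2 + k c * x ->
  z' ^+ 2 = k b' * y' ^+ 2 + k (a' * b') * x' ^+ 2 + k c' * x' ->
  x = x' -> y = y' + k p * x' -> z = k al * z' + k be * y' + k ga * x' + k de ->
  [/\ al ^+ 2 * b' = b + be ^+ 2,
      al ^+ 2 * (a' * b') = b * p ^+ 2 + a * b + ga ^+ 2,
      al ^+ 2 * c' = c & de = 0].
Proof.
move=> ntx' e' ez ez' xE yE zE.
have [|c3 c2 c1 c0] := @quadratic_form_free_B (al ^+ 2 * b' + (b + be ^+ 2))
  (al ^+ 2 * (a' * b') + (b * p ^+ 2 + a * b + ga ^+ 2)) (al ^+ 2 * c' + c) (de ^+ 2) ntx' e'.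
  have S0 : (z ^+ 2 + (k b * y ^+ 2 + k (a * b) * x ^+ 2 + k c * x))
      + k al ^+ 2 * (z' ^+ 2 + (k b' * y' ^+ 2 + k (a' * b') * x' ^+ 2 + k c' * x')) = 0.
    by rewrite ez ez' !(char2_addxx h2) mulr0 addr0.
  rewrite -[RHS]S0 !(rmorphD, rmorphM, rmorphXn) /= zE yE xE.
  by char2_ring h2.
by split; try exact: (char2_eqD h2K); apply/eqP; rewrite -sqrf_eq0 c0.
Qed.

(** In this family the coefficients of [x' y'], [x'^3], [y'] and [1] in the curve
    equation force the scaling factors to be 1 and the translations to vanish. *)
Lemma transformation_B_exists :
  normal_form_B k j x y z a eta b c -> normal_form_B k j' x' y' z' a' eta' b' c' ->
  exists alpha sigma beta gamma,
    [/\ alpha != 0, constraint_B a b sigma beta gamma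
      & transformation_B k x y z x' y' z' alpha sigma beta gamma].
Proof.
move=> nf nf'.
have ntx : ~ algebraicOver k x by exact: (normal_form_B_transcendental _ _ nf).
have ntx' : ~ algebraicOver k x' by exact: (normal_form_B_transcendental _ _ nf').
have [O [hO nO]] := exists_pole ntx.
have nO' : ~ O x' by exact: (same_pole_B h2 _ _ nf nf').
have := nf; case=> F1E e [eta0 _] gz [zE nb c0].
have := nf'; case=> F1E' e' [eta'0 _] gz' [zE' nb' c'0].
have ew := curve_B_weierstrass e; have ew' := curve_B_weierstrass e'.
have sm := smooth_B h2 e eta0 ntx; have sm' := smooth_B h2 e' eta'0 ntx'.
have [|l [m [n [p [q [l0 n0 xE yE]]]]]] := change_of_coordinates h2
  (size_weierstrass_trace _ _) (size_weierstrass_cubic _ _ _) (monic_weierstrass_cubic _ _ _)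
  (size_weierstrass_trace _ _) (size_weierstrass_cubic _ _ _) (monic_weierstrass_cubic _ _ _)
  ew ew' ntx sm sm' _ hO nO nO'; first by rewrite -F1E -F1E'.
have [[k3 kxy ky k0] [k2 _]] := coefficients_B ntx' e e' xE yE.
have m0 : m = 0 by move/eqP: ky; rewrite mulf_eq0 (negPf n0) orbF => /eqP.
have nl : n = l by apply: (mulIf n0); rewrite -kxy expr2.
have l1 : l = 1.
  apply: (mulfI (expf_neq0 2 l0)); rewrite mulr1 -[RHS](_ : n ^+ 2 = _); last by rewrite nl.
  by rewrite k3 -exprSr.
have q0 : q = 0.
  apply/eqP; rewrite -sqrf_eq0; apply/eqP; move: k0.
  by rewrite m0 expr0n !expr0n /= !(mulr0, mul0r, addr0).
have {}xE : x = x' by rewrite xE m0 l1 rmorph1 rmorph0 mul1r addr0.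
have {}yE : y = y' + k p * x' by rewrite yE q0 nl l1 rmorph1 rmorph0 mul1r addr0.
have a'E : a' = a + p + p ^+ 2.
  move: k2; rewrite nl l1 m0 !expr1n !mul1r !mulr1 !addr0 => ->.
  by char2_ring h2K.
have hF := frobenius_subfield k.
have KF : range k `<=` F1 by exact: adjoin_const.
have [|D [hD Dx]] := invariant_derivation h2 ew' ntx'; first by rewrite trace_B polyX_eq0.
rewrite trace_B pevalX in Dx; rewrite -F1E' in hD.
have F1x' : F1 x' by rewrite F1E'; exact: curve_x.
have F1y' : F1 y' by rewrite F1E'; exact: curve_y.
have F1y : F1 y by rewrite F1E; exact: curve_y.
have FM := subringM hF.1; have FD := subringD hF.1; have FX := subringX hF.1; have FV := hF.2.
have Fk c1 : F1 (k c1) by exact: frobenius_const.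
have [u [w [F1u F1w zz']]] := generated_quadratic gz' z.
have z2 : z ^+ 2 = u ^+ 2 + w ^+ 2 * z' ^+ 2 by rewrite zz' (char2_sqrD h2) exprMn.
have x'0 := pole_neq0 hO nO'; have mx' := pole_inv hO nO'.
have kc0 : k c != 0 by rewrite fmorph_eq0.
have kc'0 : k c' != 0 by rewrite fmorph_eq0.
have Dsq (b1 b2 c1 : K) f g : F1 f -> F1 g ->
    D (k b1 * g ^+ 2 + k b2 * f ^+ 2 + k c1 * f) = k c1 * D f.
  move=> F1f F1g; have Ff2 := FX _ 2 F1f; have Fg2 := FX _ 2 F1g.
  rewrite !(derD hD) ?(derZ KF hD) ?(der_sqr h2 hD) //; auto.
  by rewrite !mulr0 !add0r.
have w2 : w ^+ 2 = k (c / c').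
  have Fz2 : F1 (k b' * y' ^+ 2 + k (a' * b') * x' ^+ 2 + k c' * x').
    by have := FX x' 2%N F1x'; have := FX y' 2%N F1y'; auto 8.
  have := congr1 D z2; rewrite zE' zE xE Dsq // (derD hD) ?(der_sqr h2 hD) ?(der_sqrM h2 hF hD) ?Dsq //;
    [|exact: FX|by apply: (FM) => //; exact: FX].
  rewrite Dx add0r mulrA => /(mulIf x'0) e1.
  by rewrite rmorphM fmorphV e1 mulfK.
have [|al wE] := @constants_closed w.
  have [|||c1 _ <-] := quadratic_constant constants_closed (f := w) (l := 0) (c := w ^+ 2).
  - by exists 0; rewrite ?rmorph0.
  - by rewrite w2; eexists.
  - by rewrite mul0r addr0.
  exact: algebraic_id.
have al2 : al ^+ 2 * c' = c.
  have -> : al ^+ 2 = c / c' by apply: (fmorph_inj k); rewrite rmorphXn -wE.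
  by rewrite mulfVK.
have al0 : al != 0.
  by apply: contra_neq c0 => al0; rewrite -al2 al0 expr0n mul0r.
have u2 : u ^+ 2 = k (b + al ^+ 2 * b') * y' ^+ 2
    + k (b * p ^+ 2 + a * b + al ^+ 2 * (a' * b')) * x' ^+ 2.
  have -> : u ^+ 2 = z ^+ 2 + w ^+ 2 * z' ^+ 2 by rewrite z2; char2_ring h2.
  rewrite zE zE' xE yE wE -al2 !(rmorphD, rmorphM, rmorphXn).
  by char2_ring h2.
have ru : regular_at_finite k x' u.
  apply: regular_sqr; rewrite u2 => O1 hO1 O1x'; have Ok := place_const _ hO1.
  have OM := subringM hO1.1.1; have OD := subringD hO1.1.1.
  have Oy' := regular_y ew' hO1 O1x'.
  by rewrite [x' ^+ 2]expr2 [y' ^+ 2]expr2; auto.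
have [||be [ga [de [uE _]]]] := small_pole h2 (size_weierstrass_trace _ _)
    (size_weierstrass_cubic _ _ _) (monic_weierstrass_cubic _ _ _) ew' sm' hO nO' _ ru (N := 3) isT.
- by rewrite -F1E'.
- have Ok c1 : O (k c1) by exact: place_const.
  have OM := subringM hO.1.1; have OD := subringD hO.1.1.
  have Oxi := nonunits_sub hO.1 mx'.
  have Oyx := leading_term_integral hO (pole_y_leading_B hO nO' e').
  rewrite u2 mulrDl; apply: (OD); rewrite -mulrA; apply: (OM) => //.
  by rewrite (_ : x' ^+ 2 / x' ^+ 3 = x'^-1); [|field].
have zE2 : z = k al * z' + k be * y' + k ga * x' + k de.
  by rewrite zz' uE wE [LHS]addrC !addrA.
have [kb kab _ de0] := coefficients_zB ntx' e' zE zE' xE yE zE2.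
exists al, p, be, ga; split=> //.
  rewrite /constraint_B -(char2_addxx h2K (al ^+ 2 * (a' * b'))) {2}kab.
  rewrite (_ : al ^+ 2 * (a' * b') = (al ^+ 2 * b') * a'); last by ring.
  by rewrite kb a'E; char2_ring h2K.
by split=> //; rewrite zE2 de0 rmorph0 addr0.
Qed.

Lemma transformation_B_rules alpha sigma beta gamma :
  normal_form_B k j x y z a eta b c -> normal_form_B k j' x' y' z' a' eta' b' c' ->
  alpha != 0 -> transformation_B k x y z x' y' z' alpha sigma beta gamma ->
  rules_B a eta b c a' eta' b' c' alpha sigma beta.
Proof.
move=> nf nf' al0 [xE yE zzE].
have ntx' : ~ algebraicOver k x' by exact: (normal_form_B_transcendental _ _ nf').
have := nf; case=> _ e _ _ [zE _ _].
have := nf'; case=> _ e' _ _ [zE' _ _].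
have xE' : x = k 1 * x' + k 0 by rewrite rmorph1 rmorph0 mul1r addr0.
have yE' : y = k 1 * y' + k sigma * x' + k 0 by rewrite rmorph1 rmorph0 mul1r addr0.
have zE'' : z = k alpha * z' + k beta * y' + k gamma * x' + k 0.
  by rewrite rmorph0 addr0.
have [_ [k2 k1]] := coefficients_B ntx' e e' xE' yE'.
have [cb _ cc _] := coefficients_zB ntx' e' zE zE' xE yE zE''.
split=> //.
  by move: k1; rewrite expr1n !expr0n /= !(mul1r, mulr0, mul0r, add0r, mulr1).
move: k2; rewrite !expr1n !(mul1r, mulr0, mulr1, addr0) => ->.
by char2_ring h2K.
Qed.

Lemma normal_form_B_transfer alpha sigma beta gamma :
  alpha != 0 -> constraint_B a b sigma beta gamma ->
  transformation_B k x y z x' y' z' alpha sigma beta gamma ->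
  rules_B a eta b c a' eta' b' c' alpha sigma beta ->
  (j = eta ^- 2 <-> j' = eta' ^- 2) ->
  normal_form_B k j x y z a eta b c <-> normal_form_B k j' x' y' z' a' eta' b' c'.
Proof.
move=> al0 con [xE yE zE] [reta ra rb rc] jj'.
have al2 : alpha ^+ 2 != 0 by rewrite expf_neq0.
have adjE : adjoin k [set x; y] = adjoin k [set x'; y'].
  apply: (@adjoin_affine _ _ _ _ 1 0 1 sigma 0); rewrite ?oner_eq0 //.
    by rewrite rmorph1 rmorph0 mul1r addr0.
  by rewrite rmorph1 rmorph0 mul1r addr0.
have curve_eq : (y ^+ 2 + x * y) + (x ^+ 3 + k a * x ^+ 2 + k eta * x)
    = (y' ^+ 2 + x' * y') + (x' ^+ 3 + k a' * x' ^+ 2 + k eta' * x').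
  by rewrite reta ra xE yE !(rmorphD, rmorphXn) /=; char2_ring h2.
have curve : curve_B k x y a eta <-> curve_B k x' y' a' eta'.
  split=> e; apply: (char2_eqD h2).
    by rewrite -curve_eq e (char2_addxx h2).
  by rewrite curve_eq e (char2_addxx h2).
have kal2 : k alpha ^+ 2 != 0 by rewrite expf_neq0 // fmorph_eq0.
have zeq : z ^+ 2 + (k b * y ^+ 2 + k (a * b) * x ^+ 2 + k c * x)
    = k alpha ^+ 2 * (z' ^+ 2 + (k b' * y' ^+ 2 + k (a' * b') * x' ^+ 2 + k c' * x')).
  have e1 : k alpha ^+ 2 * k b' = k b + k beta ^+ 2.
    by rewrite -!rmorphXn -!rmorphM -rmorphD rb.
  have e2 : k alpha ^+ 2 * k (a' * b') = k (a * b + b * sigma ^+ 2 + gamma ^+ 2).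
    rewrite -rmorphXn -rmorphM; congr (k _).
    rewrite (_ : alpha ^+ 2 * (a' * b') = (alpha ^+ 2 * b') * a'); last by ring.
    by rewrite rb ra; apply: (char2_eq_lin h2K (c := 1) con); char2_ring h2K.
  have e3 : k alpha ^+ 2 * k c' = k c by rewrite -!rmorphXn -!rmorphM rc.
  rewrite !mulrDr ![k alpha ^+ 2 * (_ * _)]mulrA e1 e2 e3 zE xE yE !(rmorphD, rmorphM, rmorphXn) /=.
  by char2_ring h2.
have zcurve : z ^+ 2 = k b * y ^+ 2 + k (a * b) * x ^+ 2 + k c * x <->
    z' ^+ 2 = k b' * y' ^+ 2 + k (a' * b') * x' ^+ 2 + k c' * x'.
  split=> e.
    apply: (char2_eqD h2); apply: (mulfI kal2).
    by rewrite -zeq e (char2_addxx h2) mulr0.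
  by apply: (char2_eqD h2); rewrite zeq e (char2_addxx h2) mulr0.
have genE : F1 = adjoin k [set x'; y'] ->
    gen_subfield (F1 `|` [set z]) = gen_subfield (F1 `|` [set z']).
  move=> F1E; apply: (gen_subfield_affine (u := k beta * y' + k gamma * x') (al := alpha)) => //.
  - exact: adjoin_const.
  - have hF := frobenius_subfield k; have Fk c1 : F1 (k c1) by exact: frobenius_const.
    have F1x' : F1 x' by rewrite F1E; exact: curve_x.
    have F1y' : F1 y' by rewrite F1E; exact: curve_y.
    have FM := subringM hF.1; have FD := subringD hF.1; auto.
  - by rewrite zE addrA.
have sq : (exists e, b = e ^+ 2) <-> (exists e, b' = e ^+ 2).
  split=> -[e eE].
    exists (alpha^-1 * (e + beta)); apply: (mulfI al2).
    by rewrite rb eE (_ : alpha ^+ 2 * _ = (e + beta) ^+ 2); [char2_ring h2K|field].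
  exists (alpha * e + beta).
  by rewrite (char2_sqrD h2K) exprMn -eE rb; char2_ring h2K.
have c0E : (c != 0) = (c' != 0) by rewrite -rc mulf_eq0 (negPf al2).
split=> -[F1E e [eta0 jE] gz [ez nb c0]].
  split; rewrite -?adjE -?c0E //; first exact/curve.
  - by rewrite reta; split=> //; rewrite -reta; exact/jj'.
  - by rewrite -genE // -adjE.
  - by split=> //; [exact/zcurve|move=> /sq].
split; rewrite ?adjE ?c0E //; first exact/curve.
- by rewrite -reta; split=> //; rewrite reta; exact/jj'.
- by rewrite genE.
- by split=> //; [exact/zcurve|move=> /sq].
Qed.

End FamilyB.
End Transformations.

(** * Isomorphisms *)

Section Isomorphisms.
Variables (K F F' : fieldType) (k : {rmorphism K -> F}) (k' : {rmorphism K -> F'}).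

Lemma gen_subfield_image (phi : {rmorphism F -> F'}) (S : set F) :
  phi @` gen_subfield S = gen_subfield (phi @` S).
Proof.
have hS := gen_subfield_subfield S; have hS' := gen_subfield_subfield (phi @` S).
apply/seteqP; split.
  move=> _ [f Sf <-]; move: f Sf.
  apply: (gen_subfield_min (L := [set f | gen_subfield (phi @` S) (phi f)])).
    split; first split.
    - by rewrite /= rmorph1; exact: (subring1 hS'.1).
    - by move=> f g; rewrite /= rmorphB; exact: (subringB hS'.1).
    - by move=> f g; rewrite /= rmorphM; exact: (subringM hS'.1).
    - by move=> f; rewrite /= fmorphV; exact: hS'.2.
  by move=> f Sf; apply: gen_subfield_sub; exists f.
apply: gen_subfield_min.
  split; first split.
  - by exists 1; [exact: (subring1 hS.1)|rewrite rmorph1].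
  - move=> _ _ [f Sf <-] [g Sg <-]; exists (f - g); last by rewrite rmorphB.
    exact: (subringB hS.1).
  - move=> _ _ [f Sf <-] [g Sg <-]; exists (f * g); last by rewrite rmorphM.
    exact: (subringM hS.1).
  - by move=> _ [f Sf <-]; exists f^-1; [exact: hS.2|rewrite fmorphV].
by move=> _ [f Sf <-]; exists f => //; exact: gen_subfield_sub.
Qed.

Section Transport.
Variables (phi : {rmorphism F -> F'}).
Hypotheses (bij : bijective phi) (phik : forall c, phi (k c) = k' c).

Lemma adjoin_image (S : set F) : phi @` adjoin k S = adjoin k' (phi @` S).
Proof.
rewrite /adjoin gen_subfield_image image_setU; congr (gen_subfield (_ `|` _)).
apply/seteqP; split.
  by move=> _ [_ [c _ <-] <-]; exists c; rewrite ?phik.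
by move=> _ [c _ <-]; exists (k c); [exists c|rewrite phik].
Qed.

Lemma frobenius_image : phi @` frobenius_pullback k = frobenius_pullback k'.
Proof.
rewrite /frobenius_pullback adjoin_image; congr (adjoin _ _).
have [psi _ psiK] := bij.
apply/seteqP; split.
  by move=> _ [_ [f _ <-] <-]; exists (phi f); rewrite ?rmorphXn.
by move=> _ [f _ <-]; exists (psi f ^+ 2); [exists (psi f)|rewrite rmorphXn psiK].
Qed.

Lemma adjoin_pair_image x y : phi @` adjoin k [set x; y] = adjoin k' [set phi x; phi y].
Proof. by rewrite adjoin_image image_setU !image_set1. Qed.

Lemma generator_image z : gen_subfield (frobenius_pullback k `|` [set z]) = setT ->
  gen_subfield (frobenius_pullback k' `|` [set phi z]) = setT.
Proof.
rewrite -frobenius_image -(image_set1 phi) -image_setU -gen_subfield_image => ->.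
have [psi _ psiK] := bij.
by apply/seteqP; split=> // f _; exists (psi f).
Qed.

Lemma normal_form_A_image x y z a a4 a6 b d : normal_form_A k x y z a a4 a6 b d ->
  normal_form_A k' (phi x) (phi y) (phi z) a a4 a6 b d.
Proof.
case=> F1E [e a0] gz ez nb; split=> //.
- by rewrite -frobenius_image F1E adjoin_pair_image.
- split=> //; have := congr1 phi e.
  by rewrite !(rmorphD, rmorphM, rmorphXn) /= !phik.
- exact: generator_image.
- by have := congr1 phi ez; rewrite !(rmorphD, rmorphM, rmorphXn) /= !phik.
Qed.

Lemma normal_form_B_image j x y z a eta b c : normal_form_B k j x y z a eta b c ->
  normal_form_B k' j (phi x) (phi y) (phi z) a eta b c.
Proof.
case=> F1E e je gz [ez nb c0]; split=> //.
- by rewrite -frobenius_image F1E adjoin_pair_image.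
- by have := congr1 phi e; rewrite !(rmorphD, rmorphM, rmorphXn) /= !phik.
- exact: generator_image.
- split=> //; have := congr1 phi ez.
  by rewrite !(rmorphD, rmorphM, rmorphXn) /= !phik.
Qed.

End Transport.

Section Tower.
Hypotheses (h2 : 2%:R = 0 :> F) (h2' : 2%:R = 0 :> F').
Variables (x y z : F) (x' y' z' : F') (L C : {poly K}).
Hypotheses (sL : (size L <= 2)%N) (sC : size C = 4%N) (mC : C \is monic).
Hypothesis eqn : y ^+ 2 + peval k x L * y = peval k x C.
Hypothesis eqn' : y' ^+ 2 + peval k' x' L * y' = peval k' x' C.
Hypotheses (ntx : ~ algebraicOver k x) (ntx' : ~ algebraicOver k' x').
Local Notation E := (adjoin k [set x; y]).
Local Notation E' := (adjoin k' [set x'; y']).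
Local Notation G0 := (rational_iso k k' x x').
Local Notation G1 := (quadratic_iso G0 y y').
Hypothesis Gz : G1 (z ^+ 2) (z' ^+ 2).
Hypotheses (nz : ~ E z) (nz' : ~ E' z').
Hypothesis genz : forall f, quadratic_extension E z f.
Hypothesis genz' : forall f, quadratic_extension E' z' f.

Let peval_iso P : G0 (peval k x P) (peval k' x' P).
Proof. by exists P, 1; rewrite !peval1 !divr1 oner_neq0. Qed.

Let hG0 : is_partial_iso G0.
Proof. by apply: rational_partial_iso => P; exact: peval_transcendental. Qed.

Let hG1 : is_partial_iso G1.
Proof.
apply: (quadratic_partial_iso hG0 (l := - peval k x L) (c := peval k x C)
  (l' := - peval k' x' L) (c' := peval k' x' C)).
- by apply: (pisoN hG0); exact: peval_iso.
- exact: peval_iso.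
- by rewrite -eqn; ring.
- by rewrite -eqn'; ring.
- move=> f [P [R [R0 yE _]]]; apply: (curve_y_irrational sL sC mC eqn ntx).
  by exists P, R; split=> //; exact: peval_transcendental.
- move=> f [P [R [R0 _ yE]]]; apply: (curve_y_irrational sL sC mC eqn' ntx').
  by exists P, R; split=> //; exact: peval_transcendental.
Qed.

Let G1_left f f' : G1 f f' -> E f.
Proof.
move=> [p [p' [q [q' [[P [R [R0 pE _]]] [Q [S [S0 qE _]]] fE _]]]]].
rewrite (curve_quadratic h2 eqn); exists p, q; split=> //.
  by exists P, R; split=> //; exact: peval_transcendental.
by exists Q, S; split=> //; exact: peval_transcendental.
Qed.

Let G1_right f f' : G1 f f' -> E' f'.
Proof.
move=> [p [p' [q [q' [[P [R [R0 _ pE]]] [Q [S [S0 _ qE]]] _ fE]]]]].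
rewrite (curve_quadratic h2' eqn'); exists p', q'; split=> //.
  by exists P, R; split=> //; exact: peval_transcendental.
by exists Q, S; split=> //; exact: peval_transcendental.
Qed.

Let G1_total f : E f -> exists f', G1 f f'.
Proof.
rewrite (curve_quadratic h2 eqn) => -[_ [_ [[P [R [R0 ->]]] [Q [S [S0 ->]]] ->]]].
exists (peval k' x' P / peval k' x' R + peval k' x' Q / peval k' x' S * y').
eexists; eexists; eexists; eexists; split; [| |by []|by []].
  by exists P, R; split=> //; apply: contra_neq R0 => ->; rewrite peval0.
by exists Q, S; split=> //; apply: contra_neq S0 => ->; rewrite peval0.
Qed.

Let G1_onto f' : E' f' -> exists f, G1 f f'.
Proof.
rewrite (curve_quadratic h2' eqn') => -[_ [_ [[P [R [R0 ->]]] [Q [S [S0 ->]]] ->]]].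
exists (peval k x P / peval k x R + peval k x Q / peval k x S * y).
eexists; eexists; eexists; eexists; split; [| |by []|by []].
  by exists P, R; split=> //; apply: contra_neq R0 => ->; rewrite peval0.
by exists Q, S; split=> //; apply: contra_neq S0 => ->; rewrite peval0.
Qed.

(** The isomorphism [K(x) -> K(x')] extends through the two quadratic extensions; the
    irreducibility needed at each step is [nz], [nz'] and [curve_y_irrational]. *)
Lemma tower_isomorphism : isomorphic_over k k'.
Proof.
have hG2 : is_partial_iso (quadratic_iso G1 z z').
  apply: (quadratic_partial_iso hG1 (l := 0) (c := z ^+ 2) (l' := 0) (c' := z' ^+ 2)) => //.
  - exact: (piso0 hG1).
  - by rewrite mul0r add0r.
  - by rewrite mul0r add0r.
  - by move=> f /G1_left.
  - by move=> f /G1_right.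
have [||phi [bij phiP]] := partial_iso_total hG2.
- move=> f; have [p [q [/G1_total [p' Gp] /G1_total [q' Gq] ->]]] := genz f.
  by exists (p' + q' * z'), p, p', q, q'.
- move=> f; have [p' [q' [/G1_onto [p Gp] /G1_onto [q Gq] ->]]] := genz' f.
  by exists (p + q * z), p, p', q, q'.
exists phi; split=> // c; apply: (piso_fun hG2 (phiP (k c))).
apply: (quadratic_iso_base hG1); apply: (quadratic_iso_base hG0).
by rewrite -(pevalC k x) -(pevalC k' x'); exact: peval_iso.
Qed.

End Tower.

Section NormalFormIsomorphism.
Hypotheses (h2 : 2%:R = 0 :> F) (h2' : 2%:R = 0 :> F').
Hypothesis constants_closed : forall f, algebraicOver k f -> exists c, f = k c.
Hypothesis constants_closed' : forall f, algebraicOver k' f -> exists c, f = k' c.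
Hypothesis transcendental_exists : exists t, ~ algebraicOver k t.
Hypothesis transcendental_exists' : exists t, ~ algebraicOver k' t.

Let rational_sub (x y : F) (x' y' : F') P :
  quadratic_iso (rational_iso k k' x x') y y' (peval k x P) (peval k' x' P).
Proof.
exists (peval k x P), (peval k' x' P), 0, 0; split; rewrite ?mul0r ?addr0 //.
  by exists P, 1; rewrite !peval1 !divr1 oner_neq0.
by exists 0, 1; rewrite !peval1 !peval0 !divr1 oner_neq0.
Qed.

Lemma normal_form_A_isomorphism x y z x' y' z' a a4 a6 b d :
  normal_form_A k x y z a a4 a6 b d -> normal_form_A k' x' y' z' a a4 a6 b d ->
  isomorphic_over k k'.
Proof.
move=> nf nf'.
have ntx : ~ algebraicOver k x by exact: (normal_form_A_transcendental _ _ nf).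
have ntx' : ~ algebraicOver k' x' by exact: (normal_form_A_transcendental _ _ nf').
have nz := normal_form_A_z_notin h2 constants_closed transcendental_exists nf.
have nz' := normal_form_A_z_notin h2' constants_closed' transcendental_exists' nf'.
have := nf; case=> F1E [e _] gz ez _; have := nf'; case=> F1E' [e' _] gz' ez' _.
rewrite F1E in nz; rewrite F1E' in nz'.
apply: (tower_isomorphism h2 h2' (size_weierstrass_trace _ _) (size_weierstrass_cubic _ _ _)
  (monic_weierstrass_cubic _ _ _) (curve_A_weierstrass e) (curve_A_weierstrass e') ntx ntx' _ nz nz').
- rewrite ez ez'; have := rational_sub x y x' y' (b *: 'X^2 + a^-1 *: 'X + d%:P).
  by rewrite !pevalE.
- by rewrite -F1E; exact: generated_quadratic.
- by rewrite -F1E'; exact: generated_quadratic.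
Qed.

Lemma normal_form_B_isomorphism j j' x y z x' y' z' a eta b c :
  normal_form_B k j x y z a eta b c -> normal_form_B k' j' x' y' z' a eta b c ->
  isomorphic_over k k'.
Proof.
move=> nf nf'.
have ntx : ~ algebraicOver k x by exact: (normal_form_B_transcendental _ _ nf).
have ntx' : ~ algebraicOver k' x' by exact: (normal_form_B_transcendental _ _ nf').
have nz := normal_form_B_z_notin h2 constants_closed transcendental_exists nf.
have nz' := normal_form_B_z_notin h2' constants_closed' transcendental_exists' nf'.
have := nf; case=> F1E e _ gz [ez _ _]; have := nf'; case=> F1E' e' _ gz' [ez' _ _].
rewrite F1E in nz; rewrite F1E' in nz'.
apply: (tower_isomorphism h2 h2' (size_weierstrass_trace _ _) (size_weierstrass_cubic _ _ _)
  (monic_weierstrass_cubic _ _ _) (curve_B_weierstrass e) (curve_B_weierstrass e') ntx ntx' _ nz nz').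
- (* [y^2] is replaced by a function linear in [y] *)
  rewrite (_ : z ^+ 2 = peval k x (b *: ('X^3 + a *: 'X^2 + eta *: 'X) + (a * b) *: 'X^2 + c *: 'X)
    + peval k x (- b *: 'X) * y); last first.
    by rewrite ez !pevalE -e; ring.
  rewrite (_ : z' ^+ 2 = peval k' x' (b *: ('X^3 + a *: 'X^2 + eta *: 'X) + (a * b) *: 'X^2 + c *: 'X)
    + peval k' x' (- b *: 'X) * y'); last first.
    by rewrite ez' !pevalE -e'; ring.
  do 4!eexists; split; [| |by []|by []].
    by eexists; exists 1; rewrite !peval1 !divr1 oner_neq0.
  by eexists; exists 1; rewrite !peval1 !divr1 oner_neq0.
- by rewrite -F1E; exact: generated_quadratic.
- by rewrite -F1E'; exact: generated_quadratic.
Qed.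

End NormalFormIsomorphism.
End Isomorphisms.

Lemma genus3_setting_constants (K F : fieldType) (k : {rmorphism K -> F}) (j : K) :
  genus3_setting k j -> [/\ 2%:R = 0 :> F,
    forall f, algebraicOver k f -> exists c, f = k c & exists t, ~ algebraicOver k t].
Proof.
case=> ch [_ [t [nt _]] cl] _ _; split=> //; last by exists t.
by rewrite -(rmorph_nat k) (pcharf0 ch) rmorph0.
Qed.

(** * Uniqueness of normal forms and the isomorphism criterion *)

Unset Implicit Arguments.
Local Close Scope classical_set_scope.

Theorem corollary2p2
    (K F : fieldType) (k : {rmorphism K -> F}) (j : K)
    (hF : genus3_setting k j) :
  (* (a) *)
  (j = 0 ->
   forall (x y z : F) (a a4 a6 b d : K),
   normal_form_A k x y z a a4 a6 b d ->
   [/\ forall x' y' z' : F,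
         (exists a' a4' a6' b' d' : K,
            normal_form_A k x' y' z' a' a4' a6' b' d') <->
         (exists alpha sigma tau gamma delta : K, alpha != 0 /\
            transformation_A k x y z x' y' z' alpha sigma tau gamma delta),
       forall (x' y' z' : F) (a' a4' a6' b' d' : K)
              (alpha sigma tau gamma delta : K),
         normal_form_A k x' y' z' a' a4' a6' b' d' ->
         alpha != 0 ->
         transformation_A k x y z x' y' z' alpha sigma tau gamma delta ->
         rules_A a a4 a6 b d a' a4' a6' b' d' alpha sigma tau gamma delta
     & forall (F' : fieldType) (k' : {rmorphism K -> F'})
              (x' y' z' : F') (a' a4' a6' b' d' : K),
         genus3_setting k' 0 ->
         normal_form_A k' x' y' z' a' a4' a6' b' d' ->
         isomorphic_over k k' <->
         exists alpha sigma tau gamma delta : K, alpha != 0 /\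
           rules_A a a4 a6 b d a' a4' a6' b' d' alpha sigma tau gamma delta])
  /\
  (* (b) *)
  (j != 0 ->
   forall (x y z : F) (a eta b c : K),
   normal_form_B k j x y z a eta b c ->
   [/\ forall x' y' z' : F,
         (exists a' eta' b' c' : K,
            normal_form_B k j x' y' z' a' eta' b' c') <->
         (exists alpha sigma beta gamma : K,
            [/\ alpha != 0, constraint_B a b sigma beta gamma
              & transformation_B k x y z x' y' z' alpha sigma beta gamma]),
       forall (x' y' z' : F) (a' eta' b' c' : K)
              (alpha sigma beta gamma : K),
         normal_form_B k j x' y' z' a' eta' b' c' ->
         alpha != 0 ->
         constraint_B a b sigma beta gamma ->
         transformation_B k x y z x' y' z' alpha sigma beta gamma ->
         rules_B a eta b c a' eta' b' c' alpha sigma beta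
     & forall (F' : fieldType) (k' : {rmorphism K -> F'}) (j' : K)
              (x' y' z' : F') (a' eta' b' c' : K),
         genus3_setting k' j' -> j' != 0 ->
         normal_form_B k' j' x' y' z' a' eta' b' c' ->
         isomorphic_over k k' <->
         exists alpha sigma beta gamma : K,
           [/\ alpha != 0, constraint_B a b sigma beta gamma
             & rules_B a eta b c a' eta' b' c' alpha sigma beta]]).
Proof.
have [h2 cl nt] := genus3_setting_constants hF.
split=> _.
  move=> x y z a a4 a6 b d nf; split.
  - move=> x' y' z'; split=> [[a' [a4' [a6' [b' [d' nf']]]]]|].
      exact: transformation_A_exists nf nf'.
    move=> [al [s [t [g [e [al0 tr]]]]]].
    exists (al ^+ 6 * a), (al ^+ 8 * (a4 + s * a + s ^+ 4)),
      (al ^+ 12 * (a6 + s ^+ 2 * a4 + t * a + s ^+ 6 + t ^+ 2)),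
      (al ^- 2 * (al ^- 8 * b + g ^+ 2)),
      (al ^- 2 * (d + s ^+ 4 * b + s ^+ 2 * a^-1 + e ^+ 2)).
    apply: ((normal_form_A_transfer h2 al0 tr _).1 nf).
    by split; rewrite ?mulKf ?mulVKf ?expf_neq0.
  - move=> x' y' z' a' a4' a6' b' d' al s t g e nf' al0 tr.
    exact: transformation_A_rules nf nf' al0 tr.
  - move=> F' k' x' y' z' a' a4' a6' b' d' hF' nf'.
    have [h2' cl' nt'] := genus3_setting_constants hF'.
    split=> [[phi [bij phik]]|].
      have nfi := normal_form_A_image bij phik nf.
      have [al [s [t [g [e [al0 tr]]]]]] := transformation_A_exists h2' cl' nt' nfi nf'.
      exists al, s, t, g, e; split=> //.
      exact: transformation_A_rules nfi nf' al0 tr.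
    move=> [al [s [t [g [e [al0 ru]]]]]].
    pose X := k' (al ^- 4) * x' + k' (s ^+ 2).
    pose Y := k' (al ^- 6) * y' + k' (s * al ^- 4) * x' + k' t.
    pose Z := k' al * z' + k' g * x' + k' e.
    have tr : transformation_A k' X Y Z x' y' z' al s t g e by [].
    apply: (normal_form_A_isomorphism h2 h2' cl cl' nt nt' nf).
    exact: ((normal_form_A_transfer h2' al0 tr ru).2 nf').
move=> x y z a eta b c nf; split.
- move=> x' y' z'; split=> [[a' [eta' [b' [c' nf']]]]|].
    exact: transformation_B_exists nf nf'.
  move=> [al [s [be [g [al0 con tr]]]]].
  exists (a + s + s ^+ 2), eta, (al ^- 2 * (b + be ^+ 2)), (al ^- 2 * c).
  apply: ((normal_form_B_transfer h2 al0 con tr _ _).1 nf) => //.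
  by split; rewrite ?mulVKf ?expf_neq0.
- move=> x' y' z' a' eta' b' c' al s be g nf' al0 con tr.
  exact: transformation_B_rules nf nf' al0 tr.
- move=> F' k' j' x' y' z' a' eta' b' c' hF' _ nf'.
  have [h2' cl' nt'] := genus3_setting_constants hF'.
  split=> [[phi [bij phik]]|].
    have nfi := normal_form_B_image bij phik nf.
    have [al [s [be [g [al0 con tr]]]]] := transformation_B_exists h2' cl' nt' nfi nf'.
    exists al, s, be, g; split=> //.
    exact: transformation_B_rules nfi nf' al0 tr.
  move=> [al [s [be [g [al0 con ru]]]]].
  pose X := x'.
  pose Y := y' + k' s * x'.
  pose Z := k' al * z' + k' be * y' + k' g * x'.
  have tr : transformation_B k' X Y Z x' y' z' al s be g by [].
  apply: (normal_form_B_isomorphism (j' := eta ^- 2) h2 h2' cl cl' nt nt' nf).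
  apply: ((normal_form_B_transfer h2' al0 con tr ru _).2 nf').
  have [etaE _ _ _] := ru; rewrite etaE.
  by have := nf'; case=> _ _ [_ ->]; rewrite etaE.
Qed.
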